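(* Let $1<s\le 2$ and let $X$ be a Banach space with martingale type $s$. (1) If $s\le p<\infty$, then there is a constant $C$ depending only on $p,s,X$ such that for every simple, adapted $X$-valued process $\phi$ and every $B\in\mathcal{J}$, $$\Big(\mathbb{E}\sup_{t>0}\Big\|\int_{(0,t]\times B}\phi\,\mathrm{d}\tilde N\Big\|_X^p\Big)^{1/p}\le C\,\|\phi\mathbf 1_B\|_{\mathcal{D}^p_{s,X}\cap\mathcal{D}^p_{p,X}}.$$ (2) If $1<p\le s$, then there is a constant $C$ depending only on $p,s,X$ such that for every simple, adapted $X$-valued process $\phi$ and every $B\in\mathcal{J}$, $$\Big(\mathbb{E}\sup_{t>0}\Big\|\int_{(0,t]\times B}\phi\,\mathrm{d}\tilde N\Big\|_X^p\Big)^{1/p}\le C\,\|\phi\mathbf 1_B\|_{\mathcal{D}^p_{s,X}+\mathcal{D}^p_{p,X}}.$$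
   Context: Martingale type: for $1\le s\le 2$, a Banach space $X$ has martingale type $s$ if there is a constant $C$ such that every finite martingale difference sequence $(d_i)$ in $L^s(\Omega;X)$ satisfies $(\mathbb{E}\|\sum_i d_i\|_X^s)^{1/s}\le C(\sum_i\mathbb{E}\|d_i\|_X^s)^{1/s}$. Poisson random measure: let $(\Omega,\mathcal{F},\mathbb{P})$ be a probability space. A Poisson random measure on a measurable space $(E,\mathcal{E})$ with $\sigma$-finite intensity measure $\mu$ is a map $N:\Omega\times\mathcal{E}\to\mathbb{N}\cup\{\infty\}$ such that $N(B)$ is a random variable for each $B\in\mathcal{E}$, $N(\omega,\cdot)$ is a measure for each $\omega$, $N(B)$ is Poisson distributed with parameter $\mu(B)$ for each $B$ ($N(B)=\infty$ a.s. if $\mu(B)=\infty$), and $N(B_1),\dots,N(B_n)$ are independent for pairwise disjoint $B_1,\dots,B_n\in\mathcal{E}$. For $\mu(B)<\infty$ put $\tilde N(B):=N(B)-\mu(B)$. Setting: $(J,\mathcal{J},\nu)$ is a $\sigma$-finite measure space and $N$ is a Poisson random measure on $(\mathbb{R}_+\times J,\mathcal{B}(\mathbb{R}_+)\times\mathcal{J})$ with intensity measure $dt\times\nu$. $\mathcal{F}_t$ is the $\sigma$-algebra generated by the random variables $N((s,u]\times A)$, $0\le s<u\le t$, $A\in\mathcal{J}$ ($\mathcal{F}_0$ is trivial). Simple adapted processes: a simple, adapted $X$-valued process is a map $\phi:\Omega\times\mathbb{R}_+\times J\to X$ of the form $\phi=\sum_{i=1}^l\sum_{j=1}^m\sum_{k=1}^n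 F_{ijk}\mathbf 1_{(t_i,t_{i+1}]}\mathbf 1_{A_j}x_{ijk}$ with $0=t_1<t_2<\dots<t_{l+1}<\infty$, $F_{ijk}\in L^\infty(\Omega,\mathcal{F}_{t_i})$, disjoint $A_1,\dots,A_m\in\mathcal{J}$ with $\nu(A_j)<\infty$, and $x_{ijk}\in X$. For $t>0$, $B\in\mathcal{J}$, $$\int_{(0,t]\times B}\phi\,\mathrm{d}\tilde N:=\sum_{i,j,k}F_{ijk}\,\tilde N((t_i\wedge t,t_{i+1}\wedge t]\times(A_j\cap B))\,x_{ijk}.$$ Norms: for $1\le p,q<\infty$, $\mathcal{D}^p_{q,X}:=L^p(\Omega;L^q(\mathbb{R}_+\times J;X))$, i.e. $\|\phi\|_{\mathcal{D}^p_{q,X}}=\big(\mathbb{E}(\int_{\mathbb{R}_+\times J}\|\phi\|_X^q\,dt\times d\nu)^{p/q}\big)^{1/p}$. The intersection of two such spaces carries the maximum of the two norms, and the sum carries the norm $\|\phi\|_{Y_0+Y_1}=\inf\{\|\phi_0\|_{Y_0}+\|\phi_1\|_{Y_1}:\phi=\phi_0+\phi_1\}$. *)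

(* Defs.v *)
From HB Require Import structures.
From mathcomp Require Import all_boot all_order all_algebra.
From mathcomp Require Import all_classical all_reals all_analysis.
From mathcomp Require Import measurable_realfun ess_sup_inf.
Set Implicit Arguments.
Unset Strict Implicit.
Unset Printing Implicit Defensive.
Import Order.TTheory GRing.Theory Num.Theory.
Import numFieldNormedType.Exports.
Local Open Scope classical_set_scope.
Local Open Scope ring_scope.

Section strong_measurability.
Context {R : realType} {X : normedModType R} {T : Type}.

Record step_function := StepFunction {
  step_size : nat;
  step_set : 'I_step_size -> set T;
  step_val : 'I_step_size -> X }.

Arguments step_set : clear implicits.
Arguments step_val : clear implicits.

Definition step_fun (f : step_function) (w : T) : X :=
  \sum_i (\1_(step_set f i) w : R) *: step_val f i.

Definition step_measurable (G : set_system T) (f : step_function) : Prop :=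
  forall i, G (step_set f i).

Definition strongly_measurable (G : set_system T) (f : T -> X) : Prop :=
  exists g : nat -> step_function,
    (forall n, step_measurable G (g n)) /\
    (forall w, step_fun (g n) w @[n --> \oo] --> f w).

End strong_measurability.
Arguments step_function : clear implicits.
Arguments step_function {R} X T.
Arguments step_set {R X T}.
Arguments step_val {R X T}.

Section martingale_type.
Context {R : realType} {X : normedModType R}.
Local Open Scope ereal_scope.

Section bochner.
Context {d : measure_display} {T : measurableType d} (P : probability T R).

Definition step_integral (f : step_function X T) : X :=
  (\sum_i fine (P (step_set f i)) *: step_val f i)%R.

Definition has_bochner_integral (f : T -> X) (v : X) : Prop :=
  strongly_measurable measurable f /\
  exists g : nat -> step_function X T,
    [/\ forall n, step_measurable measurable (g n),
        \int[P]_w (`|f w - step_fun (g n) w|%R)%:E @[n --> \oo] --> 0 &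
        step_integral (g n) @[n --> \oo] --> v].

Definition is_cond_exp (G : set_system T) (f g : T -> X) : Prop :=
  strongly_measurable G g /\
  forall A, G A -> exists v,
    has_bochner_integral (fun w => (\1_A w : R) *: f w)%R v /\
    has_bochner_integral (fun w => (\1_A w : R) *: g w)%R v.

(* The differences are [D 0, ..., D n.-1]; [D i] is measurable with respect to
   [F i.+1] and centred given [F i]. *)
Definition martingale_difference (n : nat) (F : nat -> set_system T)
    (D : nat -> T -> X) : Prop :=
  [/\ forall i, (i <= n)%N ->
        sigma_algebra [set: T] (F i) /\ F i `<=` measurable,
      forall i, (i < n)%N -> F i `<=` F i.+1 &
      forall i, (i < n)%N ->
        strongly_measurable (F i.+1) (D i) /\ is_cond_exp (F i) (D i) (cst 0%R)].

End bochner.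

Definition martingale_type (s : R) : Prop :=
  exists C : R,
  forall (d : measure_display) (T : measurableType d) (P : probability T R)
    (n : nat) (F : nat -> set_system T) (D : nat -> T -> X),
  martingale_difference P n F D ->
  (forall i, (i < n)%N -> \int[P]_w ((`|D i w| `^ s)%R)%:E < +oo) ->
  (\int[P]_w ((`|\sum_(i < n) D i w| `^ s)%R)%:E) `^ s^-1
    <= C%:E * (\sum_(i < n) \int[P]_w ((`|D i w| `^ s)%R)%:E) `^ s^-1.

End martingale_type.
Arguments martingale_type {R} X s.

Section poisson_random_measure.
Context {R : realType} {d : measure_display} {T : measurableType d}
  (P : probability T R).
Local Open Scope ereal_scope.

Definition mutually_independent {d' : measure_display} {U : measurableType d'}
    (n : nat) (Z : 'I_n -> T -> U) : Prop :=
  forall Y : 'I_n -> set U, (forall i, measurable (Y i)) ->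
    P [set w | forall i, Y i (Z i w)] = \prod_(i < n) P [set w | Y i (Z i w)].

(* The library's [poisson_pmf] is constantly 1 at rate 0, whereas the Poisson
   law of parameter 0 is the Dirac mass at 0; hence the explicit formula. *)
Definition poisson_distributed (Z : T -> \bar R) (r : R) : Prop :=
  forall k : nat,
    P [set w | Z w = (k%:R)%:E] = (expR (- r) * r ^+ k / (k`!)%:R)%:E.

(* A Poisson random measure on the measurable space consisting of the set [S]
   with the measurable subsets of [S]; the values of [N] and [mu] on sets not
   contained in [S] are irrelevant. *)
Record poisson_random_measure {dE : measure_display} {E : measurableType dE}
    (S : set E) (mu : {measure set E -> \bar R})
    (N : T -> {measure set E -> \bar R}) : Prop := PoissonRandomMeasure {
  prm_sigma_finite : sigma_finite S mu;
  prm_value : forall w B, measurable B -> B `<=` S ->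
    N w B = +oo \/ exists k : nat, N w B = (k%:R)%:E;
  prm_measurable : forall B, measurable B -> B `<=` S ->
    measurable_fun [set: T] (fun w => N w B);
  prm_poisson : forall B, measurable B -> B `<=` S -> mu B < +oo ->
    poisson_distributed (fun w => N w B) (fine (mu B));
  prm_infinite : forall B, measurable B -> B `<=` S -> mu B = +oo ->
    {ae P, forall w, N w B = +oo};
  prm_independent : forall (n : nat) (B : 'I_n -> set E),
    (forall i, measurable (B i) /\ B i `<=` S) -> trivIset [set: 'I_n] B ->
    mutually_independent (fun i w => N w (B i)) }.

(* Meant for [mu B < +oo], in which case [N w B] is almost surely finite. *)
Definition compensated {dE : measure_display} {E : measurableType dE}
    (mu : {measure set E -> \bar R}) (N : T -> {measure set E -> \bar R})
    (w : T) (B : set E) : R :=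
  fine (N w B - mu B).

End poisson_random_measure.

Section processes.
Context {R : realType} {X : normedModType R}
  {dJ : measure_display} {J : measurableType dJ}
  {d : measure_display} {T : measurableType d}.

(* [R_+ x J] as a subset of [R x J]; functions on [R_+ x J] are represented by
   functions on [R x J] whose values off this set are ignored. *)
Definition half_line_times : set (measurableTypeR R * J) :=
  [set z | (0 <= z.1 :> R)%R].

Definition history
    (N : T -> {measure set (measurableTypeR R * J) -> \bar R}) (t : R) :
    set_system T :=
  <<s [set C | exists (a b : R) (A : set J) (Y : set (\bar R)),
        [/\ (0 <= a)%R, (a < b)%R & (b <= t)%R] /\
        [/\ measurable A, measurable Y &
            C = [set w | Y (N w (`]a, b] `*` A))]]] >>.

(* Indices start at 0: [sp_t phi 0, ..., sp_t phi (sp_l phi)] is the time grid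
   and later values of [sp_t phi] are irrelevant. *)
Record simple_process := SimpleProcess {
  sp_l : nat;
  sp_m : nat;
  sp_n : nat;
  sp_t : nat -> R;
  sp_A : 'I_sp_m -> set J;
  sp_F : 'I_sp_l -> 'I_sp_m -> 'I_sp_n -> T -> R;
  sp_x : 'I_sp_l -> 'I_sp_m -> 'I_sp_n -> X }.

Arguments sp_A : clear implicits.
Arguments sp_F : clear implicits.
Arguments sp_x : clear implicits.

Definition sp_fun (phi : simple_process) (w : T)
    (z : measurableTypeR R * J) : X :=
  \sum_(i < sp_l phi) \sum_(j < sp_m phi) \sum_(k < sp_n phi)
    (sp_F phi i j k w * \1_(`]sp_t phi i, sp_t phi i.+1]%classic) z.1
       * \1_(sp_A phi j) z.2) *: sp_x phi i j k.

Record simple_adapted (P : probability T R) (nu : set J -> \bar R)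
    (N : T -> {measure set (measurableTypeR R * J) -> \bar R})
    (phi : simple_process) : Prop := SimpleAdapted {
  sp_t0 : sp_t phi 0%N = 0;
  sp_t_lt : forall i, (i < sp_l phi)%N -> sp_t phi i < sp_t phi i.+1;
  sp_A_measurable : forall j, measurable (sp_A phi j);
  sp_A_disjoint : trivIset [set: 'I_(sp_m phi)] (sp_A phi);
  sp_A_finite : forall j, (nu (sp_A phi j) < +oo)%E;
  sp_F_adapted : forall i j k,
    preimage_set_system [set: T] (sp_F phi i j k) measurable
      `<=` history N (sp_t phi i);
  sp_F_bounded : forall i j k,
    ('N[P]_+oo [EFin \o sp_F phi i j k] < +oo)%E }.

Definition sp_integral (nu : {sigma_finite_measure set J -> \bar R})
    (N : T -> {measure set (measurableTypeR R * J) -> \bar R})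
    (phi : simple_process) (B : set J) (t : R) (w : T) : X :=
  \sum_(i < sp_l phi) \sum_(j < sp_m phi) \sum_(k < sp_n phi)
    (sp_F phi i j k w *
     compensated (lebesgue_measure \x nu)%E N w
       (`]Num.min (sp_t phi i) t, Num.min (sp_t phi i.+1) t]
          `*` (sp_A phi j `&` B))) *: sp_x phi i j k.

End processes.
Arguments simple_process {R} X {dJ} J {d} T.
Arguments sp_A {R X dJ J d T}.
Arguments sp_F {R X dJ J d T}.
Arguments sp_x {R X dJ J d T}.

Section mixed_norms.
Context {R : realType} {X : normedModType R}
  {dJ : measure_display} {J : measurableType dJ}
  (nu : {sigma_finite_measure set J -> \bar R})
  {d : measure_display} {T : measurableType d} (P : probability T R).
Local Open Scope ereal_scope.
Implicit Types f : T -> measurableTypeR R * J -> X.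

Definition Dnorm (p q : R) f : \bar R :=
  (\int[P]_w
     (\int[lebesgue_measure \x nu]_(z in half_line_times)
        ((`|f w z| `^ q)%R)%:E) `^ (p / q)) `^ p^-1.

(* Jointly strongly measurable representatives of [L^p(Omega; L^q(R_+ x J; X))]:
   joint measurability is needed since [\int] is only a lower integral on
   non-measurable nonnegative functions. *)
Definition Dspace (p q : R) f : Prop :=
  strongly_measurable measurable
    (fun z : T * (measurableTypeR R * J) => f z.1 z.2) /\
  Dnorm p q f < +oo.

Definition Dcap_norm (p q0 q1 : R) f : \bar R :=
  maxe (Dnorm p q0 f) (Dnorm p q1 f).

Definition Dsum_norm (p q0 q1 : R) f : \bar R :=
  ereal_inf [set v | exists f0 f1,
    [/\ Dspace p q0 f0, Dspace p q1 f1,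
        {ae P, forall w, {ae lebesgue_measure \x nu, forall z,
           half_line_times z -> f w z = (f0 w z + f1 w z)%R}} &
        v = Dnorm p q0 f0 + Dnorm p q1 f1]].

Definition sp_restrict (phi : simple_process X J T) (B : set J) :
    T -> measurableTypeR R * J -> X :=
  fun w z => ((\1_B z.2 : R) *: sp_fun phi w z)%R.

Definition maximal_norm
    (N : T -> {measure set (measurableTypeR R * J) -> \bar R}) (p : R)
    (phi : simple_process X J T) (B : set J) : \bar R :=
  (\int[P]_w ereal_sup [set ((`|sp_integral nu N phi B t w| `^ p)%R)%:E
                         | t in [set t | (0 < t)%R]]) `^ p^-1.

End mixed_norms.

(* Main.v *)
(* The time axis times the sets A_j is cut into disjoint cells D_m of intensity
   at most 1 on which phi equals a vector f_m, measurable with respect to the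
   Poisson random measure off D_m, D_{m+1}, ... Sampled on the grid, the integral
   is the transform sum_m (N(D_m) - mu(D_m)) f_m. Its increments are martingale
   differences, so martingale type s gives the weak-type bound
   l^s P(max > l) <= K sum_m mu(D_m) E |f_m|^s, applied to stopped transforms.

   For p >= s, a good-lambda inequality bounds the maximal function in L^p by the
   s-energy (sum_m mu(D_m) |f_m|^s)^(1/s), which is the L^s norm of phi in time and
   space, and by the largest jump, whose p-th moment is at most that of
   (sum_m |N(D_m) - mu(D_m)|^p |f_m|^p)^(1/p). This is the intersection norm.

   For p < s, stopping at each level l gives
   P(max > 2 l) <= C E min(1, int psi(|phi| / l)) with psi(u) = min(u, u^s).
   Since psi(u + v) <= 4 (psi(u) + psi(v)), a decomposition phi = phi0 + phi1 may be
   inserted, and summing over dyadic levels gives E (int |phi0|^s)^(p/s) for the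
   first part and E int |phi1|^p for the second. For p = s the first case applies.

   Refining the grid, right continuity of the paths and Fatou's lemma yield the
   supremum over all times. *)
Require Import Defs.
From HB Require Import structures.
From mathcomp Require Import all_boot all_order all_algebra.
From mathcomp Require Import all_classical all_reals all_analysis.
From mathcomp Require Import measurable_realfun ess_sup_inf.
From mathcomp Require Import ring lra.
Import Order.TTheory GRing.Theory Num.Theory.
Import numFieldNormedType.Exports.
Local Open Scope classical_set_scope.
Local Open Scope ring_scope.
Set Implicit Arguments.
Unset Strict Implicit.
Unset Printing Implicit Defensive.

(** * Independence *)

(** The parts of a decomposition in the sum norm are jointly measurable but need not be adapted, so
    they have no stochastic integral. The tail must therefore be bounded in terms of [phi] alone, by
    a quantity that can be split afterwards: the integral of [psi], evaluated path by path.

    The bound on the intensity of a cell makes all constants independent of the grid: for a Poisson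
    variable of parameter r <= 1, the central moment of any order q >= 1 is at most a constant times
    r.

    Martingale type controls only the terminal value of a martingale. Stopping carries the event of
    a large maximum over to the terminal index. Every gate used depends only on the past of its
    cell, so a gated transform is again a martingale.

    The levels are eps * 2^k with k >= 0. Finite sums over them are finite without any moment
    assumption, so that half of such a sum can be absorbed, and eps tends to 0 at the end. For p < s
    the geometric sums over levels need p > 1, and their constants blow up as p tends to s. *)

Section independence.
Context {R : realType} {d : measure_display} {T : measurableType d}
  (P : probability T R).
Local Open Scope ereal_scope.

(** In [A], both sides are finite measures that agree on the pi-system [G], hence on the
    sigma-algebra it generates. *)
Lemma indep_sigma_algebra (G : set_system T) (E : set T) :
  G `<=` measurable -> setI_closed G -> G setT -> measurable E ->
  (forall A, G A -> P (A `&` E) = P A * P E) ->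
  forall A, <<s G >> A -> P (A `&` E) = P A * P E.
Proof.
move=> Gm GI GT mE GE A sA.
have fE0 : (0 <= fine (P E))%R by rewrite fine_ge0.
pose m2 := mscale (NngNum fE0) P.
have := @g_sigma_algebra_measure_unique _ R T G Gm (fun=> setT) (fun=> GT) _
  (mrestr P mE) m2 GI _ _ A sA.
rewrite /= /m2 /mscale /= /mrestr => ->.
- by rewrite /= fineK ?fin_num_measure// muleC.
- by rewrite bigcup_const//; exists 0%N.
- by move=> B GB; rewrite /= fineK ?fin_num_measure// muleC GE.
- by move=> _; rewrite setTI ltey_eq fin_num_measure.
Qed.

End independence.

Section poisson_independence.
Context {R : realType} {d : measure_display} {T : measurableType d}
  (P : probability T R) {dE : measure_display} {E : measurableType dE}
  (S : set E) (mu : {measure set E -> \bar R}) (N : T -> {measure set E -> \bar R})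
  (HN : poisson_random_measure P S mu N).
Local Open Scope ereal_scope.

Lemma prm_measurable_event (C : set E) (Y : set (\bar R)) :
  measurable C -> C `<=` S -> measurable Y -> measurable [set w | Y (N w C)].
Proof.
move=> mC CS mY; rewrite -[X in measurable X]setTI.
exact: (prm_measurable HN mC CS).
Qed.

Lemma prm_independent_fin (I : finType) (B : I -> set E) (Y : I -> set (\bar R)) :
  (forall i, measurable (B i)) -> (forall i, B i `<=` S) ->
  trivIset [set: I] B -> (forall i, measurable (Y i)) ->
  P [set w | forall i, Y i (N w (B i))] = \prod_i P [set w | Y i (N w (B i))].
Proof.
move=> mB BS tB mY.
have := @prm_independent _ _ _ _ _ _ _ _ _ HN #|I| (B \o enum_val)
  (fun i => conj (mB _) (BS _)) _ (Y \o enum_val) (fun i => mY _).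
rewrite (reindex (@enum_val I [pred x | true])) /=; last first.
  by exists (@enum_rank I) => x _; [exact: enum_valK | exact: enum_rankK].
move=> <-.
- congr (P _); apply/seteqP; split => w /= H i //.
  by have := H (enum_rank i); rewrite enum_rankK.
- move=> i j _ _ /= /(tB _ _ Logic.I Logic.I); exact: enum_val_inj.
Qed.

(* A pi-system independent of [N D]: it generates the past of [D]. *)
Inductive cylinder (D : set E) : set_system T :=
| cylinderT : cylinder D setT
| cylinderI : forall (C : set E) (Y : set (\bar R)) (A : set T),
    measurable C -> C `<=` S -> C `&` D = set0 -> measurable Y ->
    cylinder D A -> cylinder D ([set w | Y (N w C)] `&` A).

Lemma cylinder_measurable D : cylinder D `<=` measurable.
Proof.
move=> A; elim => // C Y B mC CS _ mY _ mB.
by apply: measurableI => //; exact: prm_measurable_event.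
Qed.

Lemma cylinder_setI D : setI_closed (cylinder D).
Proof.
move=> A B; elim => [|C Y A' mC CS CD mY _ IH] cB; first by rewrite setTI.
by rewrite -setIA; apply: cylinderI => //; exact: IH.
Qed.

Lemma cylinder1 D C Y : measurable C -> C `<=` S -> C `&` D = set0 ->
  measurable Y -> cylinder D [set w | Y (N w C)].
Proof. by move=> *; rewrite -[X in cylinder D X]setIT; apply: cylinderI => //; constructor. Qed.

Lemma subset_cylinder D D' : D `<=` D' -> cylinder D' `<=` cylinder D.
Proof.
move=> DD' A; elim => [|C Y B mC CS CD mY _ cB]; first by constructor.
by apply: cylinderI => //; apply: subsetI_eq0 CD.
Qed.

(** Cylinders may involve overlapping sets, to which the independence axiom does not apply. Boxes
    over disjoint families are the class to which it does. *)
Definition box (I : finType) (a : I -> set E) : set_system T :=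
  [set A | exists2 Y : I -> set (\bar R), (forall i, measurable (Y i)) &
     A = [set w | forall i, Y i (N w (a i))]].

Lemma box_setI (I : finType) (a : I -> set E) : setI_closed (box a).
Proof.
move=> _ _ [Y mY ->] [Z mZ ->]; exists (fun i => Y i `&` Z i).
  by move=> i; exact: measurableI.
apply/seteqP; split => w /=; first by move=> [H1 H2] i; split.
by move=> H; split => i; case: (H i).
Qed.

Lemma box_setT (I : finType) (a : I -> set E) : box a setT.
Proof. by exists (fun=> setT) => //; apply/seteqP; split. Qed.

Lemma box_measurable (I : finType) (a : I -> set E) :
  (forall i, measurable (a i)) -> (forall i, a i `<=` S) ->
  box a `<=` measurable.
Proof.
move=> ma aS _ [Y mY ->].
rewrite (_ : [set _ | _] = \bigcap_(i in [set: I]) [set w | Y i (N w (a i))]).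
  by apply: fin_bigcap_measurable => // i _; exact: prm_measurable_event.
by apply/seteqP; split => w /= H i; [move=> _; exact: H|exact: (H i)].
Qed.

Lemma box_fun_measurable (I : finType) (a : I -> set E) (i : I) :
  @measurable_fun _ _ (g_sigma_algebraType (box a)) _ setT
    (fun w => N w (a i)).
Proof.
move=> _ Y mY; rewrite setTI; apply: sub_sigma_algebra.
exists (fun j => if j == i then Y else setT) => [j|]; first by case: ifP.
apply/seteqP; split => w /=; last by move=> /(_ i); rewrite eqxx.
by move=> H j; case: eqP => // ->.
Qed.

Lemma indep_box (I : finType) (a : I -> set E) (D : set E) (Y : set (\bar R)) :
  (forall i, measurable (a i)) -> (forall i, a i `<=` S) -> trivIset setT a ->
  measurable D -> D `<=` S -> (forall i, a i `&` D = set0) -> measurable Y ->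
  forall A, <<s box a >> A ->
    P (A `&` [set w | Y (N w D)]) = P A * P [set w | Y (N w D)].
Proof.
move=> ma aS ta mD DS aD mY; apply: indep_sigma_algebra.
- exact: box_measurable.
- exact: box_setI.
- exact: box_setT.
- exact: prm_measurable_event.
move=> _ [Z mZ ->].
pose a' (o : I + unit) := if o is inl i then a i else D.
pose Z' (o : I + unit) := if o is inl i then Z i else Y.
have := @prm_independent_fin (I + unit)%type a' Z'.
rewrite (_ : [set w | _] = [set w | forall i, Z i (N w (a i))] `&` [set w | Y (N w D)]).
  rewrite big_sumType/= (big_pred1 tt)//= => ->.
  - by rewrite -prm_independent_fin.
  - by case.
  - by case.
  - move=> [i|[]] [j|[]] _ _ //=.
    + by move=> /(ta _ _ Logic.I Logic.I) ->.
    + by rewrite aD => /set0P; rewrite eqxx.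
    + by rewrite setIC aD => /set0P; rewrite eqxx.
  - by case.
apply/seteqP; split => w /=.
  by move=> H; split=> [i|]; [exact: (H (inl i))|exact: (H (inr tt))].
by move=> [H1 H2] [i|[]]; [exact: H1|].
Qed.

(** Overlaps are removed by refinement: a new set [C] cuts every [a i] into the parts inside and
    outside [C], and the rest of [C] becomes one more piece. By additivity of [N w], its values on
    the old pieces and on [C] are sums of its values on the new pieces, hence measurable for the new
    boxes. *)
Lemma cylinder_box D A : cylinder D A -> exists (I : finType) (a : I -> set E),
  [/\ forall i, [/\ measurable (a i), a i `<=` S & a i `&` D = set0],
      trivIset setT a & <<s box a >> A].
Proof.
elim => [|C Y B mC CS CD mY _ [I [a [Ha ta sB]]]].
  exists void, (fun=> set0); split => //; apply: sub_sigma_algebra; exact: box_setT.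
pose U := \bigcup_(i in [set: I]) a i.
have mU : measurable U by apply: fin_bigcup_measurable => // i _; case: (Ha i).
pose a' (o : option (I * bool)) :=
  match o with
  | Some (i, true) => a i `&` C | Some (i, false) => a i `\` C | None => C `\` U end.
have ma' o : [/\ measurable (a' o), a' o `<=` S & a' o `&` D = set0].
  case: o => [[i []]|] /=; last 1 first.
  - split; [exact: measurableD|by move=> x [/CS]|].
    by apply: subsetI_eq0 CD => // x [].
  - case: (Ha i) => m1 m2 m3; split; [exact: measurableI|by move=> x [/m2]|].
    by apply: subsetI_eq0 m3 => // x [].
  - case: (Ha i) => m1 m2 m3; split; [exact: measurableD|by move=> x [/m2]|].
    by apply: subsetI_eq0 m3 => // x [].
have ta' : trivIset setT a'.
  have aux i b x : a' (Some (i, b)) x -> a i x by case: b => -[].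
  move=> [[i b]|] [[j b']|] _ _ // [x [h1 h2]].
  - have ij : i = j by apply: ta => //; exists x; split; [exact: aux h1|exact: aux h2].
    subst j; congr (Some (_, _)).
    by case: b b' h1 h2 => -[] //= [? ?] [].
  - by case: h2 => _ []; exists i => //; exact: aux h1.
  - by case: h1 => _ []; exists j => //; exact: aux h2.
exists _, a'; split => //.
pose G := g_sigma_algebraType (box a').
have aE i w : N w (a i) = N w (a' (Some (i, true))) + N w (a' (Some (i, false))).
  case: (Ha i) => m1 _ _; rewrite /= -measureU.
  - by rewrite setUIDK.
  - exact: measurableI.
  - exact: measurableD.
  - by rewrite setDE setIACA setICr setI0.
have CE w : N w C = \sum_(i \in [set: I]) N w (a' (Some (i, true))) + N w (a' None).
  rewrite /= -measure_fin_bigcup//=.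
  - rewrite -measureU.
    + by rewrite -setI_bigcupl -/U setIC setUIDK.
    + by apply: fin_bigcup_measurable => // i _; case: (ma' (Some (i, true))).
    + by case: (ma' None).
    + by rewrite -setI_bigcupl -/U setDE [C `&` ~` U]setIC setIACA setICr set0I.
  - by apply: trivIset_setIr.
  - by move=> i _; case: (ma' (Some (i, true))).
have ma i : @measurable_fun _ _ G _ setT (fun w => N w (a i)).
  under eq_fun do rewrite aE; apply: emeasurable_funD; exact: box_fun_measurable.
have mNC : @measurable_fun _ _ G _ setT (fun w => N w C).
  under eq_fun do rewrite CE; apply: emeasurable_funD; last exact: box_fun_measurable.
  by apply: emeasurable_fsum => [|i]; [exact: finite_finset|exact: box_fun_measurable].
apply: (@measurableI _ G).
  by rewrite -[X in measurable X]setTI; exact: mNC.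
suff : <<s box a >> `<=` <<s box a' >> by exact.
apply: smallest_sub; first exact: smallest_sigma_algebra.
move=> _ [Z mZ ->].
rewrite (_ : [set _ | _] = \bigcap_(i in [set: I]) [set w | Z i (N w (a i))]).
  apply: (@fin_bigcap_measurable _ G) => // i _.
  by rewrite -[X in measurable X]setTI; exact: ma.
by apply/seteqP; split => w /= H i; [move=> _; exact: H|exact: (H i)].
Qed.

Lemma indep_past D Y A : measurable D -> D `<=` S -> measurable Y ->
  <<s cylinder D >> A ->
  P (A `&` [set w | Y (N w D)]) = P A * P [set w | Y (N w D)].
Proof.
move=> mD DS mY; move: A; apply: indep_sigma_algebra.
- exact: cylinder_measurable.
- exact: cylinder_setI.
- by constructor.
- exact: prm_measurable_event.
move=> A /cylinder_box [I [a [Ha ta sA]]].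
by apply: (indep_box (a := a)) => // i; case: (Ha i).
Qed.

End poisson_independence.

(** * Integrals of products of independent functions *)

Section nonneg_induction.
Context {R : realType} {d : measure_display} {T : measurableType d}.
Local Open Scope ereal_scope.
Import HBNNSimple.

Lemma ge0_measurable_ind (Q : (T -> \bar R) -> Prop) :
  (forall A, measurable A -> Q (fun x => (\1_A x)%:E)) ->
  (forall (k : R) f, (0 <= k)%R -> measurable_fun setT f -> (forall x, 0 <= f x) ->
     Q f -> Q (fun x => k%:E * f x)) ->
  (forall f g, measurable_fun setT f -> (forall x, 0 <= f x) -> Q f ->
     measurable_fun setT g -> (forall x, 0 <= g x) -> Q g ->
     Q (fun x => f x + g x)) ->
  (forall F : nat -> T -> \bar R, (forall n, measurable_fun setT (F n)) ->
     (forall n x, 0 <= F n x) -> (forall x, nondecreasing_seq (F ^~ x)) ->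
     (forall n, Q (F n)) -> Q (fun x => limn (F ^~ x))) ->
  forall f, measurable_fun setT f -> (forall x, 0 <= f x) -> Q f.
Proof.
move=> Qi Qk QD Ql f mf f0.
have Q0 : Q (fun=> 0).
  by have := Qi set0 measurable0; under eq_fun do rewrite indicE in_set0.
have Qs (g : {nnsfun T >-> R}) : Q (fun x => (g x)%:E).
  under eq_fun do rewrite (fimfunE g) fsbig_finite//= -sumEFin.
  set r := finmap.enum_fset _.
  have : forall y, y \in r -> (0 <= y)%R.
    by move=> y; rewrite /r in_fset_set// inE => -[x _ <-].
  elim: r => [|y r IH] r0; first by under eq_fun do rewrite big_nil.
  have m1 (z : R) : measurable_fun setT (fun x => (\1_(g @^-1` [set z]) x)%:E : \bar R).
    apply/measurable_EFinP; exact: measurable_indic.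
  have m2 (z : R) : measurable_fun setT (fun x => (z * \1_(g @^-1` [set z]) x)%:E).
    apply/measurable_EFinP; apply: measurable_funM => //; exact: measurable_indic.
  under eq_fun do rewrite big_cons; apply: QD.
  - exact: m2.
  - by move=> x; rewrite lee_fin mulr_ge0// r0// mem_head.
  - under eq_fun do rewrite EFinM; apply: Qk => //.
      by rewrite r0// mem_head.
    by apply: Qi.
  - by apply: emeasurable_sum.
  - move=> x; rewrite big_seq sume_ge0// => z zr.
    by rewrite lee_fin mulr_ge0// r0// inE zr orbT.
  - by apply: IH => z zr; rewrite r0// inE zr orbT.
pose F n := EFin \o nnsfun_approx measurableT mf n.
have -> : f = fun x => limn (F ^~ x).
  apply/funext => x; apply/esym/cvg_lim => //.
  by apply: cvg_nnsfun_approx.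
apply: Ql => //.
- by move=> n; apply/measurable_EFinP; exact: measurable_funP.
- by move=> n x; rewrite lee_fin.
- move=> x m n mn; rewrite lee_fin.
  by have /lefP := nd_nnsfun_approx measurableT mf mn; apply.
- by move=> n; exact: Qs.
Qed.

End nonneg_induction.

(** For [a = +oo] multiplication is not continuous at 0, but by monotonicity the product is
    eventually [+oo] unless [x] vanishes identically. *)
Lemma ge0_limnMl {R : realType} (a : \bar R) (x : nat -> \bar R) :
  (0 <= a)%E -> (forall n, 0 <= x n)%E -> nondecreasing_seq x ->
  limn (fun n => a * x n)%E = (a * limn x)%E.
Proof.
move=> a0 x0 ndx; have cx := ereal_nondecreasing_is_cvgn ndx.
case: a a0 => [a||] a0 //; first by rewrite limeMl.
have [[n0 xn0]|H] := pselect (exists n0, 0 < x n0)%E.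
  rewrite gt0_mulye; last first.
    apply: (lt_le_trans xn0); apply: lime_ge => //; near=> n; apply: ndx.
    by near: n; exact: nbhs_infty_ge.
  apply/cvg_lim => //; apply: cvg_near_cst; near=> n; rewrite gt0_mulye//.
  apply: (lt_le_trans xn0); apply: ndx; near: n; exact: nbhs_infty_ge.
have -> : x = fun=> 0%E.
  apply/funext => n; apply/eqP; rewrite eq_le x0 andbT leNgt; apply/negP => xn.
  by apply: H; exists n.
by under eq_fun do rewrite mule0; rewrite !lim_cst// mule0.
Unshelve. all: by end_near. Qed.

Section independent_integral.
Context {R : realType} {d : measure_display} {T : measurableType d}
  (P : probability T R).
Local Open Scope ereal_scope.

Lemma measurable_fun_sigma {d'} {U : measurableType d'} (C : set_system T) (f : T -> U) :
  C `<=` measurable -> @measurable_fun _ _ (g_sigma_algebraType C) _ setT f ->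
  measurable_fun setT f.
Proof.
move=> Cm mf _ Y mY; have := mf measurableT Y mY.
by apply: smallest_sub => //; exact: sigma_algebra_measurable.
Qed.

Lemma integral_indep_event (C : set_system T) (E : set T) :
  C `<=` measurable -> measurable E ->
  (forall A, <<s C >> A -> P (A `&` E) = P A * P E) ->
  forall W, @measurable_fun _ _ (g_sigma_algebraType C) _ setT W ->
  (forall w, 0 <= W w) ->
  \int[P]_w (W w * (\1_E w)%:E) = \int[P]_w W w * P E.
Proof.
move=> Cm mE CE W mW W0.
pose G := g_sigma_algebraType C.
have sub A : measurable (A : set G) -> measurable (A : set T).
  by apply: smallest_sub => //; exact: sigma_algebra_measurable.
have mi : measurable_fun setT (fun w => (\1_E w)%:E : \bar R).
  by apply/measurable_EFinP; exact: measurable_indic.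
pattern W; move: (W) mW W0; apply: ge0_measurable_ind.
- move=> A mA.
  have HI w : (\1_A w)%:E * (\1_E w)%:E = (\1_(A `&` E) w)%:E :> \bar R by rewrite indicI.
  under eq_integral do rewrite HI.
  have mA' := sub _ mA; have mAE := measurableI _ _ mA' mE.
  rewrite (integral_indic _ measurableT mAE) (integral_indic _ measurableT mA').
  rewrite !setIT; exact: CE.
- move=> k f k0 mf f0 H; move/(measurable_fun_sigma Cm) : mf => mf.
  under eq_integral do rewrite -muleA.
  rewrite !ge0_integralZl ?H ?muleA//.
  + by apply: emeasurable_funM.
  + by move=> x _; rewrite mule_ge0// lee_fin.
- move=> /= f g /(measurable_fun_sigma Cm) mf f0 Hf /(measurable_fun_sigma Cm) mg g0 Hg.
  under eq_integral do rewrite ge0_muleDl//.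
  have h0 h x : (forall x, 0 <= h x) -> 0 <= h x * (\1_E x)%:E.
    by move=> h0; rewrite mule_ge0// lee_fin.
  rewrite !ge0_integralD//; try by [move=> x _; apply: h0 | apply: emeasurable_funM].
  by rewrite Hf Hg; apply/esym/ge0_muleDl; apply: integral_ge0.
- move=> /= F mF' F0 ndF HF.
  have mF n : measurable_fun setT (F n : T -> _) by exact: measurable_fun_sigma (mF' n).
  transitivity (\int[P]_w limn (fun n => F n w * (\1_E w)%:E)).
    apply: eq_integral => w _; rewrite indicE; case: (w \in E) => /=.
      by rewrite mule1; congr (limn _); apply/funext => n; rewrite mule1.
    by rewrite mule0; under eq_fun do rewrite mule0; rewrite lim_cst.
  rewrite !monotone_convergence//; last 3 first.
  + by move=> n; apply: emeasurable_funM.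
  + by move=> n x _; rewrite mule_ge0// lee_fin.
  + by move=> x _ m n mn; apply: lee_wpmul2r; [rewrite lee_fin|exact: ndF].
  under eq_fun do rewrite HF.
  rewrite muleC -ge0_limnMl//.
  - by congr (limn _); apply/funext => n; rewrite muleC.
  - by move=> n; exact: integral_ge0.
  - by move=> m n mn; apply: ge0_le_integral => // x _; exact: ndF.
Qed.

(** Induction on [h] with [W] fixed; the indicator case is [integral_indep_event], itself an
    induction on [W]. Nonnegativity allows infinite integrals throughout. *)
Lemma integral_indep (C : set_system T) {d'} {U : measurableType d'} (Z : T -> U) :
  C `<=` measurable -> measurable_fun setT Z ->
  (forall A Y, <<s C >> A -> measurable Y ->
     P (A `&` Z @^-1` Y) = P A * P (Z @^-1` Y)) ->
  forall (W : T -> \bar R) h, @measurable_fun _ _ (g_sigma_algebraType C) _ setT W ->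
  (forall w, 0 <= W w) -> measurable_fun setT h -> (forall u, 0 <= h u) ->
  \int[P]_w (W w * h (Z w)) = \int[P]_w W w * \int[P]_w h (Z w).
Proof.
move=> Cm mZ CZ W h mW W0 mh h0.
have mW' := measurable_fun_sigma Cm mW.
pattern h; move: (h) mh h0; apply: ge0_measurable_ind.
- move=> Y mY.
  have mZY : measurable (Z @^-1` Y) by rewrite -[X in measurable X]setTI; exact: mZ.
  rewrite (_ : (fun x => _) = fun w => W w * (\1_(Z @^-1` Y) w)%:E)//.
  rewrite (integral_indep_event Cm)// => [|A sA]; last exact: CZ.
  have -> // : \int[P]_w (\1_Y (Z w))%:E = P (Z @^-1` Y).
  exact: etrans (integral_indic P measurableT mZY) (congr1 P (setIT _)).
- move=> k f k0 mf f0 H.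
  under eq_integral do rewrite muleCA.
  have mfZ : measurable_fun setT (f \o Z) by exact: measurableT_comp.
  rewrite !ge0_integralZl ?H//; last 2 first.
  + by apply: emeasurable_funM.
  + by move=> x _; rewrite mule_ge0.
  by rewrite muleCA.
- move=> f g mf f0 Hf mg g0 Hg.
  have mfZ : measurable_fun setT (f \o Z) by exact: measurableT_comp.
  have mgZ : measurable_fun setT (g \o Z) by exact: measurableT_comp.
  under eq_integral do rewrite ge0_muleDr//.
  rewrite !ge0_integralD//; try by [move=> x _; apply: mule_ge0 | apply: emeasurable_funM].
  by rewrite Hf Hg; apply/esym/ge0_muleDr; apply: integral_ge0.
- move=> F mF F0 ndF HF.
  have mFZ n : measurable_fun setT (F n \o Z) by exact: measurableT_comp.
  transitivity (\int[P]_w limn (fun n => W w * F n (Z w))).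
    apply: eq_integral => w _.
    by rewrite -ge0_limnMl// => n m mn; exact: ndF.
  have -> : \int[P]_w limn (fun n => W w * F n (Z w)) =
      limn (fun n => \int[P]_w (W w * F n (Z w))).
    apply: monotone_convergence => // [n|n x _|x _ m n mn].
    - by apply: emeasurable_funM => //; exact: mFZ.
    - by rewrite mule_ge0.
    - by apply: lee_wpmul2l => //; exact: ndF.
  have -> : \int[P]_w limn (fun n => F n (Z w)) = limn (fun n => \int[P]_w F n (Z w)).
    by apply: monotone_convergence => // x _ m n mn; exact: ndF.
  under eq_fun do rewrite HF.
  rewrite ge0_limnMl//.
  - exact: integral_ge0.
  - by move=> n; exact: integral_ge0.
  - move=> m n mn; apply: ge0_le_integral => //; [exact: mFZ|exact: mFZ|move=> x _; exact: ndF].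
Qed.

End independent_integral.

(** * Moments of Poisson variables *)
Section poisson_moments.
Context {R : realType} {d : measure_display} {T : measurableType d}
  (P : probability T R).
Local Open Scope ereal_scope.

Lemma nneseries_exp (x : R) : (0 <= x)%R ->
  \sum_(k <oo) (x ^+ k / k`!%:R)%:E = (expR x)%:E.
Proof.
move=> x0; rewrite -EFin_lim; last exact: is_cvg_series_exp_coeff.
apply/congr_lim/funext => n/=; rewrite /series/= -sumEFin big_mkord.
by [].
Qed.

Lemma exprn_le_fact (x : R) n : (0 <= x)%R -> (x ^+ n <= n`!%:R * expR x)%R.
Proof.
move=> x0; rewrite -ler_pdivrMl ?ltr0n ?fact_gt0// mulrC -lee_fin -nneseries_exp//.
rewrite (nneseries_split 0%N n.+1) => [|k _]; last by rewrite lee_fin divr_ge0// exprn_ge0.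
rewrite add0n big_nat_recr//= -addeA; apply: lee_paddl => //.
  by apply: sume_ge0 => k _; rewrite lee_fin divr_ge0// exprn_ge0.
by apply: leeDl; apply: nneseries_ge0 => k _ _; rewrite lee_fin divr_ge0// exprn_ge0.
Qed.

Section one_variable.
Variables (Z : T -> \bar R) (r : R).
Hypotheses (mZ : measurable_fun setT Z) (r0 : (0 <= r)%R)
  (pZ : poisson_distributed P Z r).

Let A (k : nat) : set T := Z @^-1` [set k%:R%:E].

Let mA k : measurable (A k).
Proof. by rewrite /A -[X in measurable X]setTI; apply: mZ. Qed.

Let tA : trivIset setT A.
Proof.
move=> i j _ _ [w [/=]]; rewrite /A/= => -> [/eqP].
by rewrite eqr_nat => /eqP.
Qed.

Let mUA : measurable (\bigcup_k A k).
Proof. exact: bigcup_measurable. Qed.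

Let w k : R := (expR (- r) * r ^+ k / k`!%:R)%R.

Let w0 k : (0 <= w k)%R.
Proof. by rewrite /w !mulr_ge0 ?expR_ge0 ?exprn_ge0. Qed.

Let sum_w : \sum_(k <oo) (w k)%:E = 1.
Proof.
under eq_eseriesr do rewrite /w -mulrA EFinM.
rewrite nneseriesZl => [|k _]; last by rewrite lee_fin divr_ge0// exprn_ge0.
by rewrite nneseries_exp// -EFinM expRN mulVf// gt_eqF// expR_gt0.
Qed.

Let PA k : P (A k) = (w k)%:E. Proof. exact: pZ. Qed.

Lemma poisson_ae_nat : P (~` [set w | exists k : nat, Z w = k%:R%:E]) = 0.
Proof.
have -> : [set w | exists k : nat, Z w = k%:R%:E] = \bigcup_k A k.
  by apply/seteqP; split => [x [k xk]|x [k _ xk]]; exists k.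
rewrite probability_setC// measure_bigcup//.
rewrite (eq_eseriesr (fun k _ => PA k)).
rewrite (@eq_eseriesl _ _ xpredT) ?sum_w ?subee// => k.
by rewrite in_setT.
Qed.

Lemma integral_poisson (h : \bar R -> \bar R) : measurable_fun setT h ->
  (forall z, 0 <= h z) ->
  \int[P]_x h (Z x) = \sum_(k <oo) (w k)%:E * h k%:R%:E.
Proof.
move=> mh h0.
have mhZ : measurable_fun setT (h \o Z) by exact: measurableT_comp.
rewrite (ge0_negligible_integral (measurableC mUA))//; last first.
  rewrite -poisson_ae_nat; congr (P _); congr (~` _).
  by apply/seteqP; split => [x [k _ xk]|x [k xk]]; exists k.
rewrite setTD setCK ge0_integral_bigcup//; last exact: measurable_funTS.
apply: eq_eseriesr => k _.
under eq_integral => x xA.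
  rewrite (_ : h (Z x) = cst (h k%:R%:E) x); last by move: xA; rewrite inE /A/= => ->.
  over.
by rewrite integral_cst// muleC; congr (_ * _); exact: pZ.
Qed.

Lemma poisson_mean : \int[P]_x (`|fine (Z x)|)%:E = r%:E.
Proof.
rewrite (integral_poisson (h := fun z => `|fine z|%:E)) => [|//|z]; last first.
  by rewrite lee_fin.
  by apply/measurable_EFinP/measurableT_comp => //; exact: fine_measurable.
rewrite nneseries_recl// => [|k _]; last by rewrite -EFinM lee_fin mulr_ge0.
rewrite normr0 mule0 add0e -(nneseries_addn (f := fun k => (w k)%:E * `|k%:R|%:E)) => [|k]; last first.
  by rewrite -EFinM lee_fin mulr_ge0.
rewrite -[RHS]mule1 -sum_w -nneseriesZl => [|k _]; last by rewrite lee_fin.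
apply: eq_eseriesr => k _; rewrite -!EFinM addn1 ger0_norm// /w factS natrM exprS.
congr (_%:E); field.
by rewrite pnatr_eq0 -lt0n fact_gt0 nat1r pnatr_eq0.
Qed.

(** The 1 accounts for the value 0, where the deviation is r^q <= r. For k >= 1 and m the successor
    of [Num.trunc q], the deviation is at most k^m <= m! e^k, and the terms e^k / k! sum to at most
    [expR (expR 1)]. *)
Definition poisson_const (q : R) : R :=
  (1 + (Num.trunc q).+1`!%:R * expR (expR 1))%R.

Lemma poisson_const_gt0 (q : R) : (0 < poisson_const q)%R.
Proof. by rewrite /poisson_const ltr_pwDl// mulr_ge0// expR_ge0. Qed.

(** The point is linearity in [r] for every [q]. Each weight with k >= 1 contains the factor r^k <=
    r, and r <= 1 bounds the deviation at k by k. *)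
Lemma poisson_central_moment (q : R) : (r <= 1)%R -> (1 <= q)%R ->
  \int[P]_x (`|fine (Z x - r%:E)| `^ q)%:E <= (poisson_const q * r)%:E.
Proof.
move=> r1 q1; have q0 : (0 <= q)%R by lra.
rewrite (integral_poisson (h := fun z => (`|fine (z - r%:E)| `^ q)%:E)) => [|//|z]; last first.
  by rewrite lee_fin powR_ge0.
  apply/measurable_EFinP; apply: (measurableT_comp (measurable_powR _)).
  apply: measurableT_comp => //; apply: measurableT_comp; first exact: fine_measurable.
  exact: emeasurable_funB.
have g0 (k : nat) : 0 <= (w k)%:E * (`|fine (k%:R%:E - r%:E)| `^ q)%:E.
  by rewrite -EFinM lee_fin mulr_ge0// powR_ge0.
rewrite nneseries_recl// /poisson_const mulrDl mul1r EFinD; apply: leeD.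
  rewrite sub0e/= normrN ger0_norm// /w expr0 fact0 divr1 mulr1 -EFinM lee_fin.
  rewrite -[leRHS]mul1r ler_pM ?expR_ge0 ?powR_ge0//.
    by rewrite -[leRHS]expR0 ler_expR oppr_le0.
  have [->|rn0] := eqVneq r 0%R; first by rewrite powR0// gt_eqF//; lra.
  by apply: ge1r_powR => //; rewrite lt_neqAle eq_sym rn0 r0.
rewrite -(nneseries_addn (f := fun k => (w k)%:E * (`|fine (k%:R%:E - r%:E)| `^ q)%:E))//.
pose m := (Num.trunc q).+1.
apply: (@le_trans _ _ (\sum_(k <oo) (r * m`!%:R)%:E * (expR 1 ^+ k.+1 / (k.+1)`!%:R)%:E)).
  apply: lee_nneseries => // k _; rewrite addn1 -!EFinM lee_fin /w.
  have : (`|k.+1%:R - r| `^ q <= m`!%:R * expR 1 ^+ k.+1)%R.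
    rewrite -expRM_natl mulr1; apply: (le_trans _ (exprn_le_fact _ _)) => //.
    rewrite -powR_mulrn//; apply: (@le_trans _ _ (k.+1%:R `^ q)%R).
      apply: ge0_ler_powR; rewrite ?nnegrE//.
      have : (1 <= k.+1%:R :> R)%R by rewrite ler1n.
      by move=> k1; rewrite ger0_norm ?subr_ge0 ?(le_trans r1)// lerBlDr lerDl.
    apply: ler_powR; first by rewrite ler1n.
    by rewrite /m ltW// truncnS_gt.
  move=> H.
  have h1 : (expR (- r) * r ^+ k.+1 <= r)%R.
    rewrite exprS mulrCA -[leRHS]mulr1 ler_wpM2l// -[leRHS]mul1r ler_pM ?expR_ge0 ?exprn_ge0//.
      by rewrite -[leRHS]expR0 ler_expR oppr_le0.
    exact: exprn_ile1.
  rewrite mulrAC [leRHS]mulrA -[(r * _ * _)%R]mulrA ler_wpM2r// ler_pM// ?powR_ge0//.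
  by rewrite mulr_ge0 ?expR_ge0 ?exprn_ge0.
rewrite nneseriesZl => [|k _]; last by rewrite lee_fin divr_ge0// exprn_ge0// expR_ge0.
rewrite -/m [(_ * r)%R]mulrC mulrA [leRHS]EFinM lee_pmul//.
- by rewrite lee_fin mulr_ge0.
- by apply: nneseries_ge0 => k _ _; rewrite lee_fin divr_ge0// exprn_ge0// expR_ge0.
have e0 k : 0 <= (expR 1 ^+ k / k`!%:R)%:E :> \bar R.
  by rewrite lee_fin divr_ge0// exprn_ge0// expR_ge0.
rewrite (_ : \sum_(0 <= i <oo) _ = \sum_(1 <= i <oo) (expR 1 ^+ i / i`!%:R)%:E); last first.
  by rewrite -[RHS]nneseries_addn//; apply: eq_eseriesr => k _; rewrite addn1.
by rewrite -nneseries_exp ?expR_ge0// [leRHS]nneseries_recl// lee_paddl.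
Qed.

End one_variable.
End poisson_moments.

(** * Strong measurability and Bochner integrals *)

Definition sigma_measurable_fun {d d'} {T : measurableType d} {U : measurableType d'}
  (C : set_system T) (f : T -> U) : Prop :=
  @measurable_fun _ _ (g_sigma_algebraType C) _ setT f.

Section step_lists.
Context {R : realType} {X : normedModType R} {d : measure_display} {T : measurableType d}.
Implicit Types (l : seq (set T * X)) (C : set_system T).

(* Lists turn sums of step functions into concatenations. *)
Definition step_of l : step_function X T :=
  StepFunction (fun i : 'I_(size l) => (tnth (in_tuple l) i).1)
               (fun i : 'I_(size l) => (tnth (in_tuple l) i).2).

Definition step_sum l (w : T) : X := \sum_(a <- l) (\1_(a.1) w : R) *: a.2.

Definition sets_in (V : Type) (G : set_system T) (l : seq (set T * V)) :=
  List.Forall (fun a => G a.1) l.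

Lemma step_fun_of l w : step_fun (step_of l) w = step_sum l w.
Proof. by rewrite /step_fun /step_sum (big_tnth _ _ l). Qed.

Lemma step_sum_cat l l' w : step_sum (l ++ l') w = step_sum l w + step_sum l' w.
Proof. by rewrite /step_sum big_cat. Qed.

Lemma step_list (f : step_function X T) : exists l,
  [/\ forall G : set_system T, step_measurable G f -> sets_in G l,
  step_fun f = step_sum l &
  (forall P : probability T R,
     step_integral P f = \sum_(a <- l) fine (P a.1) *: a.2)].
Proof.
exists [seq (step_set f i, step_val f i) | i <- enum 'I_(step_size f)]; split.
- move=> G Gf; rewrite /sets_in; elim: (enum _) => [|i s IH] /=; constructor => //.
  exact: Gf.
- by apply/funext => w; rewrite /step_sum big_map big_enum.
- by move=> P; rewrite big_map big_enum.
Qed.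

Lemma step_measurable_of (G : set_system T) l :
  sets_in G l -> step_measurable G (step_of l).
Proof.
move=> Gl i /=; elim: l Gl i => [|a l IH] Gl [i Hi] //.
rewrite (tnth_nth a)/=; inversion Gl; subst; case: i Hi => [|i] Hi //=.
by have := IH H2 (Ordinal (Hi : (i < size l)%N)); rewrite (tnth_nth a).
Qed.

Lemma strongly_measurable_list (G : set_system T) (f : T -> X) :
  strongly_measurable G f <->
  exists2 l : nat -> seq (set T * X), (forall n, sets_in G (l n)) &
    forall w, step_sum (l n) w @[n --> \oo] --> f w.
Proof.
split=> [[g [Gg gf]]|[l Gl lf]]; last first.
  exists (fun n => step_of (l n)); split=> [n|w]; first exact: step_measurable_of.
  by under eq_fun do rewrite step_fun_of; exact: lf.
have [l Hl] := choice (fun n => step_list (g n)).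
exists l => [n|w]; first by case: (Hl n) => H _ _; apply: H.
have <- : (fun n => step_fun (g n) w) = (fun n => step_sum (l n) w).
  by apply/funext => n; case: (Hl n) => _ -> _.
exact: gf.
Qed.

Lemma sets_in_cat (V : Type) (G : set_system T) (l l' : seq (set T * V)) :
  sets_in G l -> sets_in G l' -> sets_in G (l ++ l').
Proof. by move=> H H'; apply/List.Forall_app; split. Qed.

Lemma strongly_measurable0 (G : set_system T) :
  strongly_measurable G (fun=> 0 : X).
Proof.
apply/strongly_measurable_list; exists (fun=> [::]) => [n|w]; first by constructor.
by rewrite /step_sum; under eq_fun do rewrite big_nil; exact: cvg_cst.
Qed.

Lemma strongly_measurableD (G : set_system T) (f g : T -> X) :
  strongly_measurable G f -> strongly_measurable G g ->
  strongly_measurable G (fun w => f w + g w).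
Proof.
move=> /strongly_measurable_list[l Gl lf] /strongly_measurable_list[l' Gl' lg].
apply/strongly_measurable_list; exists (fun n => l n ++ l' n) => [n|w].
  exact: sets_in_cat.
by under eq_fun do rewrite step_sum_cat; exact: cvgD.
Qed.

Lemma strongly_measurable_sub (G G' : set_system T) (f : T -> X) :
  G `<=` G' -> strongly_measurable G f -> strongly_measurable G' f.
Proof.
move=> GG' [g [Gg gf]]; exists g; split=> // n i; exact/GG'/Gg.
Qed.

(** Norms do not add, so the induction carries an offset: on the first set the rest of the sum is
    shifted by [v + x], off it by [v]. *)
Lemma norm_step_sum_measurable C l v : sets_in <<s C >> l ->
  sigma_measurable_fun C (fun w => `|v + step_sum l w|).
Proof.
elim: l v => [|[A x] l IH] v Cl.
  by under eq_fun do rewrite /step_sum big_nil addr0; exact: measurable_cst.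
inversion Cl; subst.
rewrite (_ : (fun w => _) = (fun w => if w \in A then `|(v + x) + step_sum l w|
    else `|v + step_sum l w|)); last first.
  apply/funext => w; rewrite /step_sum big_cons/= indicE; case: (w \in A).
    by rewrite scale1r addrA.
  by rewrite scale0r add0r.
apply: measurable_fun_ifT; [|exact: IH|exact: IH].
apply: (measurable_fun_bool true).
rewrite setTI (_ : _ @^-1` _ = A)//.
by apply/seteqP; split => w; [move=> /set_mem|move=> /mem_set].
Qed.

Lemma norm_strongly_measurable C (f : T -> X) : strongly_measurable <<s C >> f ->
  sigma_measurable_fun C (fun w => `|f w|).
Proof.
move=> /strongly_measurable_list[l Cl lf].
apply: (@measurable_fun_cvg _ (g_sigma_algebraType C) _ _ (fun n w => `|0 + step_sum (l n) w|)).
  by move=> n; exact: norm_step_sum_measurable.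
by move=> w _; under eq_fun do rewrite add0r; apply: cvg_norm.
Qed.

End step_lists.

Section real_steps.
Context {R : realType} {d : measure_display} {T : measurableType d}.
Implicit Types (C : set_system T).
Import HBNNSimple.

Lemma nnsfun_list C (u : {nnsfun (g_sigma_algebraType C) >-> R}) :
  exists l : seq (set T * R), sets_in <<s C >> l /\
    forall w, \sum_(a <- l) (\1_(a.1) w : R) * a.2 = u w.
Proof.
exists [seq (u @^-1` [set y], y) | y <- finmap.enum_fset (fset_set (range u))]; split.
  rewrite /sets_in; elim: (finmap.enum_fset _) => [|y s IH]/=; constructor => //.
  exact: (@measurable_funPTI _ _ (g_sigma_algebraType C) _ u).
move=> w; rewrite big_map (fimfunE u) fsbig_finite//=.
by apply: eq_bigr => y _; rewrite mulrC.
Qed.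

(** The positive and negative parts are approximated from below. At each point one of them vanishes
    together with its approximations, which gives the domination needed for dominated
    convergence. *)
Lemma real_step_approx C (g : T -> R) : sigma_measurable_fun C g ->
  exists l : nat -> seq (set T * R), [/\ forall n, sets_in <<s C >> (l n),
    forall w, \sum_(a <- l n) (\1_(a.1) w : R) * a.2 @[n --> \oo] --> g w &
    forall n w, `|\sum_(a <- l n) (\1_(a.1) w : R) * a.2| <= `|g w|].
Proof.
move=> mg; pose G := g_sigma_algebraType C.
have mp : @measurable_fun _ _ G _ setT (EFin \o g^\+)%R.
  by apply/measurable_EFinP; exact: measurable_funrpos.
have mn : @measurable_fun _ _ G _ setT (EFin \o g^\-)%R.
  by apply/measurable_EFinP; exact: measurable_funrneg.
pose p n := nnsfun_approx measurableT mp n.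
pose q n := nnsfun_approx measurableT mn n.
have [lp Hp] := choice (fun n => nnsfun_list (p n)).
have [lq Hq] := choice (fun n => nnsfun_list (q n)).
exists (fun n => lp n ++ [seq (a.1, - a.2) | a <- lq n]).
have E n w : \sum_(a <- lp n ++ [seq (a.1, - a.2) | a <- lq n])
    (\1_(a.1) w : R) * a.2 = p n w - q n w.
  rewrite big_cat/= big_map/=; case: (Hp n) => _ ->; case: (Hq n) => _ <-.
  by rewrite -sumrN; congr (_ + _); apply: eq_bigr => a _; rewrite mulrN.
have pg n w : p n w <= g^\+ w.
  by rewrite /p nnsfun_approxE -lee_fin le_approx// => x _; rewrite lee_fin.
have qg n w : q n w <= g^\- w.
  by rewrite /q nnsfun_approxE -lee_fin le_approx// => x _; rewrite lee_fin.
split.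
- move=> n; apply: sets_in_cat; first by case: (Hp n).
  by apply/List.Forall_map; case: (Hq n).
- move=> w; under eq_fun do rewrite E.
  rewrite -[g w](_ : g^\+ w - g^\- w = _); last first.
    by rewrite -[in RHS](funrposBneg g).
  have cp : (p n w)%:E @[n --> \oo] --> (g^\+ w)%:E.
    by apply: (cvg_nnsfun_approx measurableT mp) => // x _; rewrite lee_fin.
  have cq : (q n w)%:E @[n --> \oo] --> (g^\- w)%:E.
    by apply: (cvg_nnsfun_approx measurableT mn) => // x _; rewrite lee_fin.
  exact: cvgB (fine_cvg cp) (fine_cvg cq).
- move=> n w; rewrite E.
  have p0 : 0 <= p n w by [].
  have q0 : 0 <= q n w by [].
  have := pg n w; have := qg n w; rewrite /funrpos /funrneg /Num.max.
  case: ltP => h1; case: ltP => h2; rewrite !ler_norml => ? ?; apply/andP;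
    move: (ler_norm (g w)) (ler_norm (- g w)); rewrite normrN => ? ?; split; lra.
Qed.

End real_steps.

Section strong_measurability_more.
Context {R : realType} {X : normedModType R} {d : measure_display} {T : measurableType d}.
Implicit Types (C : set_system T).

Lemma strongly_measurable_scale C (g : T -> R) (f : T -> X) :
  sigma_measurable_fun C g -> strongly_measurable <<s C >> f ->
  strongly_measurable <<s C >> (fun w => g w *: f w).
Proof.
move=> /real_step_approx[p [Cp pg _]] /strongly_measurable_list[l Cl lf].
apply/strongly_measurable_list.
exists (fun n => [seq (a.1 `&` b.1, a.2 *: b.2) | a <- p n, b <- l n]) => [n|w].
  rewrite /sets_in; elim: (p n) (Cp n) => [|a s IH] /= H; first by constructor.
  inversion H; subst; apply: sets_in_cat; last exact: IH.
  apply/List.Forall_map; elim: (l n) (Cl n) => [|b t IHt] H'; first by constructor.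
  inversion H'; subst; constructor; last exact: IHt.
  exact: (@measurableI _ (g_sigma_algebraType C)).
under eq_fun => n.
  rewrite (_ : step_sum _ w =
    (\sum_(a <- p n) (\1_(a.1) w : R) * a.2) *: step_sum (l n) w); last first.
    rewrite /step_sum big_allpairs_dep scaler_suml; apply: eq_bigr => a _.
    rewrite scaler_sumr; apply: eq_bigr => b _ /=.
    by rewrite indicI/= !scalerA mulrAC.
  over.
exact: cvgZ.
Qed.

Lemma sigma_algebra_idE : <<s (measurable : set_system T) >> = measurable.
Proof. by apply: sigma_algebra_id; exact: sigma_algebra_measurable. Qed.

Lemma sigma_measurable_funE {d'} {U : measurableType d'} (f : T -> U) :
  measurable_fun setT f -> sigma_measurable_fun measurable f.
Proof. by move=> mf _ Y mY; rewrite /measurable/= sigma_algebra_idE; exact: mf. Qed.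

Lemma norm_strongly_measurableT (f : T -> X) : strongly_measurable measurable f ->
  measurable_fun setT (fun w => `|f w|).
Proof.
rewrite -[X in strongly_measurable X]sigma_algebra_idE => /norm_strongly_measurable.
exact: measurable_fun_sigma.
Qed.

Lemma strongly_measurable_step_sum (G : set_system T) (l : seq (set T * X)) :
  sets_in G l -> strongly_measurable G (step_sum l).
Proof.
move=> Gl; apply/strongly_measurable_list; exists (fun=> l) => // w; exact: cvg_cst.
Qed.

Lemma strongly_measurableN (G : set_system T) (f : T -> X) :
  strongly_measurable G f -> strongly_measurable G (fun w => - f w).
Proof.
move=> /strongly_measurable_list[l Gl lf]; apply/strongly_measurable_list.
exists (fun n => [seq (a.1, - a.2) | a <- l n]) => [n|w].
  by apply/List.Forall_map; exact: Gl.
under eq_fun => n.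
  rewrite (_ : step_sum _ w = - step_sum (l n) w); last first.
    by rewrite /step_sum big_map -sumrN; apply: eq_bigr => a _; rewrite scalerN.
  over.
exact: cvgN.
Qed.

(* Finite-rank vector-valued functions with coefficients in [K]. *)
Inductive fspan (K : (T -> R) -> Prop) : (T -> X) -> Prop :=
| fspan0 : fspan K (fun=> 0)
| fspanD g x f : K g -> fspan K f -> fspan K (fun w => g w *: x + f w).

Lemma fspan_mono (K K' : (T -> R) -> Prop) (f : T -> X) :
  (forall g, K g -> K' g) -> fspan K f -> fspan K' f.
Proof. by move=> KK'; elim => [|g x h Kg _ IH]; constructor => //; exact: KK'. Qed.

Lemma fspan_scale (K K' : (T -> R) -> Prop) (u : T -> R) (f : T -> X) :
  (forall g, K g -> K' (fun w => u w * g w)) ->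
  fspan K f -> fspan K' (fun w => u w *: f w).
Proof.
move=> KK'; elim => [|g x h Kg _ IH].
  by under eq_fun do rewrite scaler0; constructor.
under eq_fun do rewrite scalerDr scalerA.
by apply: fspanD => //; exact: KK'.
Qed.

Lemma fspan_sum (K : (T -> R) -> Prop) (I : Type) (s : seq I) (g : I -> T -> R)
    (x : I -> X) : (forall i, K (g i)) ->
  fspan K (fun w => \sum_(i <- s) g i w *: x i).
Proof.
move=> Kg; elim: s => [|i s IH].
  by under eq_fun do rewrite big_nil; constructor.
by under eq_fun do rewrite big_cons; apply: fspanD.
Qed.

Lemma fspan_strongly_measurable C (f : T -> X) :
  fspan (sigma_measurable_fun C) f -> strongly_measurable <<s C >> f.
Proof.
elim => [|g x h mg _ IH]; first exact: strongly_measurable0.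
apply: strongly_measurableD => //; apply: strongly_measurable_scale => //.
rewrite (_ : (fun=> x) = step_sum [:: (setT, x)]).
  apply: strongly_measurable_step_sum; constructor => //=.
  exact: (@measurableT _ (g_sigma_algebraType C)).
apply/funext => w; rewrite /step_sum big_seq1/= indicE in_setT.
by rewrite scale1r.
Qed.

End strong_measurability_more.

Section bochner_integral.
Context {R : realType} {X : normedModType R} {d : measure_display} {T : measurableType d}
  (P : probability T R).
Local Open Scope ereal_scope.

Definition list_integral (l : seq (set T * X)) : X := (\sum_(a <- l) fine (P a.1) *: a.2)%R.

Lemma has_bochner_integral_list (f : T -> X) (v : X) :
  has_bochner_integral P f v <-> strongly_measurable measurable f /\
  exists l : nat -> seq (set T * X), [/\ forall n, sets_in measurable (l n),
        \int[P]_w (`|f w - step_sum (l n) w|%R)%:E @[n --> \oo] --> 0 &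
        list_integral (l n) @[n --> \oo] --> v].
Proof.
split=> -[mf].
  move=> [g [mg g0 gv]]; split=> //.
  have [l Hl] := choice (fun n => step_list (g n)).
  exists l; split=> [n||]; first by case: (Hl n) => H _ _; exact: H.
    have -> // : (fun n => \int[P]_w (`|f w - step_sum (l n) w|%R)%:E) =
      (fun n => \int[P]_w (`|f w - step_fun (g n) w|%R)%:E).
    by apply/funext => n; case: (Hl n) => _ -> _.
  have -> // : (fun n => list_integral (l n)) = (fun n => step_integral P (g n)).
  by apply/funext => n; case: (Hl n) => _ _ ->.
move=> [l [ml l0 lv]]; split=> //; exists (fun n => step_of (l n)); split=> [n||].
- exact: step_measurable_of.
- have -> // : (fun n => \int[P]_w (`|f w - step_fun (step_of (l n)) w|%R)%:E) =
      (fun n => \int[P]_w (`|f w - step_sum (l n) w|%R)%:E).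
  by apply/funext => n; apply: eq_integral => w _; rewrite step_fun_of.
- have -> // : (fun n => step_integral P (step_of (l n))) = (fun n => list_integral (l n)).
  by apply/funext => n; rewrite /list_integral (big_tnth _ _ (l n)).
Qed.

Lemma has_bochner_integral0 : has_bochner_integral P (fun=> 0%R : X) 0%R.
Proof.
apply/has_bochner_integral_list; split; first exact: strongly_measurable0.
exists (fun=> [::]); split=> [n||]; first by constructor.
  apply: cvg_near_cst; apply: nearW => n; rewrite integral0_eq// => w _.
  by rewrite /step_sum big_nil subrr normr0.
by apply: cvg_near_cst; apply: nearW => n; rewrite /list_integral big_nil.
Qed.

Lemma has_bochner_integralD (f g : T -> X) (u v : X) :
  has_bochner_integral P f u -> has_bochner_integral P g v ->
  has_bochner_integral P (fun w => f w + g w)%R (u + v)%R.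
Proof.
move=> /has_bochner_integral_list[mf [l [ml l0 lu]]].
move=> /has_bochner_integral_list[mg [l' [ml' l0' lv]]].
apply/has_bochner_integral_list; split; first exact: strongly_measurableD.
exists (fun n => l n ++ l' n); split=> [n||]; first exact: sets_in_cat.
- have mB (h : T -> X) (k : seq (set T * X)) : strongly_measurable measurable h ->
      sets_in measurable k -> measurable_fun setT (fun w => (`|h w - step_sum k w|%R)%:E).
    move=> mh mk; apply/measurable_EFinP; apply: norm_strongly_measurableT.
    apply: strongly_measurableD => //; apply: strongly_measurableN.
    exact: strongly_measurable_step_sum.
  have cvg0 := cvgeD (fin_num_adde_defl _ (erefl : 0 \is a fin_num)) l0 l0'.
  rewrite adde0 in cvg0.
  apply: (squeeze_cvge _ (cvg_cst _) (cvg0 _)) => //.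
  near=> n; rewrite integral_ge0//= -ge0_integralD//; [|exact: mB|exact: mB].
  apply: ge0_le_integral => //.
  + by apply: mB; [exact: strongly_measurableD|exact: sets_in_cat].
  + by apply: emeasurable_funD; exact: mB.
  + move=> w _; rewrite -EFinD lee_fin step_sum_cat opprD addrACA.
    exact: ler_normD.
- have -> : (fun n => list_integral (l n ++ l' n)) =
      (fun n => list_integral (l n) + list_integral (l' n))%R.
    by apply/funext => n; rewrite /list_integral big_cat.
  exact: cvgD.
Unshelve. all: by end_near. Qed.

(** Only finite-rank functions have to be integrated, so scalar dominated convergence suffices: step
    approximations of [h] are multiplied by the fixed vector [x]. *)
Lemma has_bochner_integral_scale (h : T -> R) (x : X) :
  P.-integrable setT (EFin \o h) ->
  has_bochner_integral P (fun w => h w *: x)%R (fine (\int[P]_w (h w)%:E) *: x)%R.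
Proof.
move=> ih; have mh : measurable_fun setT h.
  by apply/measurable_EFinP; exact: (measurable_int _ ih).
have smh := sigma_measurable_funE mh.
have [l [ml lh lle]] := real_step_approx smh.
pose S n w : R := (\sum_(a <- l n) (\1_(a.1) w : R) * a.2)%R.
have mi (A : set T) : measurable A -> P.-integrable setT (fun w => (\1_A w)%:E).
  by move=> mA; apply: integrable_indic => //; rewrite setTI//; rewrite -ltey ltey_eq fin_num_measure.
have lS n : sets_in measurable (l n) by rewrite -sigma_algebra_idE; exact: ml.
have iS n : P.-integrable setT (EFin \o S n) /\
    \int[P]_w (S n w)%:E = (\sum_(a <- l n) fine (P a.1) * a.2)%R%:E.
  rewrite /S; elim: (l n) (lS n) => [|[A y] s IH] H.
    rewrite big_nil; split; last first.
      by rewrite integral0_eq// => w _; rewrite big_nil.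
    rewrite (_ : _ \o _ = cst 0); first exact: integrable0.
    by apply/funext => w /=; rewrite big_nil.
  inversion H; subst; have [i1 i2] := IH H3.
  have iA : P.-integrable setT (fun w => (\1_A w * y)%:E).
    under eq_fun do rewrite mulrC EFinM; apply: integrableZl => //; exact: mi.
  split.
    rewrite (_ : _ \o _ = (fun w => (\1_A w * y)%:E) \+ (EFin \o (fun w => \sum_(a <- s) (\1_(a.1) w : R) * a.2)%R)).
      exact: integrableD.
    by apply/funext => w /=; rewrite big_cons EFinD.
  under eq_integral do rewrite big_cons/= EFinD.
  rewrite integralD//= i2 big_cons/= EFinD; congr (_ + _).
  under eq_integral do rewrite mulrC EFinM.
  rewrite integralZl//; last exact: mi.
  by rewrite integral_indic// setIT EFinM muleC fineK// fin_num_measure.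
have mS n : measurable_fun setT (EFin \o S n) by case: (iS n) => /measurable_int.
have c1 : {ae P, forall w, setT w -> (S n w)%:E @[n --> \oo] --> (h w)%:E}.
  by apply: aeW => w _; apply: cvg_EFin; [apply: nearW|exact: lh].
have c2 : {ae P, forall w (n : nat), setT w -> `|(S n w)%:E| <= `|h w|%:E}.
  by apply: aeW => w n _; rewrite lee_fin; exact: lle.
have [_ D1 D2] := dominated_convergence measurableT mS (measurable_int _ ih) c1
  (integrable_norm ih) c2.
apply/has_bochner_integral_list; split.
  rewrite -[X in strongly_measurable X]sigma_algebra_idE.
  apply: strongly_measurable_scale => //.
  rewrite (_ : (fun=> x) = step_sum [:: (setT, x)]).
    by apply: strongly_measurable_step_sum; constructor => //=; rewrite sigma_algebra_idE.
  apply/funext => w; rewrite /step_sum big_seq1/= indicE in_setT.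
  by rewrite scale1r.
exists (fun n => [seq (a.1, a.2 *: x)%R | a <- l n]); split.
- by move=> n; apply/List.Forall_map; exact: lS.
- have E n w : step_sum [seq (a.1, a.2 *: x)%R | a <- l n] w = (S n w *: x)%R.
    by rewrite /step_sum big_map scaler_suml; apply: eq_bigr => a _; rewrite scalerA.
  have -> : (fun n => \int[P]_w (`|h w *: x - step_sum [seq (a.1, a.2 *: x) | a <- l n] w|%R)%:E) =
      (fun n => `|x|%:E * \int[P]_w `|(S n w)%:E - (h w)%:E|).
    apply/funext => n; rewrite -ge0_integralZl//.
      by apply: eq_integral => w _; rewrite E -scalerBl normrZ EFinM muleC distrC.
    apply: measurableT_comp => //; apply: emeasurable_funB => //.
    - exact: mS.
    - exact: (measurable_int _ ih).
  by rewrite -[X in _ --> X](mule0 `|x|%:E); apply: cvgeZl.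
- have E n : list_integral [seq (a.1, a.2 *: x)%R | a <- l n] =
      (fine (\int[P]_w (S n w)%:E) *: x)%R.
    case: (iS n) => _ ->; rewrite /list_integral big_map scaler_suml.
    by apply: eq_bigr => a _; rewrite scalerA.
  under eq_fun do rewrite E.
  apply: cvgZr_tmp; apply: fine_cvg; rewrite fineK; first exact: D2.
  exact: integrable_fin_num ih.
Qed.

Lemma fspan_bochner (f : T -> X) :
  fspan (fun h => P.-integrable setT (EFin \o h) /\ \int[P]_w (h w)%:E = 0) f ->
  has_bochner_integral P f 0%R.
Proof.
elim => [|h x g [ih h0] _ IH]; first exact: has_bochner_integral0.
rewrite -[X in has_bochner_integral _ _ X](addr0 (0%R : X)).
apply: has_bochner_integralD => //.
by have := has_bochner_integral_scale x ih; rewrite h0 /= scale0r.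
Qed.

End bochner_integral.

(** * Discrete stochastic integrals *)

Definition bounded_sigma_measurable {R : realType} {d} {T : measurableType d}
    (C : set_system T) (f : T -> R) : Prop :=
  sigma_measurable_fun C f /\ exists b : R, forall w, `|f w| <= b.

Lemma sigma_measurable_fun_sub {d d'} {T : measurableType d} {U : measurableType d'}
    (C C' : set_system T) (f : T -> U) : C `<=` C' ->
  sigma_measurable_fun C f -> sigma_measurable_fun C' f.
Proof.
move=> CC' mf _ Y mY; have := mf measurableT Y mY.
by apply: smallest_sub; [exact: smallest_sigma_algebra|move=> A /CC'; exact: sub_sigma_algebra].
Qed.

Lemma bounded_sigma_measurableM {R : realType} {d} {T : measurableType d}
    (C : set_system T) (f g : T -> R) :
  bounded_sigma_measurable C f -> bounded_sigma_measurable C g ->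
  bounded_sigma_measurable C (fun w => f w * g w).
Proof.
move=> [mf [b fb]] [mg [c gc]]; split; first exact: measurable_funM.
by exists (b * c) => w; rewrite normrM ler_pM.
Qed.

Lemma fspan_bounded {R : realType} {X : normedModType R} {d} {T : measurableType d}
    (C : set_system T) (f : T -> X) :
  fspan (bounded_sigma_measurable C) f -> exists2 b : R, 0 <= b & forall w, `|f w| <= b.
Proof.
elim => [|g x h [_ [b gb]] _ [c c0 hc]]; first by exists 0 => // w; rewrite normr0.
have b0 : 0 <= b by apply: le_trans (gb point); exact: normr_ge0.
exists (b * `|x| + c) => [|w]; first by rewrite addr_ge0// mulr_ge0.
by apply: (le_trans (ler_normD _ _)); rewrite lerD// normrZ ler_wpM2r.
Qed.

Section martingale_constant.
Context {R : realType} {X : normedModType R}.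
Local Open Scope ereal_scope.

(** Martingale type raised to the power [s]: without the roots, the right side is additive over the
    increments. *)
Definition martingale_bound (s K : R) : Prop :=
  forall (d : measure_display) (T : measurableType d) (P : probability T R)
    (n : nat) (F : nat -> set_system T) (D : nat -> T -> X),
  martingale_difference P n F D ->
  (forall i, (i < n)%N -> \int[P]_w ((`|D i w| `^ s)%R)%:E < +oo) ->
  \int[P]_w ((`|\sum_(i < n) D i w| `^ s)%R)%:E
    <= K%:E * \sum_(i < n) \int[P]_w ((`|D i w| `^ s)%R)%:E.

Lemma martingale_type_bound (s : R) : (0 < s)%R -> martingale_type X s ->
  exists2 K : R, (0 < K)%R & martingale_bound s K.
Proof.
(* Nothing is known about the sign of [C]; the absolute value plus 1 ensures [0 < K]. *)
move=> s0 [C HC]; exists ((`|C| + 1) `^ s)%R.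
  by rewrite powR_gt0// ltr_wpDl.
move=> d T P n F D mD iD; have := HC _ _ _ _ _ _ mD iD.
set x := \int[P]_w _; set y := \sum_(i < n) _ => H.
have x0 : 0 <= x by apply: integral_ge0 => w _; rewrite lee_fin powR_ge0.
have y0 : 0 <= y.
  by apply: sume_ge0 => i _; apply: integral_ge0 => w _; rewrite lee_fin powR_ge0.
have sK z : 0 <= z -> (z `^ s^-1) `^ s = z.
  by move=> z0; rewrite -poweRrM mulVf ?gt_eqF// poweRe1.
rewrite -(sK x)// -(sK y)// -poweR_EFin -poweRM ?poweR_ge0 ?lee_fin ?addr_ge0//.
apply: gt0_ler_poweR; rewrite ?in_itv/= ?leey ?poweR_ge0 ?mule_ge0 ?poweR_ge0 ?lee_fin ?addr_ge0//; first exact: ltW.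
apply: (le_trans H); apply: lee_wpmul2r; first exact: poweR_ge0.
by rewrite lee_fin (le_trans (ler_norm _))// lerDl.
Qed.

End martingale_constant.

Section discrete.
Context {R : realType} {d : measure_display} {T : measurableType d}
  (P : probability T R) {dE : measure_display} {E : measurableType dE}
  (S : set E) (mu : {measure set E -> \bar R}) (N : T -> {measure set E -> \bar R})
  (HN : poisson_random_measure P S mu N)
  (D : nat -> set E) (mD : forall m, measurable (D m)) (DS : forall m, D m `<=` S)
  (tD : trivIset setT D) (D1 : forall m, (mu (D m) <= 1)%E).
Local Open Scope ereal_scope.

(* When the integrand on the cell [D m] is measurable with respect to
   [history_gen m], the increments over the cells are independent centred
   multipliers of the integrand. *)
Definition future (m : nat) : set E := \bigcup_(j in [set j | (m <= j)%N]) D j.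
Definition history_gen (m : nat) : set_system T := cylinder S N (future m).
Definition incr (m : nat) (w : T) : R := compensated mu N w (D m).
Definition mass (m : nat) : R := fine (mu (D m)).

Lemma mass_fin m : mu (D m) = (mass m)%:E.
Proof. by rewrite fineK// ge0_fin_numE// (le_lt_trans (D1 m))// ltry. Qed.

Lemma mass_ge0 m : (0 <= mass m)%R. Proof. exact: fine_ge0. Qed.

Lemma mass_le1 m : (mass m <= 1)%R.
Proof. by rewrite -lee_fin -mass_fin. Qed.

Lemma history_gen_measurable m : history_gen m `<=` measurable.
Proof. exact: cylinder_measurable HN _. Qed.

Lemma history_gen_mono m n : (m <= n)%N -> history_gen m `<=` history_gen n.
Proof.
move=> mn; apply: subset_cylinder => x [j /= nj Djx]; exists j => //=.
exact: leq_trans nj.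
Qed.

Lemma measurable_N m : measurable_fun setT (fun w => N w (D m)).
Proof. exact: (prm_measurable HN). Qed.

Lemma poisson_N m : poisson_distributed P (fun w => N w (D m)) (mass m).
Proof. by apply: (prm_poisson HN) => //; rewrite mass_fin ltry. Qed.

Lemma incr_sigma_measurable m : sigma_measurable_fun (history_gen m.+1) (incr m).
Proof.
have mN : @measurable_fun _ _ (g_sigma_algebraType (history_gen m.+1)) _ setT
    (fun w => N w (D m)).
  move=> _ Y mY; rewrite setTI; apply: sub_sigma_algebra; apply: cylinder1 => //.
  rewrite -subset0 => x [Dx [j /= mj Djx]].
  by have jm := tD Logic.I Logic.I (ex_intro _ x (conj Djx Dx)); rewrite jm ltnn in mj.
rewrite /incr /compensated; apply: measurableT_comp; first exact: fine_measurable.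
exact: emeasurable_funB.
Qed.

Lemma incr_measurable m : measurable_fun setT (incr m).
Proof.
apply: (measurable_fun_sigma (C := history_gen m.+1)).
  exact: history_gen_measurable.
exact: incr_sigma_measurable.
Qed.

Lemma integral_history_N m (W : T -> \bar R) (h : \bar R -> \bar R) :
  sigma_measurable_fun (history_gen m) W -> (forall w, 0 <= W w) ->
  measurable_fun setT h -> (forall u, 0 <= h u) ->
  \int[P]_w (W w * h (N w (D m))) = \int[P]_w W w * \int[P]_w h (N w (D m)).
Proof.
move=> mW W0 mh h0.
apply: (integral_indep (C := history_gen m)) => //.
- exact: history_gen_measurable.
- exact: measurable_N.
- move=> A Y sA mY; apply: (indep_past HN (D := D m)) => //.
  have sub : history_gen m `<=` cylinder S N (D m).
    by apply: subset_cylinder => x Dx; exists m => /=.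
  by apply: smallest_sub sA; [exact: smallest_sigma_algebra|move=> B /sub; exact: sub_sigma_algebra].
Qed.

Lemma integral_history_incr m (W : T -> \bar R) (q : R) : (1 <= q)%R ->
  sigma_measurable_fun (history_gen m) W -> (forall w, 0 <= W w) ->
  \int[P]_w (W w * (`|incr m w| `^ q)%:E) <=
  (poisson_const q * mass m)%:E * \int[P]_w W w.
Proof.
move=> q1 mW W0.
have H := @integral_history_N m W (fun z => (`|fine (z - (mass m)%:E)| `^ q)%:E) mW W0.
under eq_integral do rewrite /incr /compensated mass_fin.
rewrite {}H.
- rewrite muleC; apply: lee_wpmul2r; first exact: integral_ge0.
  apply: poisson_central_moment => //; [exact: measurable_N|exact: mass_ge0|exact: poisson_N|exact: mass_le1].
- apply/measurable_EFinP; apply: (measurableT_comp (measurable_powR _)).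
  apply: measurableT_comp => //; apply: measurableT_comp; first exact: fine_measurable.
  exact: emeasurable_funB.
- by move=> z; rewrite lee_fin powR_ge0.
Qed.

(** Where [N w (D m)] is infinite, [fine] yields 0 on the left and the sides may differ. The right
    side is a difference of nonnegative variables with the same mean, to each of which the product
    formula applies. *)
Lemma incr_ae m : {ae P, forall w, incr m w = (`|fine (N w (D m))| - mass m)%R}.
Proof.
have H0 := poisson_ae_nat (measurable_N m) (mass_ge0 m) (poisson_N m).
exists (~` [set w | exists k : nat, N w (D m) = k%:R%:E]); split => //.
  rewrite (_ : [set w | _] = \bigcup_k (fun w => N w (D m)) @^-1` [set k%:R%:E]).
    apply: measurableC; apply: bigcup_measurable => k _.
    by rewrite -[X in measurable X]setTI; apply: measurable_N.
  by apply/seteqP; split => [x [k xk]|x [k _ xk]]; exists k.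
move=> w /= H [k Nk]; apply: H.
by rewrite /incr /compensated Nk mass_fin /= ger0_norm.
Qed.

(** This is centring given the past, tested against bounded [u]. The product formula requires
    nonnegative factors, so [u] is split into positive and negative parts and the increment into its
    count and its mean. *)
Lemma integrable_history_incr m (u : T -> R) :
  bounded_sigma_measurable (history_gen m) u ->
  P.-integrable setT (EFin \o (fun w => u w * incr m w)%R) /\
  \int[P]_w (u w * incr m w)%:E = 0.
Proof.
have pos (v : T -> R) : bounded_sigma_measurable (history_gen m) v ->
    (forall w, 0 <= v w)%R ->
    P.-integrable setT (EFin \o (fun w => v w * incr m w)%R) /\
    \int[P]_w (v w * incr m w)%:E = 0.
  move=> [mv [b vb]] v0.
  have mv' : measurable_fun setT v.
    by apply: measurable_fun_sigma mv; exact: history_gen_measurable.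
  have iv : P.-integrable setT (EFin \o v).
    apply: measurable_bounded_integrable => //; first by rewrite -ge0_fin_numE ?fin_num_measure.
    by exists b; split; [exact: num_real|move=> c bc w _ /=]; apply: (le_trans (vb w)); exact: ltW.
  pose n w : R := `|fine (N w (D m))|%R.
  have mn : measurable_fun setT n.
    by apply: measurableT_comp => //; apply: measurableT_comp (measurable_N m) => //; exact: fine_measurable.
  have vn : \int[P]_w (v w * n w)%:E = \int[P]_w (v w)%:E * (mass m)%:E.
    rewrite -(poisson_mean (measurable_N m) (mass_ge0 m) (poisson_N m)).
    have mh : measurable_fun setT (fun z : \bar R => `|fine z|%:E).
      by apply/measurable_EFinP; apply: measurableT_comp => //; exact: fine_measurable.
    have mW : sigma_measurable_fun (history_gen m) (EFin \o v) by exact/measurable_EFinP.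
    rewrite -(integral_history_N mW _ mh) => [|w|z]; last 2 first.
    - by rewrite lee_fin.
    - by rewrite lee_fin.
    by apply: eq_integral => w _; rewrite EFinM.
  have fv : \int[P]_w (v w)%:E \is a fin_num by exact: integrable_fin_num iv.
  have ivn : P.-integrable setT (EFin \o (fun w => v w * n w)%R).
    apply/integrableP; split.
      by apply/measurable_EFinP; exact: measurable_funM.
    rewrite (_ : \int[P]_w _ = \int[P]_w (v w * n w)%:E); last first.
      by apply: eq_integral => w _ /=; rewrite ger0_norm// mulr_ge0// normr_ge0.
    by rewrite vn -(fineK fv) -EFinM ltry.
  have ivm : P.-integrable setT (EFin \o (fun w => v w * mass m)%R).
    rewrite (_ : _ \o _ = fun w => (v w)%:E * (mass m)%:E); last by apply/funext => w; rewrite -EFinM.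
    exact: integrableZr.
  have mvc : measurable_fun setT (EFin \o (fun w => v w * incr m w)%R).
    by apply/measurable_EFinP; apply: measurable_funM => //; exact: incr_measurable.
  have ibB : P.-integrable setT (EFin \o (fun w => v w * n w - v w * mass m)%R).
    rewrite (_ : _ \o _ = (EFin \o (fun w => v w * n w)%R) \- (EFin \o (fun w => v w * mass m)%R)).
      exact: integrableB.
    by apply/funext => w /=; rewrite EFinB.
  have ae : ae_eq P setT (EFin \o (fun w => v w * n w - v w * mass m)%R)
      (EFin \o (fun w => v w * incr m w)%R).
    by have := incr_ae m; apply: filterS => w Hw _ /=; rewrite Hw mulrBr.
  split.
    apply/integrableP; split => //.
    rewrite (_ : \int[P]_w _ = \int[P]_w ((v w)%:E * (`|incr m w| `^ 1)%:E)); last first.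
      by apply: eq_integral => w _; rewrite powRr1//= normrM ger0_norm.
    have mW : sigma_measurable_fun (history_gen m) (EFin \o v) by exact/measurable_EFinP.
    have v0e w : 0 <= (EFin \o v) w by rewrite lee_fin.
    apply: (le_lt_trans (integral_history_incr (lexx 1%R) mW v0e)).
    by rewrite -(fineK fv) -EFinM ltry.
  have <- := ae_eq_integral _ _ measurableT (measurable_int _ ibB) mvc ae.
  under eq_integral do rewrite /= EFinB.
  rewrite integralB//= vn.
  under [X in _ - X]eq_integral do rewrite EFinM.
  by rewrite integralZr// subee// fin_numM.
move=> [mu_ [b ub]].
have Hp : bounded_sigma_measurable (history_gen m) (u^\+)%R.
  split; first exact: measurable_funrpos.
  by exists b => w; rewrite ger0_norm// (le_trans _ (ub w))// /funrpos ge_max ler_norm normr_ge0.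
have Hn : bounded_sigma_measurable (history_gen m) (u^\-)%R.
  split; first exact: measurable_funrneg.
  by exists b => w; rewrite ger0_norm// (le_trans _ (ub w))// /funrneg ge_max -normrN ler_norm normr_ge0.
have [i1 e1] := pos _ Hp (funrpos_ge0 _); have [i2 e2] := pos _ Hn (funrneg_ge0 _).
have uE w : (u w * incr m w)%:E = ((u^\+ w * incr m w)%:E - (u^\- w * incr m w)%:E).
  by rewrite -EFinB -mulrBl -[in LHS](funrposBneg u).
split.
  rewrite (_ : _ \o _ = (EFin \o (fun w => u^\+ w * incr m w)%R) \- (EFin \o (fun w => u^\- w * incr m w)%R)).
    exact: integrableB.
  exact/funext.
by under eq_integral do rewrite uE; rewrite integralB//= e1 e2 subee.
Qed.

End discrete.

Lemma measurable_gt {R : realType} {d} {T : measurableType d} (f : T -> R) (l : R) :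
  measurable_fun setT f -> measurable [set w | l < f w].
Proof.
move=> mf; rewrite -[X in measurable X]setTI.
rewrite (_ : [set w | _] = f @^-1` `]l, +oo[); first exact: mf.
by apply/seteqP; split => w /=; rewrite in_itv/= andbT.
Qed.

(** * Martingale transforms and the weak-type bound *)

Section discrete_martingale.
Context {R : realType} {d : measure_display} {T : measurableType d}
  (P : probability T R) {dE : measure_display} {E : measurableType dE}
  (S : set E) (mu : {measure set E -> \bar R}) (N : T -> {measure set E -> \bar R})
  (HN : poisson_random_measure P S mu N)
  (D : nat -> set E) (mD : forall m, measurable (D m)) (DS : forall m, D m `<=` S)
  (tD : trivIset setT D) (D1 : forall m, (mu (D m) <= 1)%E).
Context {X : normedModType R} (s K : R) (s1 : (1 <= s)%R) (K0 : (0 < K)%R)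
  (mart : @martingale_bound R X s K).

Let G m := history_gen S N D m.
Let c m := incr mu N D m.
Let mm m := mass mu D m.

Definition transform (g : nat -> T -> X) (n : nat) (w : T) : X :=
  \sum_(m < n) incr mu N D m w *: g m w.

Fixpoint maximal (g : nat -> T -> X) (n : nat) (w : T) : R :=
  if n is n'.+1 then Num.max (maximal g n' w) `|transform g n w| else 0.

Lemma transformS g n w : transform g n.+1 w = transform g n w + c n w *: g n w.
Proof. by rewrite /transform big_ord_recr. Qed.

Lemma transform0 g w : transform g 0 w = 0.
Proof. by rewrite /transform big_ord0. Qed.

Lemma maximal_ge0 g n w : 0 <= maximal g n w.
Proof. by elim: n => //= n IH; rewrite le_max IH. Qed.

Lemma maximal_gt g n w l : 0 <= l ->
  l < maximal g n w <-> exists2 j, (j <= n)%N & l < `|transform g j w|.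
Proof.
move=> l0; elim: n => [|n IH] /=.
  split; first by rewrite ltNge l0.
  by move=> [j]; rewrite leqn0 => /eqP ->; rewrite transform0 normr0 ltNge l0.
rewrite lt_max; split.
  move=> /orP[/IH[j jn H]|H]; [exists j => //; exact: leqW|by exists n.+1].
move=> [j]; rewrite leq_eqVlt => /predU1P[-> ->|jn H]; first by rewrite orbT.
by apply/orP; left; apply/IH; exists j.
Qed.

Lemma maximal_ge g n j w : (j <= n)%N -> `|transform g j w| <= maximal g n w.
Proof.
move=> jn; rewrite leNgt; apply/negP => H.
have /(maximal_gt g n w (maximal_ge0 g n w)) : exists2 j, (j <= n)%N &
  maximal g n w < `|transform g j w| by exists j.
by rewrite ltxx.
Qed.

Lemma maximal_mono g n j w : (j <= n)%N -> maximal g j w <= maximal g n w.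
Proof.
move=> /subnKC <-; elim: (n - j)%N => [|k IH]; first by rewrite addn0.
by rewrite addnS /= le_max IH.
Qed.

(** Predictability: [g m] is known before cell [m] is observed. The parameter selects bounded
    coefficients, which integrability requires, or merely measurable ones. *)
Definition adapted (K' : set_system T -> (T -> R) -> Prop) (g : nat -> T -> X) :=
  forall m, fspan (K' (history_gen S N D m)) (g m).

Lemma adapted_bounded g : adapted (@bounded_sigma_measurable _ _ _) g ->
  adapted (@sigma_measurable_fun _ _ _ _) g.
Proof. by move=> Hg m; apply: fspan_mono (Hg m) => u []. Qed.

Lemma strongly_measurable_adapted g m n : adapted (@sigma_measurable_fun _ _ _ _) g ->
  (m <= n)%N -> strongly_measurable <<s G n >> (g m).
Proof.
move=> Hg mn; apply: (@strongly_measurable_sub _ _ _ _ <<s G m >>).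
  apply: smallest_sub; first exact: smallest_sigma_algebra.
  by move=> A /(history_gen_mono mn); exact: sub_sigma_algebra.
exact: fspan_strongly_measurable.
Qed.

Lemma transform_strongly_measurable g n : adapted (@sigma_measurable_fun _ _ _ _) g ->
  strongly_measurable <<s G n >> (transform g n).
Proof.
move=> Hg; rewrite /transform.
suff H k : (k <= n)%N -> strongly_measurable <<s G n >> (transform g k) by exact: H.
elim: k => [|k IH] kn.
  rewrite (_ : transform g 0 = fun=> 0); first exact: strongly_measurable0.
  by apply/funext => w; rewrite transform0.
rewrite (_ : transform g k.+1 = fun w => transform g k w + c k w *: g k w); last first.
  by apply/funext => w; rewrite transformS.
apply: strongly_measurableD; first by apply: IH; exact: ltnW.
apply: strongly_measurable_scale; last by apply: strongly_measurable_adapted => //; exact: ltnW.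
apply: (sigma_measurable_fun_sub (C := G k.+1)); first exact: history_gen_mono.
exact: incr_sigma_measurable.
Qed.

Lemma maximal_sigma_measurable g n : adapted (@sigma_measurable_fun _ _ _ _) g ->
  sigma_measurable_fun (G n) (maximal g n).
Proof.
move=> Hg; elim: n => [|n IH]; first exact: measurable_cst.
apply: measurable_maxr.
  by apply: (sigma_measurable_fun_sub (C := G n)) IH; exact: history_gen_mono.
exact: (norm_strongly_measurable (transform_strongly_measurable n.+1 Hg)).
Qed.

Lemma norm_adapted_measurable g m : adapted (@sigma_measurable_fun _ _ _ _) g ->
  sigma_measurable_fun (G m) (fun w => `|g m w|).
Proof.
move=> Hg; apply: norm_strongly_measurable; exact: strongly_measurable_adapted.
Qed.

Lemma history_measurable_fun m {d'} {U : measurableType d'} (f : T -> U) :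
  sigma_measurable_fun (G m) f -> measurable_fun setT f.
Proof. by apply: measurable_fun_sigma; exact: (history_gen_measurable HN). Qed.

Lemma maximal_measurable g n : adapted (@sigma_measurable_fun _ _ _ _) g ->
  measurable_fun setT (maximal g n).
Proof. by move=> Hg; apply: (history_measurable_fun (m := n)); exact: maximal_sigma_measurable. Qed.

Local Open Scope ereal_scope.

Lemma integral_norm_incr g m q : (1 <= q)%R -> adapted (@sigma_measurable_fun _ _ _ _) g ->
  \int[P]_w ((`|c m w *: g m w| `^ q)%R)%:E <=
  (poisson_const q * mm m)%:E * \int[P]_w ((`|g m w| `^ q)%R)%:E.
Proof.
move=> q1 Hg.
have mW : sigma_measurable_fun (G m) (fun w => (`|g m w| `^ q)%:E).
  apply/measurable_EFinP; apply: (measurableT_comp (measurable_powR _)).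
  exact: norm_adapted_measurable.
have W0 w : 0 <= (`|g m w| `^ q)%:E by rewrite lee_fin powR_ge0.
apply: le_trans (integral_history_incr HN mD DS D1 q1 mW W0).
rewrite le_eqVlt; apply/orP; left; apply/eqP; apply: eq_integral => w _.
by rewrite normrZ powRM// mulrC EFinM.
Qed.

Lemma transform_martingale_difference g n : adapted (@bounded_sigma_measurable _ _ _) g ->
  martingale_difference P n (fun i => <<s G i >>) (fun i w => c i w *: g i w)%R.
Proof.
move=> Hg; have Hg' := adapted_bounded Hg; split.
- move=> i _; split; first exact: smallest_sigma_algebra.
  by apply: smallest_sub; [exact: sigma_algebra_measurable|exact: (history_gen_measurable HN)].
- move=> i _; apply: smallest_sub; first exact: smallest_sigma_algebra.
  by move=> A /(history_gen_mono (leqnSn i)); exact: sub_sigma_algebra.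
move=> i _; split.
  apply: strongly_measurable_scale; last exact: strongly_measurable_adapted.
  exact: incr_sigma_measurable.
split; first exact: strongly_measurable0.
move=> A GA; exists 0%R; split; last first.
  under eq_fun do rewrite scaler0; exact: has_bochner_integral0.
apply: fspan_bochner.
rewrite (_ : (fun w => _) = fun w => (\1_A w * c i w) *: g i w)%R; last first.
  by apply/funext => w; rewrite -scalerA.
apply: fspan_scale (Hg i) => u bu.
(* The test event is absorbed into the scalar coefficient, which stays bounded and known before cell
   [i]. *)
have bAu : bounded_sigma_measurable (G i) (fun w => \1_A w * u w)%R.
  apply: bounded_sigma_measurableM => //; split; first exact: measurable_indic.
  by exists 1%R => w; rewrite indicE; case: (w \in A); rewrite ?normr1// normr0.
have Ac : (fun w => \1_A w * c i w * u w)%R = (fun w => \1_A w * u w * c i w)%R.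
  by apply/funext => w; rewrite mulrAC.
have [i1 i2] := integrable_history_incr HN mD DS tD D1 bAu.
split; first by rewrite Ac.
by rewrite -[RHS]i2; apply: eq_integral => w _; rewrite mulrAC.
Qed.

Lemma transform_bound g n : adapted (@bounded_sigma_measurable _ _ _) g ->
  \int[P]_w ((`|transform g n w| `^ s)%R)%:E <=
  (K * poisson_const s)%:E * \sum_(m < n) (mm m)%:E * \int[P]_w ((`|g m w| `^ s)%R)%:E.
Proof.
move=> Hg; have Hg' := adapted_bounded Hg.
have pc0 : (0 <= poisson_const s)%R.
  exact/ltW/poisson_const_gt0.
apply: (le_trans (mart (transform_martingale_difference n Hg) _)).
  move=> i _; apply: (le_lt_trans (integral_norm_incr i s1 Hg')).
  have [b b0 gb] := fspan_bounded (Hg i).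
  apply: (@le_lt_trans _ _ ((poisson_const s * mm i)%:E * (b `^ s)%:E)); last by rewrite -EFinM ltry.
  apply: lee_wpmul2l; first by rewrite lee_fin mulr_ge0// mass_ge0.
  rewrite -[leRHS]mule1 -(probability_setT P) -(integral_cst P measurableT).
  apply: ge0_le_integral => //.
  - apply/measurable_EFinP; apply: (measurableT_comp (measurable_powR _)).
    by apply: (history_measurable_fun (m := i)); exact: norm_adapted_measurable.
  - move=> w _; rewrite lee_fin; apply: ge0_ler_powR; rewrite ?nnegrE//.
    by apply: le_trans s1.
rewrite EFinM -muleA; apply: lee_wpmul2l; first by rewrite lee_fin ltW.
rewrite ge0_sume_distrr; last first.
  by move=> i _; rewrite mule_ge0 ?lee_fin ?mass_ge0//; apply: integral_ge0 => w _; rewrite lee_fin powR_ge0.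
apply: lee_sum => i _; rewrite muleA -EFinM.
exact: integral_norm_incr.
Qed.

Lemma bounded_indicator m (b : T -> bool) : sigma_measurable_fun (G m) b ->
  bounded_sigma_measurable (G m) (fun w => (b w)%:R : R).
Proof.
move=> mb; split; last by exists 1%R => w; case: (b w); rewrite ?normr1// normr0.
rewrite (_ : (fun w => _) = fun w => if b w then 1%R else 0%R).
  by apply: measurable_fun_ifT => //; exact: measurable_cst.
by apply/funext => w; case: (b w).
Qed.

(** [maximal g m] involves only the cells before [m], so stopping at the first passage above [l]
    preserves predictability. *)
Definition stopped (g : nat -> T -> X) (l : R) (m : nat) (w : T) : X :=
  ((maximal g m w <= l)%R%:R *: g m w)%R.

Lemma stopped_adapted g l : adapted (@bounded_sigma_measurable _ _ _) g ->
  adapted (@bounded_sigma_measurable _ _ _) (stopped g l).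
Proof.
move=> Hg m; apply: fspan_scale (Hg m) => u bu.
apply: bounded_sigma_measurableM => //; apply: bounded_indicator.
apply: measurable_fun_ler; last exact: measurable_cst.
exact: (maximal_sigma_measurable (adapted_bounded Hg)).
Qed.

(** After the passage the stopped transform is frozen at a value of norm above [l]. A large maximum
    is thus visible at the terminal index, where Markov's inequality and martingale type apply. *)
Lemma transform_stopped g (l : R) n w : (0 <= l)%R ->
  ((maximal g n w <= l)%R -> transform (stopped g l) n w = transform g n w) /\
  (l < maximal g n w -> l < `|transform (stopped g l) n w|)%R.
Proof.
move=> l0; elim: n => [|n [IH1 IH2]].
  by rewrite !transform0 normr0 /=; split.
rewrite !transformS /stopped; case: (lerP (maximal g n w) l) => ml.
  rewrite scale1r (IH1 ml) /= ge_max ml lt_max ltNge ml /= transformS; split=> //.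
rewrite scale0r scaler0 addr0; split=> [|_]; last exact: IH2.
by move=> H; have := lt_le_trans ml (le_trans (maximal_mono g w (leqnSn n)) H); rewrite ltxx.
Qed.

Lemma maximal_weak g n (l : R) : adapted (@bounded_sigma_measurable _ _ _) g -> (0 < l)%R ->
  (l `^ s)%:E * P [set w | (l < maximal g n w)%R] <=
  (K * poisson_const s)%:E * \sum_(m < n) (mm m)%:E * \int[P]_w ((`|g m w| `^ s)%R)%:E.
Proof.
move=> Hg l0; have Hg' := adapted_bounded Hg.
have Hs := stopped_adapted l Hg; have Hs' := adapted_bounded Hs.
have s0 : (0 <= s)%R by apply: le_trans s1.
have pc0 : (0 <= poisson_const s)%R.
  exact/ltW/poisson_const_gt0.
have mpow (h : T -> X) : strongly_measurable measurable h ->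
    measurable_fun setT (fun w => (`|h w| `^ s)%:E).
  move=> mh; apply/measurable_EFinP; apply: (measurableT_comp (measurable_powR _)).
  exact: norm_strongly_measurableT.
have sG m : <<s G m >> `<=` measurable.
  by apply: smallest_sub; [exact: sigma_algebra_measurable|exact: (history_gen_measurable HN)].
have mev : measurable [set w | (l < maximal g n w)%R].
  exact/measurable_gt/maximal_measurable.
apply: (@le_trans _ _ (\int[P]_w ((`|transform (stopped g l) n w| `^ s)%R)%:E)).
  rewrite -(setIT [set w | _]) -integral_indic// -ge0_integralZl//; last 2 first.
  - exact/measurable_EFinP/measurable_indic.
  - by rewrite lee_fin powR_ge0.
  apply: ge0_le_integral => //.
  - by move=> w _; rewrite -EFinM lee_fin mulr_ge0 ?powR_ge0.
  - by apply: emeasurable_funM => //; exact/measurable_EFinP/measurable_indic.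
  - apply: mpow; apply: strongly_measurable_sub (transform_strongly_measurable n Hs').
    exact: sG.
  - move=> w _; rewrite -EFinM lee_fin indicE; case: (boolP (w \in _)) => [|_]; last by rewrite mulr0 powR_ge0.
    rewrite inE => /= lm; rewrite mulr1; apply: ge0_ler_powR; rewrite ?nnegrE// ?ltW//.
    by have [_ ->] := transform_stopped g n w (ltW l0).
apply: (le_trans (transform_bound n Hs)); apply: lee_wpmul2l.
  by rewrite lee_fin mulr_ge0// ltW.
apply: lee_sum => m _; apply: lee_wpmul2l; first by rewrite lee_fin mass_ge0.
apply: ge0_le_integral => //.
- by apply: mpow; apply: strongly_measurable_sub (strongly_measurable_adapted Hs' (leqnn m)); exact: sG.
- by apply: mpow; apply: strongly_measurable_sub (strongly_measurable_adapted Hg' (leqnn m)); exact: sG.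
move=> w _; rewrite lee_fin; apply: ge0_ler_powR; rewrite ?nnegrE//.
by rewrite /stopped; case: (maximal g m w <= l)%R; rewrite ?scale1r// scale0r normr0.
Qed.

End discrete_martingale.

(** * Dyadic sums *)

Section dyadic.
Context {R : realType}.
Implicit Types (a p s t y eps : R).

Lemma powR_le a x y : 0 <= a -> 0 <= x -> x <= y -> x `^ a <= y `^ a :> R.
Proof.
by move=> a0 x0 xy; apply: ge0_ler_powR; rewrite ?nnegrE// (le_trans x0).
Qed.

Definition dyad eps (k : nat) : R := eps * 2 ^+ k.
(** The sum of the geometric series of ratio 2^(-a), for [0 < a]. *)
Definition geo a : R := 2 `^ a / (2 `^ a - 1).

Lemma dyadS eps k : dyad eps k.+1 = 2 * dyad eps k.
Proof. by rewrite /dyad exprS mulrCA. Qed.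

Lemma dyad_gt0 eps k : 0 < eps -> 0 < dyad eps k.
Proof. by move=> e0; rewrite mulr_gt0// exprn_gt0. Qed.

Lemma dyad_mono eps j k : 0 < eps -> (j <= k)%N -> dyad eps j <= dyad eps k.
Proof. by move=> e0 jk; rewrite /dyad ler_wpM2l ?(ltW e0)// ler_weXn2l// ler1n. Qed.

Lemma powR2_gt1 a : 0 < a -> 1 < 2 `^ a :> R.
Proof.
move=> a0; have E : 1 `^ a = 1 :> R by rewrite powR1.
rewrite -[ltLHS]E.
by apply: gt0_ltr_powR; rewrite ?nnegrE ?ltr1n.
Qed.

Lemma geo_gt0 a : 0 < a -> 0 < geo a.
Proof. by move=> a0; rewrite divr_gt0 ?powR_gt0// subr_gt0 powR2_gt1. Qed.

Lemma geoE a : 0 < a -> geo a = 1 + (2 `^ a - 1)^-1.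
Proof.
move=> a0; have h : 2 `^ a - 1 != 0 :> R by rewrite gt_eqF// subr_gt0 powR2_gt1.
by rewrite /geo; field.
Qed.

Lemma dyadic_sum_le a eps t (L : nat) : 0 < a -> 0 < eps -> 0 <= t ->
  \sum_(k < L) (dyad eps k <= t)%R%:R * dyad eps k `^ a <= geo a * t `^ a.
Proof.
move=> a0 e0 t0.
have r1 := powR2_gt1 a0.
have h : 0 < 2 `^ a - 1 :> R by rewrite subr_gt0.
have g0 := ltW (geo_gt0 a0); have hi : 0 <= (2 `^ a - 1)^-1 :> R by rewrite invr_ge0 ltW.
(* The second estimate bounds the full geometric sum over the levels before [L]. It yields the first
   one when level [L] itself still lies below [t]. *)
suff /andP[] : (\sum_(k < L) (dyad eps k <= t)%R%:R * dyad eps k `^ a <= geo a * t `^ a)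
  && (\sum_(k < L) (dyad eps k <= t)%R%:R * dyad eps k `^ a <= dyad eps L `^ a / (2 `^ a - 1)) by [].
elim: L => [|L /andP[IH1 IH2]].
  by rewrite big_ord0 !mulr_ge0 ?powR_ge0.
have d0 := dyad_gt0 L e0.
have dS : dyad eps L.+1 `^ a = 2 `^ a * dyad eps L `^ a.
  by rewrite dyadS powRM// ltW.
rewrite big_ord_recr/=; case: (lerP (dyad eps L) t) => Lt; last first.
  rewrite mul0r addr0 IH1/=; apply: (le_trans IH2).
  by rewrite ler_wpM2r// dS ler_peMl ?powR_ge0// ltW.
rewrite mul1r; have E : dyad eps L `^ a / (2 `^ a - 1) + dyad eps L `^ a = geo a * dyad eps L `^ a.
  by rewrite geoE// mulrDl mul1r addrC mulrC.
apply/andP; split.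
  apply: (@le_trans _ _ (geo a * dyad eps L `^ a)); first by rewrite -E lerD2r.
  by rewrite ler_wpM2l//; apply: powR_le => //; exact: ltW.
by rewrite dS (le_trans (lerD IH2 (lexx _)))// E /geo mulrAC.
Qed.

Lemma dyadic_sum_gt a eps t (L : nat) : 0 < a -> 0 < eps -> 0 < t ->
  \sum_(k < L) (t < dyad eps k)%R%:R * dyad eps k `^ (- a) <= geo a * t `^ (- a).
Proof.
move=> a0 e0 t0.
have r1 := powR2_gt1 a0.
have h : 0 < 2 `^ a - 1 :> R by rewrite subr_gt0.
have g0 := ltW (geo_gt0 a0).
have anti (x : R) : t <= x -> x `^ (- a) <= t `^ (- a).
  move=> tx; have x0 : 0 < x by apply: lt_le_trans tx.
  rewrite !powRN lef_pV2 ?posrE ?powR_gt0//.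
  by apply: powR_le => //; exact: ltW.
(* The added term is the whole geometric tail from level [L] on, so the induction step loses
   nothing. *)
suff : \sum_(k < L) (t < dyad eps k)%R%:R * dyad eps k `^ (- a) +
    (t < dyad eps L)%R%:R * (geo a * dyad eps L `^ (- a)) <= geo a * t `^ (- a).
  by apply: le_trans; rewrite lerDl mulr_ge0// mulr_ge0// powR_ge0.
elim: L => [|L IH].
  rewrite big_ord0 add0r; case: ltP => tL; last by rewrite mul0r mulr_ge0 ?powR_ge0.
  by rewrite mul1r ler_wpM2l// anti// ltW.
rewrite big_ord_recr/=.
have d0 := dyad_gt0 L e0.
have dS : dyad eps L.+1 `^ (- a) = (2 `^ a)^-1 * dyad eps L `^ (- a).
  by rewrite dyadS powRM// ?(ltW d0)// [in LHS]powRN.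
have [tL|Lt] := ltP t (dyad eps L).
  have tL1 : t < dyad eps L.+1.
    by apply: (lt_le_trans tL); exact: dyad_mono.
  rewrite tL1 !mul1r; apply: le_trans IH; rewrite tL mul1r -addrA lerD2l dS.
  rewrite geoE// le_eqVlt; apply/orP; left; apply/eqP.
  by field; rewrite !gt_eqF// ?powR_gt0.
rewrite mul0r addr0 big1 ?add0r => [|[k kL] _ /=]; last first.
  by rewrite ltNge (le_trans (dyad_mono e0 (ltnW kL)) Lt) mul0r.
case: ltP => tL; last by rewrite mul0r mulr_ge0 ?powR_ge0.
by rewrite mul1r ler_wpM2l// anti// ltW.
Qed.

(** Truncation at level [L] makes the claim inductive. If [y] exceeds level [L], the next truncation
    is at most twice that level, and 2^p times the last summand covers its power. *)
Lemma dyadic_layer p eps y (L : nat) : 0 < p -> 0 < eps -> 0 <= y ->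
  Num.min y (dyad eps L) `^ p <=
  eps `^ p + 2 `^ p * \sum_(k < L) (dyad eps k < y)%R%:R * dyad eps k `^ p.
Proof.
move=> p0 e0 y0.
elim: L => [|L IH].
  rewrite big_ord0 mulr0 addr0 /dyad expr0 mulr1.
  by apply: powR_le; rewrite ?le_min ?y0 ?ge_min ?lexx ?orbT ?ltW.
rewrite big_ord_recr/= mulrDr addrA.
have [yL|Ly] := leP y (dyad eps L).
  have E : Num.min y (dyad eps L.+1) = Num.min y (dyad eps L).
    rewrite !min_l//; apply: (le_trans yL); exact: dyad_mono.
  by rewrite E mul0r mulr0 addr0.
rewrite mul1r; apply: (@le_trans _ _ (dyad eps L.+1 `^ p)).
  by apply: powR_le; rewrite ?le_min ?y0 ?ge_min ?lexx ?orbT ?ltW ?dyad_gt0.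
have dL0 := ltW (dyad_gt0 L e0).
rewrite dyadS powRM// lerDr addr_ge0 ?powR_ge0//.
rewrite mulr_ge0 ?powR_ge0// sumr_ge0// => k _.
by rewrite mulr_ge0 ?powR_ge0.
Qed.

Lemma dyad_unbounded eps y : 0 < eps -> exists L, y <= dyad eps L.
Proof.
move=> e0; have [L HL] : exists L : nat, y / eps <= L%:R.
  exists (Num.trunc (y / eps)).+1; exact/ltW/truncnS_gt.
exists L; rewrite /dyad mulrC -ler_pdivrMr//; apply: (le_trans HL).
rewrite -natrX ler_nat; exact/ltnW/ltn_expl.
Qed.

(* Relative to the level 1, small values are measured in L^s and large values
   in L^1. *)
Definition psi s (u : R) : R := Num.min u (u `^ s).

Lemma psi_ge0 s u : 0 <= u -> 0 <= psi s u.
Proof. by move=> u0; rewrite /psi le_min u0 powR_ge0. Qed.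

Lemma psi_le s u v : 0 <= s -> 0 <= u -> u <= v -> psi s u <= psi s v.
Proof.
move=> s0 u0 uv; rewrite /psi le_min !ge_min uv/=; apply/orP; right.
by apply: powR_le.
Qed.

Lemma psi_small s u : 1 <= s -> 0 <= u -> u <= 1 -> psi s u = u `^ s.
Proof.
move=> s1 u0 u1; rewrite /psi min_r//.
have [->|un0] := eqVneq u 0; first by rewrite powR0// gt_eqF// (lt_le_trans _ s1).
by apply: ge1r_powR => //; rewrite lt_neqAle eq_sym un0 u0.
Qed.

Lemma psi_large s u : 1 <= s -> 1 <= u -> psi s u = u.
Proof. by move=> s1 u1; rewrite /psi min_l// le1r_powR. Qed.

(** If [v] is the larger argument, the sum is at most 2 v, and doubling the argument multiplies
    [psi] by at most 2^s <= 4. *)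
Lemma psiD s u v : 1 <= s -> s <= 2 -> 0 <= u -> 0 <= v ->
  psi s (u + v) <= 4 * (psi s u + psi s v).
Proof.
move=> s1 s2; have s0 : 0 <= s by apply: le_trans s1.
have key x y : 0 <= x -> 0 <= y -> x <= y -> psi s (x + y) <= 4 * (psi s x + psi s y).
  move=> x0 y0 xy; apply: (@le_trans _ _ (psi s (2 * y))).
    by apply: psi_le => //; [exact: addr_ge0|lra].
  apply: (@le_trans _ _ (4 * psi s y)); last by rewrite ler_wpM2l// lerDr psi_ge0.
  rewrite /psi powRM// [leRHS]minr_pMr// le_min !ge_min; apply/andP; split; apply/orP.
    by left; rewrite ler_wpM2r// ler_nat.
  right; rewrite ler_wpM2r ?powR_ge0//.
  have -> : 4 = 2 `^ 2%:R :> R by rewrite powR_mulrn// -natrX.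
  by apply: ler_powR => //; rewrite ler1n.
move=> u0 v0; have [uv|/ltW vu] := leP u v; first exact: key.
by rewrite addrC [psi s u + _]addrC; apply: key.
Qed.

(** The condition on term [m] already counts [v m], so the retained sum does not overshoot [a]. *)
Lemma sum_stopped (v : nat -> R) (a : R) n : (forall m, 0 <= v m) -> 0 <= a ->
  \sum_(m < n) (\sum_(j < m.+1) v j <= a)%R%:R * v m <= Num.min a (\sum_(m < n) v m).
Proof.
move=> v0 a0; elim: n => [|n]; first by rewrite !big_ord0 le_min a0 lexx.
rewrite !le_min => /andP[IH1 IH2]; rewrite big_ord_recr/=.
have [H|H] := leP (\sum_(j < n.+1) v j) a; last first.
  by rewrite mul0r addr0 IH1/= big_ord_recr/= (le_trans IH2)// lerDl.
rewrite mul1r; have E : \sum_(i < n) (\sum_(j < i.+1) v j <= a)%R%:R * v i + v n <= \sum_(m < n.+1) v m.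
  by rewrite big_ord_recr/= lerD2r.
by rewrite E (le_trans E H).
Qed.

End dyadic.

(** * Tail and moment bounds *)

Section discrete_tails.
Context {R : realType} {d : measure_display} {T : measurableType d}
  (P : probability T R) {dE : measure_display} {E : measurableType dE}
  (S : set E) (mu : {measure set E -> \bar R}) (N : T -> {measure set E -> \bar R})
  (HN : poisson_random_measure P S mu N)
  (D : nat -> set E) (mD : forall m, measurable (D m)) (DS : forall m, D m `<=` S)
  (tD : trivIset setT D) (D1 : forall m, (mu (D m) <= 1)%E).
Context {X : normedModType R} (s K : R) (s1 : (1 <= s)%R) (K0 : (0 < K)%R)
  (mart : @martingale_bound R X s K).

Implicit Types (f g : nat -> T -> X) (h : R -> R).

Let G m := history_gen S N D m.
Let c m := incr mu N D m.
Let mm m := mass mu D m.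
Let tr := @transform _ _ _ _ _ mu N D X.
Let mx := @maximal _ _ _ _ _ mu N D X.

Lemma mm_ge0 m : 0 <= mm m. Proof. exact: mass_ge0. Qed.

Definition gated (b : nat -> T -> bool) (f : nat -> T -> X) (m : nat) (w : T) : X :=
  (b m w)%:R *: f m w.

Lemma gated_adapted b f : (forall m, sigma_measurable_fun (G m) (b m)) ->
  adapted S N D (@bounded_sigma_measurable _ _ _) f ->
  adapted S N D (@bounded_sigma_measurable _ _ _) (gated b f).
Proof.
move=> mb Hf m; apply: fspan_scale (Hf m) => u bu.
by apply: bounded_sigma_measurableM => //; apply: bounded_indicator.
Qed.

Lemma norm_gated b f m w : `|gated b f m w| = (b m w)%:R * `|f m w|.
Proof. by rewrite /gated normrZ; case: (b m w); rewrite ?normr1// normr0. Qed.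

Lemma powR_norm_gated b f m w q : 0 < q ->
  `|gated b f m w| `^ q = (b m w)%:R * `|f m w| `^ q.
Proof.
move=> q0; rewrite norm_gated; case: (b m w); rewrite ?mul1r// !mul0r powR0//.
by rewrite gt_eqF.
Qed.

(** The discrete form of the integral of h applied to the norm of the integrand;
    [integral_restricted] identifies the two. *)
Definition energy (h : R -> R) (f : nat -> T -> X) (n : nat) (w : T) : R :=
  \sum_(m < n) mass mu D m * h `|f m w|.

Lemma energy_mono h f j n w : (forall x, 0 <= x -> 0 <= h x) -> (j <= n)%N ->
  energy h f j w <= energy h f n w.
Proof.
move=> h0 /subnKC <-; elim: (n - j)%N => [|k IH]; first by rewrite addn0.
rewrite addnS /energy big_ord_recr/= (le_trans IH)// lerDl mulr_ge0 ?h0//.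
exact: mass_ge0.
Qed.

Lemma energy_ge0 h f n w : (forall x, 0 <= x -> 0 <= h x) -> 0 <= energy h f n w.
Proof. by move=> h0; apply: sumr_ge0 => i _; rewrite mulr_ge0 ?h0// mass_ge0. Qed.

(** The energy up to and including term [m] is still known before cell [m], because [f m] is. Hence
    one can stop before the energy passes a threshold, without an extra term. *)
Lemma energyS_measurable h f m : measurable_fun setT h ->
  adapted S N D (@sigma_measurable_fun _ _ _ _) f ->
  sigma_measurable_fun (G m) (energy h f m.+1).
Proof.
move=> mh Hf; rewrite /energy /sigma_measurable_fun.
have H k : (k <= m.+1)%N -> sigma_measurable_fun (G m) (fun w => \sum_(j < k) mass mu D j * h `|f j w|).
  elim: k => [|k IH] km; first by under eq_fun do rewrite big_ord0; exact: measurable_cst.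
  under eq_fun do rewrite big_ord_recr/=.
  apply: measurable_funD; first by apply: IH; exact: ltnW.
  apply: measurable_funM; first exact: measurable_cst.
  apply: measurableT_comp => //.
  have := norm_adapted_measurable (m := k) Hf.
  by apply: sigma_measurable_fun_sub; exact: history_gen_mono.
exact: H.
Qed.

Lemma energy_measurable h f n : measurable_fun setT h ->
  adapted S N D (@sigma_measurable_fun _ _ _ _) f -> measurable_fun setT (energy h f n).
Proof.
move=> mh Hf; case: n => [|n].
  rewrite (_ : energy h f 0 = cst 0); first exact: measurable_cst.
  by apply/funext => w; rewrite /energy big_ord0.
by apply: (history_measurable_fun (m := n) HN); exact: energyS_measurable.
Qed.

Fixpoint jumps (f : nat -> T -> X) (n : nat) (w : T) : R :=
  if n is n'.+1 then Num.max (jumps f n' w) `|incr mu N D n' w *: f n' w| else 0.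

Lemma jumps_ge f n m w : (m < n)%N -> `|c m w *: f m w| <= jumps f n w.
Proof.
elim: n => // n IH; rewrite ltnS leq_eqVlt /= le_max => /predU1P[->|/IH->//].
by rewrite lexx orbT.
Qed.

Lemma jumps_ge0 f n w : 0 <= jumps f n w.
Proof. by elim: n => //= n IH; rewrite le_max IH. Qed.

Lemma jump_measurable f m : adapted S N D (@sigma_measurable_fun _ _ _ _) f ->
  measurable_fun setT (fun w => `|c m w *: f m w|).
Proof.
move=> Hf.
rewrite (_ : (fun w => _) = fun w => `|c m w| * `|f m w|); last first.
  by apply/funext => w; rewrite normrZ.
apply: measurable_funM.
  by apply: measurableT_comp => //; exact: (incr_measurable HN mD DS tD m).
exact: (history_measurable_fun HN (norm_adapted_measurable (m := m) Hf)).
Qed.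

Lemma jumps_measurable f n : adapted S N D (@sigma_measurable_fun _ _ _ _) f ->
  measurable_fun setT (jumps f n).
Proof.
move=> Hf; elim: n => [|n IH] /=; first exact: measurable_cst.
by apply: measurable_maxr => //; exact: jump_measurable.
Qed.

(* The gate opens when the maximal function crosses [l], at which time the
   transform is at most [l] plus one jump. *)
Lemma start_gate f (l e : R) n w (b : nat -> T -> bool) : 0 <= l ->
  (forall m, (m < n)%N -> b m w = (l < mx f m w)) ->
  jumps f n w <= e -> forall j, (j <= n)%N ->
  (mx f j w <= l -> tr (gated b f) j w = 0) /\
  (l < mx f j w -> `|tr f j w - tr (gated b f) j w| <= l + e).
Proof.
move=> l0 bE Je; elim => [|j IH] jn.
  split; first by rewrite /tr transform0.
  by rewrite /mx /= ltNge l0.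
have {IH} [IH1 IH2] := IH (ltnW jn).
have trE g : tr g j.+1 w = tr g j w + c j w *: g j w by rewrite /tr transformS.
have mxE : mx f j w <= mx f j.+1 w by exact: maximal_mono.
have [ml|ml] := leP (mx f j w) l.
  have tg0 : tr (gated b f) j.+1 w = 0.
    by rewrite trE (IH1 ml) /gated bE// ltNge ml scale0r scaler0 addr0.
  split=> // _; rewrite tg0 subr0 trE (le_trans (ler_normD _ _))// lerD//.
    by apply: le_trans ml; exact: maximal_ge.
  by apply: le_trans Je; exact: jumps_ge.
split; first by move=> /(le_trans mxE); rewrite leNgt ml.
move=> _; rewrite !trE /gated bE// ml scale1r opprD addrACA subrr addr0.
exact: IH2.
Qed.

Local Open Scope ereal_scope.

Let Kp : R := (K * poisson_const s)%R.

Lemma Kp_ge0 : (0 <= Kp)%R.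
Proof. by rewrite ltW// mulr_gt0// poisson_const_gt0. Qed.

Lemma sum_integral_energy f h n : (forall x, 0 <= x -> 0 <= h x)%R -> measurable_fun setT h ->
  adapted S N D (@sigma_measurable_fun _ _ _ _) f ->
  \sum_(m < n) (mm m)%:E * \int[P]_w (h `|f m w|)%:E = \int[P]_w (energy h f n w)%:E.
Proof.
move=> h0 mh Hf; rewrite /energy.
have mhf m : measurable_fun setT (fun w => (h `|f m w|)%:E).
  apply/measurable_EFinP; apply: measurableT_comp => //.
  exact: (history_measurable_fun HN (norm_adapted_measurable (m := m) Hf)).
under [RHS]eq_integral do rewrite -sumEFin.
rewrite ge0_integral_sum//; last 2 first.
- by move=> m; under eq_fun do rewrite EFinM; exact: measurable_funeM.
- by move=> m w _; rewrite lee_fin mulr_ge0 ?h0// mass_ge0.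
apply: eq_bigr => m _; rewrite -ge0_integralZl//.
- by move=> w _; rewrite lee_fin h0.
- by rewrite lee_fin mass_ge0.
Qed.

(* The transform gated on {l < max} and stopped when the energy reaches
   (del l)^s is bounded by the weak-type inequality. *)
Lemma good_lambda f n (l del : R) : adapted S N D (@bounded_sigma_measurable _ _ _) f ->
  (0 < l)%R -> (0 < del)%R -> (del <= 2^-1)%R ->
  P [set w | 2 * l < mx f n w]%R <=
    (Kp * (2 * del) `^ s)%:E * P [set w | l < mx f n w]%R +
    P [set w | (del * l) `^ s < energy (@powR R ^~ s) f n w]%R +
    P [set w | del * l < jumps f n w]%R.
Proof.
move=> Hf l0 del0 del2; have Hf' := adapted_bounded Hf.
have s0 : (0 < s)%R by apply: lt_le_trans s1.
pose a := ((del * l) `^ s)%R.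
pose V := energy (@powR R ^~ s) f.
pose b m w := ((l < mx f m w) && (V m.+1 w <= a))%R.
have pw0 (x : R) : (0 <= x)%R -> (0 <= x `^ s)%R by move=> _; exact: powR_ge0.
have mpw : measurable_fun setT (@powR R ^~ s) by exact: measurable_powR.
have mb m : sigma_measurable_fun (G m) (b m).
  apply: measurable_and.
    apply: measurable_fun_ltr; first exact: measurable_cst.
    exact: (maximal_sigma_measurable mu mD DS tD Hf').
  apply: measurable_fun_ler; last exact: measurable_cst.
  exact: energyS_measurable.
have Hg := gated_adapted mb Hf; have Hg' := adapted_bounded Hg.
have mmx g : adapted S N D (@bounded_sigma_measurable _ _ _) g -> measurable_fun setT (mx g n).
  by move=> /adapted_bounded; exact: (maximal_measurable HN mD DS tD).
have mA1 : measurable [set w | (1 - del) * l < mx (gated b f) n w]%R.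
  by apply: measurable_gt; exact: mmx.
have mA2 : measurable [set w | a < V n w]%R by apply: measurable_gt; exact: energy_measurable.
have mA3 : measurable [set w | del * l < jumps f n w]%R.
  by apply: measurable_gt; exact: jumps_measurable.
have mB : measurable [set w | l < mx f n w]%R by apply: measurable_gt; exact: mmx.
apply: (@le_trans _ _ (P [set w | (1 - del) * l < mx (gated b f) n w]%R +
    P [set w | a < V n w]%R + P [set w | del * l < jumps f n w]%R)).
  apply: (@le_trans _ _ (P ([set w | (1 - del) * l < mx (gated b f) n w]%R `|`
     [set w | a < V n w]%R `|` [set w | del * l < jumps f n w]%R))); last first.
    apply: (le_trans (measureU2 P (measurableU _ _ mA1 mA2) mA3)).
    by apply: leeD => //; exact: measureU2.
  apply: le_measure; rewrite ?inE.
  - by apply: measurable_gt; exact: mmx.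
  - by apply: measurableU => //; exact: measurableU.
  move=> w /= H.
  have [Va|Va] := leP (V n w) a; last by left; right.
  have [Ja|Ja] := leP (jumps f n w) (del * l)%R; last by right.
  left; left; move: H => /(maximal_gt mu N D f n w); case; first by rewrite mulr_ge0// ltW.
  move=> j jn Hj.
  have bE m : (m < n)%N -> b m w = (l < mx f m w)%R.
    move=> mn; rewrite /b (_ : (V m.+1 w <= a)%R = true) ?andbT//.
    by apply: le_trans Va; exact: energy_mono.
  (* Off the two exceptional events the gated transform differs from the original by at most
     [l + del * l]. From a value above [2 * l], more than [(1 - del) * l] remains. *)
  have [_ H2] := start_gate (ltW l0) bE Ja jn.
  have lj : (l < mx f j w)%R.
    apply: (@lt_le_trans _ _ `|tr f j w|%R); last exact: maximal_ge.
    by apply: lt_trans Hj; lra.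
  apply/maximal_gt; first by rewrite mulr_ge0 ?ltW// subr_gt0; lra.
  exists j => //; have := H2 lj.
  have : (`|tr f j w| <= `|tr f j w - tr (gated b f) j w| + `|tr (gated b f) j w|)%R.
    by rewrite -[X in (`|X| <= _)%R](subrK (tr (gated b f) j w)) ler_normD.
  rewrite -/tr in Hj *; rewrite -/(tr f j w) in Hj; rewrite -/(tr (gated b f) j w).
  by lra.
rewrite -!addeA; apply: leeD => //.
have l1 : (0 < (1 - del) * l)%R by rewrite mulr_gt0// subr_gt0; lra.
have W := maximal_weak HN mD DS tD D1 s1 K0 mart n Hg l1.
have l1s : (0 < ((1 - del) * l) `^ s)%R by rewrite powR_gt0.
rewrite -(@lee_pmul2l _ (((1 - del) * l) `^ s)%:E)//.
apply: (le_trans W); rewrite (sum_integral_energy n pw0 mpw Hg').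
rewrite -/Kp [in leRHS]EFinM -[in leRHS]muleA [leRHS]muleCA; apply: lee_wpmul2l; first by rewrite lee_fin Kp_ge0.
(* Since [del <= 1/2], one has [del * l <= 2 * del * ((1 - del) * l)]: this is where the factor with
   [2 * del] comes from. *)
apply: (@le_trans _ _ (a%:E * P [set w | l < mx f n w]%R)); last first.
  rewrite muleA -EFinM; apply: lee_wpmul2r => //; rewrite lee_fin -powRM; [|by rewrite ltW..|by lra].
  apply: powR_le; [exact: ltW|by rewrite mulr_ge0 ?ltW|].
  have h2 : (0 <= 1 - 2 * del)%R by lra.
  by have := mulr_ge0 (mulr_ge0 (ltW del0) (ltW l0)) h2; nra.
rewrite -(setIT [set w | _]%R) -integral_indic// -ge0_integralZl//; last 2 first.
- exact/measurable_EFinP/measurable_indic.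
- by rewrite lee_fin powR_ge0.
apply: ge0_le_integral => //.
- by move=> w _; rewrite lee_fin energy_ge0.
- by apply/measurable_EFinP; exact: energy_measurable.
- by apply: emeasurable_funM => //; exact/measurable_EFinP/measurable_indic.
(* The gated energy vanishes unless the maximum exceeds [l], and [sum_stopped] keeps it below [a] in
   that case. *)
move=> w _; rewrite -EFinM lee_fin indicE.
have E1 : energy (@powR R ^~ s) (gated b f) n w =
    (\sum_(m < n) (b m w)%:R * (mm m * `|f m w| `^ s))%R.
  by apply: eq_bigr => m _; rewrite powR_norm_gated// mulrCA.
have -> : (w \in [set w0 | l < mx f n w0]%R) = (l < mx f n w)%R.
  by apply/idP/idP => [/set_mem|/mem_set].
rewrite E1; have [H|H] := ltP l (mx f n w).
  rewrite mulr1; apply: (@le_trans _ _ (\sum_(m < n) (\sum_(j < m.+1) mm j * `|f j w| `^ s <= a)%R%:R * (mm m * `|f m w| `^ s))%R).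
    apply: ler_sum => m _; rewrite ler_wpM2r ?mulr_ge0 ?powR_ge0 ?mm_ge0// ler_nat.
    by rewrite /b /V /energy; case: (_ < _)%R.
  have := @sum_stopped _ (fun m => mm m * `|f m w| `^ s)%R a n _ _.
  rewrite le_min => /(_ _ _)/andP[]//; last exact: powR_ge0.
  by move=> m; rewrite mulr_ge0 ?powR_ge0 ?mm_ge0.
rewrite mulr0 big1// => m _; rewrite /b (_ : (l < mx f m w)%R = false) ?mul0r//.
apply/negbTE; rewrite -leNgt; apply: le_trans H.
by apply: maximal_mono; exact: ltnW.
Qed.

Lemma markov_gt (Y : T -> R) (l : R) : measurable_fun setT Y ->
  (forall w, 0 <= Y w)%R -> (0 <= l)%R ->
  l%:E * P [set w | l < Y w]%R <= \int[P]_w (Y w)%:E.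
Proof.
move=> mY Y0 l0.
have mA := measurable_gt l mY.
rewrite -(setIT [set w | _]%R) -integral_indic// -ge0_integralZl//; last first.
  exact/measurable_EFinP/measurable_indic.
apply: ge0_le_integral => //.
- by move=> w _; rewrite -EFinM lee_fin mulr_ge0.
- by apply: emeasurable_funM => //; exact/measurable_EFinP/measurable_indic.
- exact/measurable_EFinP.
move=> w _; rewrite -EFinM lee_fin indicE.
have -> : (w \in [set w0 | l < Y w0]%R) = (l < Y w)%R.
  by apply/idP/idP => [/set_mem|/mem_set].
by case: ltP => [/ltW|_]; rewrite ?mulr1// mulr0.
Qed.

Lemma measurable_psi (l : R) : measurable_fun setT (fun x : R => psi s (x / l)).
Proof.
rewrite /psi; apply: measurable_minr; first exact: measurable_funM.
apply: (measurableT_comp (measurable_powR _)); exact: measurable_funM.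
Qed.

(** Serves both halves of [tail_psi]: at scale [l], [psi] is the power [q = s] on small values and
    the power [q = 1] on large ones. *)
Lemma gated_le_psi f n w (l q : R) (b : nat -> T -> bool) : (0 < q)%R -> (0 < l)%R ->
  (forall m, b m w -> (energy (fun x : R => psi s (x / l)) f m.+1 w <= 1)%R /\
     ((`|f m w| / l) `^ q = psi s (`|f m w| / l))%R) ->
  (energy (@powR R ^~ q) (gated b f) n w <=
   l `^ q * Num.min 1 (energy (fun x : R => psi s (x / l)) f n w))%R.
Proof.
move=> q0 l0 Hb.
have ps0 m : (0 <= mm m * psi s (`|f m w| / l))%R.
  by rewrite mulr_ge0 ?mm_ge0// psi_ge0// divr_ge0// ltW.
rewrite /energy; apply: (@le_trans _ _ (l `^ q * \sum_(m < n)
  (\sum_(j < m.+1) mm j * psi s (`|f j w| / l) <= 1)%R%:R * (mm m * psi s (`|f m w| / l)))%R); last first.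
  rewrite ler_wpM2l ?powR_ge0//.
  exact: (@sum_stopped R (fun m => mm m * psi s (`|f m w| / l))%R 1%R n ps0 ler01).
rewrite mulr_sumr; apply: ler_sum => m _; rewrite powR_norm_gated//.
case bm: (b m w); last by rewrite mul0r mulr0 mulr_ge0 ?powR_ge0// mulr_ge0.
have [-> <-] := Hb _ bm.
rewrite !mul1r mulrCA -powRM ?divr_ge0 ?(ltW l0)//.
by rewrite [(l * _)%R]mulrC divfK ?gt_eqF.
Qed.

(* After stopping when the energy exceeds 1, the part |f| <= l is bounded by the
   weak-type inequality and the part |f| > l by Markov's inequality. *)
Lemma tail_psi f n (l : R) : adapted S N D (@bounded_sigma_measurable _ _ _) f ->
  (0 < l)%R ->
  P [set w | 2 * l < mx f n w]%R <= (1 + Kp + poisson_const 1)%:E *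
    \int[P]_w (Num.min 1 (energy (fun x : R => psi s (x / l)) f n w))%:E.
Proof.
move=> Hf l0; have Hf' := adapted_bounded Hf.
have s0 : (0 < s)%R by apply: lt_le_trans s1.
have pc0 : (0 <= poisson_const 1 :> R)%R.
  exact/ltW/poisson_const_gt0.
pose h (x : R) : R := psi s (x / l).
have h0 x : (0 <= x -> 0 <= h x)%R by move=> x0; rewrite psi_ge0// divr_ge0// ltW.
pose V := energy h f.
have mh : measurable_fun setT h by exact: measurable_psi.
have mV n' : measurable_fun setT (V n') by exact: energy_measurable.
have V0 n' w : (0 <= V n' w)%R by exact: energy_ge0.
have mnorm m : sigma_measurable_fun (G m) (fun w => `|f m w|%R).
  exact: norm_adapted_measurable Hf'.
pose b0 m w := ((V m.+1 w <= 1) && (`|f m w| <= l))%R.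
pose b1 m w := ((V m.+1 w <= 1) && (l < `|f m w|))%R.
have mb0 m : sigma_measurable_fun (G m) (b0 m).
  apply: measurable_and; apply: measurable_fun_ler; [|exact: measurable_cst|exact: mnorm|exact: measurable_cst].
  exact: energyS_measurable.
have mb1 m : sigma_measurable_fun (G m) (b1 m).
  apply: measurable_and; last by apply: measurable_fun_ltr; [exact: measurable_cst|exact: mnorm].
  apply: measurable_fun_ler; last exact: measurable_cst.
  exact: energyS_measurable.
have Hg0 := gated_adapted mb0 Hf; have Hg0' := adapted_bounded Hg0.
have Hg1 := gated_adapted mb1 Hf; have Hg1' := adapted_bounded Hg1.
pose W w := (\sum_(m < n) `|c m w *: gated b1 f m w|)%R.
have mW : measurable_fun setT W.
  by apply: measurable_sum => m; exact: jump_measurable.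
have W0 w : (0 <= W w)%R by apply: sumr_ge0.
have mA0 : measurable [set w | l < mx (gated b0 f) n w]%R.
  by apply: measurable_gt; apply: (maximal_measurable HN mD DS tD); exact: Hg0'.
have mA1 : measurable [set w | l < W w]%R by apply: measurable_gt.
have mA2 : measurable [set w | 1 < V n w]%R by apply: measurable_gt.
pose I := \int[P]_w (Num.min 1 (V n w))%:E.
have mI : measurable_fun setT (fun w => (Num.min 1 (V n w))%:E : \bar R).
  by apply/measurable_EFinP; apply: measurable_minr.
have I0 w : 0 <= (Num.min 1 (V n w))%:E :> \bar R by rewrite lee_fin le_min V0 ler01.
apply: (@le_trans _ _ (P [set w | 1 < V n w]%R + P [set w | l < mx (gated b0 f) n w]%R +
    P [set w | l < W w]%R)).
  apply: (@le_trans _ _ (P ([set w | 1 < V n w]%R `|` [set w | l < mx (gated b0 f) n w]%R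
     `|` [set w | l < W w]%R))); last first.
    apply: (le_trans (measureU2 P (measurableU _ _ mA2 mA0) mA1)).
    by apply: leeD => //; exact: measureU2.
  apply: le_measure; rewrite ?inE.
  - by apply: measurable_gt; apply: (maximal_measurable HN mD DS tD); exact: Hf'.
  - by apply: measurableU => //; exact: measurableU.
  move=> w /= H.
  have [Va|Va] := leP (V n w) 1%R; last by left; left.
  move: H => /(maximal_gt mu N D f n w); case; first by rewrite mulr_ge0// ltW.
  move=> j jn Hj.
  (* While the total energy is at most 1, exactly one of the two gates is open at each index. A
     transform above [2 * l] then forces one of its two parts above [l]; the part of large values is
     bounded by the sum of its norms. *)
  have trE i : (i <= n)%N -> (tr f i w = tr (gated b0 f) i w + tr (gated b1 f) i w)%R.
    elim: i => [|i IH] iN; first by rewrite /tr !transform0 addr0.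
    rewrite /tr !transformS -/(tr f i w) (IH (ltnW iN)) addrACA -scalerDr.
    congr (_ + _ *: _)%R; rewrite /gated /b0 /b1.
    rewrite (_ : (V i.+1 w <= 1)%R = true)/=; last by apply: le_trans Va; exact: energy_mono.
    by case: leP; rewrite scale1r scale0r ?addr0 ?add0r.
  have [H0|H0] := ltP l `|tr (gated b0 f) j w|%R.
    by left; right; apply/maximal_gt; [exact: ltW|exists j].
  right; apply: (@lt_le_trans _ _ `|tr (gated b1 f) j w|%R).
    have := ler_normD (tr (gated b0 f) j w) (tr (gated b1 f) j w).
    by rewrite -trE// => H1; move: (lt_le_trans Hj H1) H0; lra.
  rewrite /tr /transform /W (le_trans (ler_norm_sum _ _ _))//.
  rewrite (big_ord_widen n (fun m => `|c m w *: gated b1 f m w|%R))// big_mkcond/=.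
  by apply: ler_sum => m _; case: ifP.
have B2 : P [set w | 1 < V n w]%R <= I.
  rewrite -(setIT [set w | _]%R) -integral_indic//; apply: ge0_le_integral => //.
    exact/measurable_EFinP/measurable_indic.
  move=> w _; rewrite lee_fin indicE.
  have -> : (w \in [set w0 | 1 < V n w0]%R) = (1 < V n w)%R.
    by apply/idP/idP => [/set_mem|/mem_set].
  by case: ltP => _ /=; rewrite ?lexx ?V0.
have B0 : P [set w | l < mx (gated b0 f) n w]%R <= Kp%:E * I.
  rewrite -(@lee_pmul2l _ (l `^ s)%:E) ?lte_fin ?powR_gt0//.
  apply: (le_trans (maximal_weak HN mD DS tD D1 s1 K0 mart n Hg0 l0)).
  rewrite (sum_integral_energy (h := @powR R ^~ s))//; last by move=> x _; exact: powR_ge0.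
  rewrite -/Kp muleCA; apply: lee_wpmul2l; first by rewrite lee_fin Kp_ge0.
  rewrite -ge0_integralZl//; last by rewrite lee_fin powR_ge0.
  apply: ge0_le_integral => //.
  - by move=> w _; rewrite lee_fin energy_ge0// => x _; exact: powR_ge0.
  - by apply/measurable_EFinP; apply: energy_measurable.
  - exact: measurable_funeM.
  move=> w _; rewrite -EFinM lee_fin; apply: gated_le_psi => // m /andP[-> fl]; split=> //.
  by rewrite psi_small// ?divr_ge0 ?ler_pdivrMr ?mul1r// ltW.
have B1 : P [set w | l < W w]%R <= (poisson_const 1)%:E * I.
  rewrite -(@lee_pmul2l _ l%:E) ?lte_fin//.
  apply: (le_trans (markov_gt mW W0 (ltW l0))).
  rewrite /W; under eq_integral do rewrite -sumEFin.
  rewrite ge0_integral_sum//; last first.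
    by move=> m; apply/measurable_EFinP; exact: jump_measurable.
  apply: (@le_trans _ _ ((poisson_const 1)%:E * \sum_(m < n) (mm m)%:E * \int[P]_w (`|gated b1 f m w| `^ 1)%:E)).
    rewrite ge0_sume_distrr => [|m _]; last first.
      rewrite mule_ge0 ?lee_fin ?mm_ge0//; apply: integral_ge0 => w _.
      by rewrite lee_fin powR_ge0.
    apply: lee_sum => m _; rewrite muleA -EFinM.
    apply: le_trans (integral_norm_incr HN mD DS D1 m (lexx 1%R) Hg1').
    by rewrite le_eqVlt; apply/orP; left; apply/eqP; apply: eq_integral => w _; rewrite powRr1.
  rewrite (sum_integral_energy (h := @powR R ^~ 1%R))//; last by move=> x _; exact: powR_ge0.
  rewrite muleCA; apply: lee_wpmul2l; first by rewrite lee_fin.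
  rewrite -ge0_integralZl//; last by rewrite lee_fin ltW.
  apply: ge0_le_integral => //.
  - by move=> w _; rewrite lee_fin energy_ge0// => x _; exact: powR_ge0.
  - by apply/measurable_EFinP; apply: energy_measurable.
  - exact: measurable_funeM.
  move=> w _; rewrite -EFinM lee_fin -[X in (_ <= X * _)%R](powRr1 (ltW l0)).
  apply: gated_le_psi => // m /andP[-> fl]; split=> //.
  rewrite psi_large// ?powRr1// ?divr_ge0 ?ler_pdivlMr ?mul1r// ltW//.
have Kp0 := Kp_ge0.
rewrite EFinD ge0_muleDl ?lee_fin ?addr_ge0// EFinD ge0_muleDl ?lee_fin// mul1e.
by apply: leeD => //; exact: leeD.
Qed.

End discrete_tails.

(** * Summation of tail probabilities over dyadic levels *)

Section layer_cake.
Context {R : realType} {d : measure_display} {T : measurableType d}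
  (P : probability T R).
Local Open Scope ereal_scope.

Lemma nneseries_le (u : nat -> \bar R) (b : \bar R) : (forall k, 0 <= u k) ->
  (forall L, \sum_(k < L) u k <= b) -> \sum_(k <oo) u k <= b.
Proof.
move=> u0 ub; apply: lime_le; first exact: is_cvg_nneseries.
by apply: nearW => n; rewrite big_mkord.
Qed.

Lemma prob_integral_indic (A : set T) : measurable A -> P A = \int[P]_w (\1_A w)%:E.
Proof. by move=> mA; rewrite integral_indic// setIT. Qed.

Lemma layer_cake (p eps : R) (Y : T -> R) : (0 < p)%R -> (0 < eps)%R ->
  measurable_fun setT Y -> (forall w, 0 <= Y w)%R ->
  \int[P]_w (Y w `^ p)%:E <= (eps `^ p)%:E +
    (2 `^ p)%:E * \sum_(k <oo) (dyad eps k `^ p)%:E * P [set w | dyad eps k < Y w]%R.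
Proof.
move=> p0 e0 mY Y0.
have mA k : measurable [set w | dyad eps k < Y w]%R by exact: measurable_gt.
have mi k : measurable_fun setT (fun w => (\1_[set w | dyad eps k < Y w]%R w)%:E : \bar R).
  exact/measurable_EFinP/measurable_indic.
pose u k w := (dyad eps k `^ p)%:E * (\1_[set w | dyad eps k < Y w]%R w)%:E.
have u0 k w : 0 <= u k w by rewrite /u -EFinM lee_fin mulr_ge0// powR_ge0.
have mu_ k : measurable_fun setT (u k) by exact: measurable_funeM.
have -> : \sum_(k <oo) (dyad eps k `^ p)%:E * P [set w | dyad eps k < Y w]%R =
    \int[P]_w \sum_(k <oo) u k w.
  rewrite integral_nneseries//; apply: eq_eseriesr => k _.
  by rewrite ge0_integralZl// ?lee_fin ?powR_ge0// -prob_integral_indic.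
have ms : measurable_fun setT (fun w => \sum_(k <oo) u k w).
  exact: ge0_emeasurable_sum.
rewrite -ge0_integralZl// ?lee_fin ?powR_ge0//; last by move=> w _; exact: nneseries_ge0.
rewrite -[X in X + _]mule1 -(probability_setT P) -(integral_cst P measurableT).
rewrite -ge0_integralD//; last 3 first.
- by move=> w _; rewrite lee_fin powR_ge0.
- by move=> w _; rewrite mule_ge0 ?lee_fin ?powR_ge0//; exact: nneseries_ge0.
- exact: measurable_funeM.
apply: ge0_le_integral => //.
- by move=> w _; rewrite lee_fin powR_ge0.
- by apply/measurable_EFinP; apply: (measurableT_comp (measurable_powR _)).
- by apply: emeasurable_funD => //; exact: measurable_funeM.
move=> w _ /=; have [L HL] := dyad_unbounded (Y w) e0.
have := dyadic_layer L p0 e0 (Y0 w); rewrite min_l// => H.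
apply: (@le_trans _ _ (eps `^ p + 2 `^ p * \sum_(k < L) (dyad eps k < Y w)%R%:R * dyad eps k `^ p)%:E).
  by rewrite lee_fin.
rewrite EFinD; apply: leeD => //; rewrite EFinM; apply: lee_wpmul2l; first by rewrite lee_fin powR_ge0.
rewrite -sumEFin; apply: le_trans (nneseries_lim_ge L _) => //.
rewrite big_mkord; apply: lee_sum => k _; rewrite /u -EFinM lee_fin mulrC indicE.
have -> // : (w \in [set w0 | dyad eps k < Y w0]%R) = (dyad eps k < Y w)%R.
by apply/idP/idP => [/set_mem|/mem_set].
Qed.

(** Sum and integral are exchanged; at each point there remains a geometric sum over the levels
    below [Y w / del]. *)
Lemma sum_prob_le (p eps del : R) (Y : T -> R) L : (0 < p)%R -> (0 < eps)%R -> (0 < del)%R ->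
  measurable_fun setT Y -> (forall w, 0 <= Y w)%R ->
  \sum_(k < L) (dyad eps k `^ p)%:E * P [set w | del * dyad eps k < Y w]%R <=
  (geo p * (del^-1) `^ p)%:E * \int[P]_w (Y w `^ p)%:E.
Proof.
move=> p0 e0 d0 mY Y0.
have mA k : measurable [set w | del * dyad eps k < Y w]%R by exact: measurable_gt.
have mi k : measurable_fun setT (fun w => (\1_[set w | del * dyad eps k < Y w]%R w)%:E : \bar R).
  exact/measurable_EFinP/measurable_indic.
have mYp : measurable_fun setT (fun w => (Y w `^ p)%:E).
  by apply/measurable_EFinP; apply: (measurableT_comp (measurable_powR _)).
have g0 : (0 <= geo p * (del^-1) `^ p)%R by rewrite mulr_ge0 ?powR_ge0// ltW// geo_gt0.
rewrite -ge0_integralZl//; last by move=> w _; rewrite lee_fin powR_ge0.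
under eq_bigr => k _.
  rewrite prob_integral_indic// -ge0_integralZl// ?lee_fin ?powR_ge0//; over.
rewrite -ge0_integral_sum//; last 2 first.
- by move=> k; exact: measurable_funeM.
- by move=> k w _; rewrite -EFinM lee_fin mulr_ge0// powR_ge0.
apply: ge0_le_integral => //.
- by move=> w _; apply: sume_ge0 => k _; rewrite -EFinM lee_fin mulr_ge0// powR_ge0.
- by apply: emeasurable_sum => k; exact: measurable_funeM.
- exact: measurable_funeM.
move=> w _; under eq_bigr do rewrite -EFinM.
rewrite sumEFin -EFinM lee_fin -mulrA -powRM ?invr_ge0 ?(ltW d0)//.
have t0 : (0 <= del^-1 * Y w)%R by rewrite mulr_ge0// invr_ge0 ltW.
apply: le_trans (dyadic_sum_le L p0 e0 t0).
apply: ler_sum => k _; rewrite mulrC ler_wpM2r ?powR_ge0// indicE.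
have -> : (w \in [set w0 | del * dyad eps k < Y w0]%R) = (del * dyad eps k < Y w)%R.
  by apply/idP/idP => [/set_mem|/mem_set].
rewrite ler_nat; case: ltP => // H.
by rewrite mulrC ler_pdivlMr// mulrC ltW.
Qed.

Lemma half_absorb (A b : \bar R) : A \is a fin_num -> 0 <= b ->
  A <= (2^-1)%:E * A + b -> A <= 2%:E * b.
Proof.
case: A => // a _; case: b => [b| |]// b0; last by rewrite gt0_muley ?lte_fin// leey.
by rewrite -!EFinM -EFinD !lee_fin; lra.
Qed.

End layer_cake.

Section discrete_moments.
Context {R : realType} {d : measure_display} {T : measurableType d}
  (P : probability T R) {dE : measure_display} {E : measurableType dE}
  (S : set E) (mu : {measure set E -> \bar R}) (N : T -> {measure set E -> \bar R})
  (HN : poisson_random_measure P S mu N)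
  (D : nat -> set E) (mD : forall m, measurable (D m)) (DS : forall m, D m `<=` S)
  (tD : trivIset setT D) (D1 : forall m, (mu (D m) <= 1)%E).
Context {X : normedModType R} (s K : R) (s1 : (1 <= s)%R) (K0 : (0 < K)%R)
  (mart : @martingale_bound R X s K).
Implicit Types (f g : nat -> T -> X).
Local Open Scope ereal_scope.

Let mx := @maximal _ _ _ _ _ mu N D X.
Let mm m := mass mu D m.

Lemma discrete_moment_small f n (p eps : R) :
  adapted S N D (@bounded_sigma_measurable _ _ _) f -> (0 < p)%R -> (0 < eps)%R ->
  \int[P]_w (mx f n w `^ p)%:E <= ((2 * eps) `^ p)%:E +
    (4 `^ p * (1 + K * poisson_const s + poisson_const 1))%:E *
    \sum_(k <oo) (dyad eps k `^ p)%:E *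
      \int[P]_w (Num.min 1 (energy mu D (fun x => psi s (x / dyad eps k)) f n w))%:E.
Proof.
move=> Hf p0 e0; have Hf' := adapted_bounded Hf.
have e20 : (0 < 2 * eps)%R by rewrite mulr_gt0.
have mmx : measurable_fun setT (mx f n) by apply: (maximal_measurable HN mD DS tD); exact: Hf'.
have mx0 w : (0 <= mx f n w)%R by exact: maximal_ge0.
(* The levels start at [2 * eps], so that each of them is twice [dyad eps k], the form [tail_psi]
   requires. This doubling turns the 2^p of the layer cake into 4^p. *)
apply: (le_trans (layer_cake P p0 e20 mmx mx0)); apply: leeD => //.
have pc0 (q : R) : (0 <= poisson_const q)%R.
  exact/ltW/poisson_const_gt0.
have c0 : (0 <= 1 + K * poisson_const s + poisson_const 1)%R.
  by rewrite !addr_ge0// mulr_ge0// ltW.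
have E42 : (4 `^ p = 2 `^ p * 2 `^ p :> R)%R.
  by rewrite -powRM//; congr (_ `^ _)%R; rewrite -natrM.
have I0 k : 0 <= \int[P]_w (Num.min 1 (energy mu D (fun x => psi s (x / dyad eps k)) f n w))%:E.
  apply: integral_ge0 => w _; rewrite lee_fin le_min ler01/=; apply: energy_ge0 => // x x0.
  by rewrite psi_ge0// divr_ge0// ltW// dyad_gt0.
rewrite E42 -mulrA EFinM -muleA; apply: lee_wpmul2l; first by rewrite lee_fin powR_ge0.
rewrite -nneseriesZl => [|k _]; last by rewrite mule_ge0// lee_fin powR_ge0.
apply: lee_nneseries => [k _ _|k _]; first by rewrite mule_ge0// lee_fin powR_ge0.
have dyE : dyad (2 * eps) k = (2 * dyad eps k)%R by rewrite /dyad mulrA.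
have d0 := dyad_gt0 k e0.
rewrite dyE powRM ?(ltW d0)// EFinM -muleA [in leRHS]EFinM -!muleA.
apply: lee_wpmul2l; first by rewrite lee_fin powR_ge0.
rewrite [leRHS]muleCA; apply: lee_wpmul2l; first by rewrite lee_fin powR_ge0.
exact: (tail_psi HN mD DS tD D1 s1 K0 mart n Hf d0).
Qed.

(** [good_lambda] requires a value of at most 1/2. The second entry makes 2^p times its coefficient
    at most 1/2, where 2^p is the price of passing to the next dyadic level. *)
Definition good_lambda_del (p : R) : R :=
  Num.min (2^-1)%R (2^-1 * (2 * 2 `^ p * (K * poisson_const s))^-1 `^ s^-1)%R.

Lemma good_lambda_del_gt0 (p : R) : (0 < good_lambda_del p)%R.
Proof.
rewrite /good_lambda_del lt_min invr_gt0 ltr0n/= mulr_gt0 ?invr_gt0// powR_gt0//.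
by rewrite invr_gt0 !mulr_gt0 ?powR_gt0// poisson_const_gt0.
Qed.

(** From the outside in: 2^p from the layer cake, 2 from the absorption, 2^p from the shift by one
    level, the geometric sum of the tails at scale del. The last factor accounts for the jumps. *)
Definition moment_const (p : R) : R :=
  (2 `^ p * (2 * (2 `^ p * (geo p * ((good_lambda_del p)^-1 `^ p))))
   * (1 + poisson_const p))%R.

Lemma jumps_moment f n (p : R) : (1 <= p)%R ->
  adapted S N D (@sigma_measurable_fun _ _ _ _) f ->
  \int[P]_w (jumps mu N D f n w `^ p)%:E <=
  (poisson_const p)%:E * \int[P]_w (energy mu D (@powR R ^~ p) f n w)%:E.
Proof.
move=> p1 Hf; have p0 : (0 < p)%R by apply: lt_le_trans p1.
have mj m : measurable_fun setT (fun w => (`|incr mu N D m w *: f m w|%R `^ p)%:E).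
  apply/measurable_EFinP; apply: (measurableT_comp (measurable_powR _)).
  exact: (jump_measurable HN mD DS tD).
apply: (@le_trans _ _ (\sum_(m < n) \int[P]_w (`|incr mu N D m w *: f m w|%R `^ p)%:E)).
  rewrite -ge0_integral_sum//.
  apply: ge0_le_integral => //.
  - by move=> w _; rewrite lee_fin powR_ge0.
  - apply/measurable_EFinP; apply: (measurableT_comp (measurable_powR _)).
    by apply: (jumps_measurable HN mD DS tD); exact: Hf.
  - exact: emeasurable_sum.
  move=> w _; rewrite sumEFin lee_fin; elim: n => [|n IH] /=.
    by rewrite big_ord0 powR0// gt_eqF.
  rewrite big_ord_recr/=; have [H|H] := leP (jumps mu N D f n w) `|incr mu N D n w *: f n w|%R.
    by rewrite lerDr sumr_ge0// => i _; exact: powR_ge0.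
  by rewrite (le_trans IH)// lerDl powR_ge0.
rewrite -(sum_integral_energy HN n (h := @powR R ^~ p))//; last by move=> x _; exact: powR_ge0.
rewrite ge0_sume_distrr => [|m _]; last first.
  rewrite mule_ge0 ?lee_fin ?mass_ge0//; apply: integral_ge0 => w _.
  by rewrite lee_fin powR_ge0.
apply: lee_sum => m _; rewrite muleA -EFinM.
exact: (integral_norm_incr HN mD DS D1 m p1 Hf).
Qed.

Lemma discrete_moment_large f n (p : R) :
  adapted S N D (@bounded_sigma_measurable _ _ _) f -> (s <= p)%R ->
  \int[P]_w (mx f n w `^ p)%:E <= (moment_const p)%:E *
    (\int[P]_w (energy mu D (@powR R ^~ s) f n w `^ (p / s))%:E +
     \int[P]_w (energy mu D (@powR R ^~ p) f n w)%:E).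
Proof.
move=> Hf sp; have Hf' := adapted_bounded Hf.
have s0 : (0 < s)%R by apply: lt_le_trans s1.
have p1 : (1 <= p)%R by apply: le_trans sp.
have p0 : (0 < p)%R by apply: lt_le_trans p1.
pose Kp : R := (K * poisson_const s)%R.
have Kp0 : (0 < Kp)%R by rewrite mulr_gt0// poisson_const_gt0.
pose del := good_lambda_del p.
have del0 : (0 < del)%R by exact: good_lambda_del_gt0.
have del2 : (del <= 2^-1)%R by rewrite /del /good_lambda_del ge_min lexx.
have kap : (2 `^ p * (Kp * (2 * del) `^ s) <= 2^-1)%R.
  have : ((2 * del) `^ s <= (2 * 2 `^ p * Kp)^-1)%R.
    have Q0 : (0 <= (2 * 2 `^ p * Kp)^-1)%R by rewrite invr_ge0 ltW// mulr_gt0// mulr_gt0// powR_gt0.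
    have -> : ((2 * 2 `^ p * Kp)^-1 = ((2 * 2 `^ p * Kp)^-1 `^ s^-1) `^ s)%R.
      by rewrite -powRrM mulVf ?gt_eqF// powRr1.
    apply: powR_le; [exact: ltW|by rewrite mulr_ge0// ltW|].
    by rewrite -ler_pdivlMl// /del /good_lambda_del ge_min lexx orbT.
  move=> H; apply: (@le_trans _ _ (2 `^ p * (Kp * (2 * 2 `^ p * Kp)^-1))%R).
    by rewrite ler_wpM2l ?powR_ge0// ler_wpM2l// ltW.
  by rewrite le_eqVlt; apply/orP; left; apply/eqP; field; rewrite !gt_eqF ?powR_gt0.
pose V := energy mu D (@powR R ^~ s) f n.
have mV : measurable_fun setT V by exact: (energy_measurable HN).
have V0 w : (0 <= V w)%R by apply: energy_ge0 => // x _; exact: powR_ge0.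
pose Y1 w := (V w `^ s^-1)%R.
have mY1 : measurable_fun setT Y1 by apply: (measurableT_comp (measurable_powR _)).
have Y10 w : (0 <= Y1 w)%R by exact: powR_ge0.
pose J := jumps mu N D f n.
have mJ : measurable_fun setT J by apply: (jumps_measurable HN mD DS tD); exact: Hf'.
have J0 w : (0 <= J w)%R by exact: jumps_ge0.
have mmx : measurable_fun setT (mx f n) by apply: (maximal_measurable HN mD DS tD); exact: Hf'.
have mx0 w : (0 <= mx f n w)%R by exact: maximal_ge0.
pose B : \bar R := (geo p * (del^-1 `^ p))%:E * (\int[P]_w (Y1 w `^ p)%:E + \int[P]_w (J w `^ p)%:E).
have B0 : 0 <= B.
  have g0 := ltW (geo_gt0 p0).
  apply: mule_ge0; first by rewrite lee_fin; apply: mulr_ge0 => //; exact: powR_ge0.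
  by apply: adde_ge0; apply: integral_ge0 => w _; rewrite lee_fin powR_ge0.
have key (eps : R) : (0 < eps)%R -> \int[P]_w (mx f n w `^ p)%:E <=
    (eps `^ p)%:E + (2 `^ p)%:E * (2%:E * ((eps `^ p)%:E + (2 `^ p)%:E * B)).
  move=> e0; apply: (le_trans (layer_cake P p0 e0 mmx mx0)); apply: leeD => //.
  apply: lee_wpmul2l; first by rewrite lee_fin powR_ge0.
  pose a k := (dyad eps k `^ p)%:E * P [set w | dyad eps k < mx f n w]%R.
  have a0 k : 0 <= a k by rewrite mule_ge0// lee_fin powR_ge0.
  apply: nneseries_le => // L.
  (* Finitely many levels with probabilities at most 1: finiteness comes for free, and half of the
     sum may be subtracted. *)
  have afin : \sum_(k < L) a k \is a fin_num.
    by apply/sum_fin_numP => k _; rewrite fin_numM// fin_num_measure//; exact: measurable_gt.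
  have b0 : 0 <= (eps `^ p)%:E + (2 `^ p)%:E * B.
    by apply: adde_ge0; [|apply: mule_ge0 => //]; rewrite lee_fin powR_ge0.
  apply: half_absorb => //.
  case: L afin => [|L] _.
    by rewrite big_ord0 mule0 add0e.
  pose v k := (dyad eps k `^ p)%:E * P [set w | del * dyad eps k < Y1 w]%R.
  pose j k := (dyad eps k `^ p)%:E * P [set w | del * dyad eps k < J w]%R.
  have v0 k : 0 <= v k by rewrite mule_ge0// lee_fin powR_ge0.
  have j0 k : 0 <= j k by rewrite mule_ge0// lee_fin powR_ge0.
  (* Consecutive levels differ by the factor 2 of the good-lambda inequality, so it reads as a
     recursion with coefficient at most 1/2. *)
  have step k : a k.+1 <= (2^-1)%:E * a k + (2 `^ p)%:E * (v k + j k).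
    have d0 := dyad_gt0 k e0.
    have := good_lambda HN mD DS tD D1 s1 K0 mart n Hf d0 del0 del2.
    rewrite (_ : [set w | (del * dyad eps k) `^ s < energy mu D (@powR R ^~ s) f n w]%R =
      [set w | del * dyad eps k < Y1 w]%R); last first.
      have dd0 : (0 <= del * dyad eps k)%R by rewrite mulr_ge0 ?ltW.
      apply/seteqP; split => w /= H; rewrite ltNge; apply/negP => H'.
        have := powR_le (ltW s0) (Y10 w) H'.
        by rewrite /Y1 -powRrM mulVf ?gt_eqF// powRr1// leNgt H.
      have si0 : (0 <= s^-1)%R by rewrite invr_ge0 ltW.
      have := powR_le si0 (V0 w) H'.
      by rewrite -powRrM mulfV ?gt_eqF// powRr1// leNgt; move/negP; apply.
    move=> H; rewrite /a dyadS powRM ?(ltW d0)// EFinM.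
    apply: (@le_trans _ _ ((2 `^ p)%:E * (dyad eps k `^ p)%:E * ((Kp * (2 * del) `^ s)%:E *
      P [set w | dyad eps k < mx f n w]%R + P [set w | del * dyad eps k < Y1 w]%R +
      P [set w | del * dyad eps k < J w]%R))).
      by apply: lee_wpmul2l => //; rewrite -EFinM lee_fin mulr_ge0 ?powR_ge0.
    have k0 : (0 <= Kp * (2 * del) `^ s)%R by rewrite mulr_ge0 ?powR_ge0// ltW.
    rewrite -addeA -muleA ge0_muleDr ?adde_ge0 ?mule_ge0//.
    rewrite [X in _ * (_ + X)]ge0_muleDr// -/(v k) -/(j k).
    rewrite [leLHS]ge0_muleDr ?adde_ge0 ?mule_ge0 ?lee_fin ?powR_ge0//.
    apply: leeD => //.
    rewrite [X in _ * X]muleCA muleA -EFinM -/(a k).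
    by apply: lee_wpmul2r => //; rewrite lee_fin.
  have a00 : a 0%N <= (eps `^ p)%:E.
    rewrite /a {1}/dyad expr0 mulr1 -[leRHS]mule1; apply: lee_wpmul2l; first by rewrite lee_fin powR_ge0.
    exact: probability_le1 (measurable_gt _ mmx).
  have sumB : \sum_(k < L) (v k + j k) <= B.
    rewrite big_split/= /B ge0_muleDr ?integral_ge0// => [|w _|w _]; rewrite ?lee_fin ?powR_ge0//.
    by apply: leeD; apply: sum_prob_le.
  rewrite [leLHS]big_ord_recl/=.
  apply: (@le_trans _ _ ((eps `^ p)%:E + ((2^-1)%:E * \sum_(k < L) a k + (2 `^ p)%:E * B))).
    apply: leeD => //.
    apply: (@le_trans _ _ (\sum_(k < L) ((2^-1)%:E * a k + (2 `^ p)%:E * (v k + j k)))).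
      by apply: lee_sum => k _; exact: step.
    rewrite big_split/= -!ge0_sume_distrr//; last by move=> k _; rewrite adde_ge0.
    by apply: leeD => //; apply: lee_wpmul2l => //; rewrite lee_fin powR_ge0.
  rewrite addeCA; apply: leeD => //; apply: lee_wpmul2l => //.
  by rewrite [leRHS]big_ord_recr/=; apply: leeDl; exact: (a0 L).
apply/lee_addgt0Pr => e e0.
pose C : R := (1 + 2 `^ p * 2)%R.
(* [C] collects the two occurrences of eps^p in [key]; eps is then chosen so that they contribute
   exactly [e]. *)
have C0 : (0 < C)%R by rewrite /C ltr_pwDl// mulr_ge0// powR_ge0.
have ep0 : (0 < (e / C) `^ p^-1)%R by rewrite powR_gt0// divr_gt0.
apply: (le_trans (key _ ep0)).
have -> : (((e / C) `^ p^-1) `^ p = e / C)%R.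
  by rewrite -powRrM mulVf ?gt_eqF// powRr1// ltW// divr_gt0.
have e1 : 0 <= (e / C)%:E by rewrite lee_fin ltW// divr_gt0.
have t2 : 0 <= (2 `^ p)%:E :> \bar R by rewrite lee_fin powR_ge0.
have tB := mule_ge0 t2 B0.
have two0 : 0 <= 2%:E :> \bar R by [].
rewrite (ge0_muleDr _ e1 tB) (ge0_muleDr _ (mule_ge0 two0 e1) (mule_ge0 two0 tB)).
rewrite addeA addeC; apply: leeD; last first.
  rewrite -!EFinM -EFinD lee_fin le_eqVlt; apply/orP; left; apply/eqP.
  by rewrite /C; field; rewrite gt_eqF// ltr_pwDl// mulr_ge0// powR_ge0.
have EY : \int[P]_w (Y1 w `^ p)%:E = \int[P]_w (V w `^ (p / s))%:E.
  by apply: eq_integral => w _; rewrite /Y1 -powRrM mulrC.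
have Jp := jumps_moment n p1 Hf'.
rewrite /moment_const -/del /B EY.
set c1 := (geo p * _)%R; set A1 := \int[P]_w (V w `^ (p / s))%:E.
set A2 := \int[P]_w (energy mu D (@powR R ^~ p) f n w)%:E in Jp *.
set A3 := \int[P]_w (J w `^ p)%:E in Jp *.
have A10 : 0 <= A1 by apply: integral_ge0 => w _; rewrite lee_fin powR_ge0.
have A20 : 0 <= A2.
  by apply: integral_ge0 => w _; rewrite lee_fin energy_ge0// => x _; exact: powR_ge0.
have c10 : (0 <= c1)%R by rewrite mulr_ge0 ?powR_ge0// ltW// geo_gt0.
clearbody c1.
rewrite !EFinM -!muleA; do 4 (apply: lee_wpmul2l; first by rewrite lee_fin// powR_ge0).
have pc0 := poisson_const_gt0 p.
apply: (@le_trans _ _ (A1 + (poisson_const p)%:E * A2)); first by apply: leeD.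
rewrite (ge0_muleDr _ A10 A20); apply: leeD.
  by rewrite -[leLHS]mul1e; apply: lee_wpmul2r => //; rewrite lee_fin lerDl ltW.
by apply: lee_wpmul2r => //; rewrite lee_fin lerDr.
Qed.

End discrete_moments.

(** * Paths of the integral *)

Section lower_integral.
Context {R : realType} {d : measure_display} {T : measurableType d}
  (mu : {measure set T -> \bar R}).
Local Open Scope ereal_scope.

(* The integral of a nonnegative function is a supremum over simple functions,
   so monotonicity holds for the supremum over all times, whose measurability
   is not known. *)
Lemma le_integral_nonmeasurable (f g : T -> \bar R) : (forall x, 0 <= f x) ->
  (forall x, f x <= g x) -> \int[mu]_x f x <= \int[mu]_x g x.
Proof.
move=> f0 fg; have g0 x : 0 <= g x by exact: le_trans (fg x).
rewrite !ge0_integralTE//; apply: ereal_sup_le => _ [h Hh <-].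
by exists h => // x; apply: le_trans (Hh x) (fg x).
Qed.

(** Used on whichever side of an inequality is measurable. On the null set a measurable lower
    function becomes 0 and a measurable upper one [+oo]; the inequality then holds everywhere and
    the other side need not be measurable. *)
Lemma integral_change_null (h : T -> \bar R) (A : set T) (c : \bar R) :
  measurable_fun setT h -> (forall x, 0 <= h x) -> 0 <= c -> measurable A -> mu A = 0 ->
  \int[mu]_x h x = \int[mu]_x (if x \in A then c else h x).
Proof.
move=> mh h0 c0 mA A0; apply: ge0_ae_eq_integral => //.
- apply: measurable_fun_ifT => //; apply: (measurable_fun_bool true).
  rewrite setTI (_ : _ @^-1` _ = A)//.
  by apply/seteqP; split => w; [move=> /set_mem|move=> /mem_set].
- by move=> x _; case: ifP.
exists A; split => // x /= H; apply: contrapT => nA; apply: H => _.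
by rewrite memNset.
Qed.

Lemma le_ae_integral (f g : T -> \bar R) : measurable_fun setT f ->
  (forall x, 0 <= f x) -> (forall x, 0 <= g x) ->
  {ae mu, forall x, f x <= g x} -> \int[mu]_x f x <= \int[mu]_x g x.
Proof.
move=> mf f0 g0 [A [mA A0 fg]]; rewrite (integral_change_null mf f0 (lexx 0) mA A0).
apply: le_integral_nonmeasurable => x; first by case: ifP.
by case: ifPn => // /negP H; apply: contrapT => H'; apply/H/mem_set/fg.
Qed.

Lemma le_integral_ae (f g : T -> \bar R) : measurable_fun setT g ->
  (forall x, 0 <= f x) -> (forall x, 0 <= g x) ->
  {ae mu, forall x, f x <= g x} -> \int[mu]_x f x <= \int[mu]_x g x.
Proof.
move=> mg f0 g0 [A [mA A0 fg]]; rewrite (integral_change_null mg g0 (leey 0) mA A0).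
apply: le_integral_nonmeasurable => // x.
case: ifPn => [_|/negP H]; first exact: leey.
by apply: contrapT => H'; apply/H/mem_set/fg.
Qed.

End lower_integral.

Section paths.
Context {R : realType} {dJ : measure_display} {J : measurableType dJ}
  (nu : {sigma_finite_measure set J -> \bar R}).

Let mu : {measure set (measurableTypeR R * J) -> \bar R} := (lebesgue_measure \x nu)%E.

Definition slab (a b : R) (C : set J) : set (measurableTypeR R * J) := `]a, b] `*` C.

Lemma measurable_slab a b C : measurable C -> measurable (slab a b C).
Proof. by move=> mC; apply: measurableX. Qed.

Lemma slab_mono a b a' b' C : a' <= a -> b <= b' -> slab a b C `<=` slab a' b' C.
Proof.
move=> aa bb [x z] [/=]; rewrite in_itv/= => /andP[ax xb] Cz; split => //=.
by rewrite in_itv/= (le_lt_trans aa ax) (le_trans xb bb).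
Qed.

Lemma slab_half_line a b C : 0 <= a -> slab a b C `<=` half_line_times.
Proof.
move=> a0 [x z] [/=]; rewrite in_itv/= => /andP[ax _] _.
by rewrite /half_line_times/=; apply: le_trans (ltW ax).
Qed.

Lemma slab_split a b c C : a <= b -> b <= c -> slab a c C = slab a b C `|` slab b c C.
Proof.
move=> ab bc; apply/seteqP; split => -[x z] /=.
  rewrite /slab/= in_itv/= => -[/andP[ax xc] Cz]; have [xb|bx] := leP x b.
    by left; split => //=; rewrite in_itv/= ax.
  by right; split => //=; rewrite in_itv/= bx.
by move=> []; apply: slab_mono.
Qed.

Lemma slab_disj a b c C : slab a b C `&` slab b c C = set0.
Proof.
rewrite -subset0 => -[x z] [[/=]]; rewrite in_itv/= => /andP[_ xb] _ [/=].
by rewrite in_itv/= => /andP[bx _] _; move: (le_lt_trans xb bx); rewrite ltxx.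
Qed.

Local Open Scope ereal_scope.

Lemma mu_slab (a b : R) C : (a <= b)%R -> measurable C -> mu (slab a b C) = (b - a)%:E * nu C.
Proof.
move=> ab mC.
have -> : mu (slab a b C) = lebesgue_measure (`]a, b]%classic : set (measurableTypeR R)) * nu C.
  by apply: product_measure1E.
congr (_ * _); rewrite lebesgue_measure_itv/= lte_fin.
by move: ab; rewrite le_eqVlt => /predU1P[->|->//]; rewrite ltxx subrr.
Qed.

(** Continuity from above along slabs that open at [u] and shrink to the empty set. They are cut at
    [tL] because only the mass up to [tL] is known to be finite. *)
Lemma slab_vanish (M : {measure set (measurableTypeR R * J) -> \bar R}) (tL u : R) C :
  measurable C -> M (slab 0 tL C) < +oo -> (0 <= u)%R -> (u <= tL)%R ->
  forall e : R, (0 < e)%R -> exists2 del : R, (0 < del)%R &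
    forall v, (u <= v)%R -> (v <= u + del)%R -> (v <= tL)%R -> (M (slab u v C) < e%:E).
Proof.
move=> mC fin u0 ut e e0.
pose F k := slab u (Num.min (u + k.+1%:R^-1)%R tL) C.
have F0 : \bigcap_k F k = set0.
  rewrite -subset0 => -[x z] H.
  have ux : (u < x)%R.
    by have [/=] := H 0%N Logic.I; rewrite in_itv/= => /andP[].
  have : (0 < x - u)%R by rewrite subr_gt0.
  move=> xu; pose k := (Num.trunc (x - u)^-1).
  have kx : (k.+1%:R^-1 < x - u)%R by rewrite invf_plt ?posrE//; exact: truncnS_gt.
  have [/=] := H k Logic.I; rewrite in_itv/= le_min => /andP[_ /andP[xk _]] _.
  by move: kx; rewrite ltrBrDl ltNge xk.
have cv : M (F k) @[k --> \oo] --> 0%E.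
  rewrite -(measure0 M) -F0; apply: nonincreasing_cvg_mu.
  - apply: le_lt_trans fin; apply: le_measure; rewrite ?inE; [exact: measurable_slab..|].
    by apply: slab_mono => //; rewrite ge_min lexx orbT.
  - by move=> k; exact: measurable_slab.
  - by rewrite F0.
  - move=> a b ab; apply/subsetPset; apply: slab_mono => //.
    rewrite le_min !ge_min lexx orbT andbT; apply/orP; left.
    by rewrite lerD2l lef_pV2 ?posrE// ler_nat.
have /fine_cvgP[c1 /cvgrPdist_lt/(_ _ e0) c2] := cv.
near \oo => k.
have h1 : M (F k) \is a fin_num by near: k.
have h2 : (`|0 - fine (M (F k))| < e)%R by near: k; exact: c2.
exists (k.+1%:R^-1)%R => [|v uv vd vt]; first by rewrite invr_gt0.
apply: (@le_lt_trans _ _ (M (F k))).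
  apply: le_measure; rewrite ?inE; [exact: measurable_slab..|].
  by apply: slab_mono => //; rewrite le_min vd vt.
by move: h2; rewrite sub0r normrN ger0_norm ?fine_ge0// -lte_fin fineK.
Unshelve. all: by end_near. Qed.

End paths.

Section right_continuity.
Context {R : realType} {V : normedModType R}.

Definition right_cont (g : R -> V) (u : R) : Prop :=
  forall e : R, 0 < e -> exists2 del : R, 0 < del &
    forall v, u <= v -> v <= u + del -> `|g v - g u| <= e.

Lemma right_cont_cst (c : V) u : right_cont (fun=> c) u.
Proof. by move=> e e0; exists 1 => // v _ _; rewrite subrr normr0 ltW. Qed.

Lemma right_contD f g u : right_cont f u -> right_cont g u ->
  right_cont (fun v => f v + g v) u.
Proof.
move=> rf rg e e0; have e20 : 0 < e / 2 by rewrite divr_gt0.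
have [d1 d10 H1] := rf _ e20; have [d2 d20 H2] := rg _ e20.
exists (Num.min d1 d2) => [|v uv vd]; first by rewrite lt_min d10.
rewrite opprD addrACA (le_trans (ler_normD _ _))// [leRHS]splitr.
by apply: lerD; [apply: H1|apply: H2] => //; apply: (le_trans vd); rewrite lerD2l ge_min lexx ?orbT.
Qed.

Lemma right_cont_sum (I : Type) (s : seq I) (g : I -> R -> V) u :
  (forall i, right_cont (g i) u) -> right_cont (fun v => \sum_(i <- s) g i v) u.
Proof.
move=> rg; elim: s => [|i s IH].
  by under eq_fun do rewrite big_nil; exact: right_cont_cst.
by under eq_fun do rewrite big_cons; exact: right_contD.
Qed.

End right_continuity.

Lemma right_contZ {R : realType} {V : normedModType R} (g : R -> R) (x : V) u :
  right_cont (g : R -> R^o) u -> right_cont (fun v => g v *: x) u.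
Proof.
move=> rg e e0; have x0 : 0 < `|x| + 1 by rewrite ltr_wpDl.
have [d d0 H] := rg (e / (`|x| + 1)) (divr_gt0 e0 x0).
exists d => // v uv vd; rewrite -scalerBl normrZ.
apply: (@le_trans _ _ (e / (`|x| + 1) * (`|x| + 1))); last by rewrite divfK ?gt_eqF.
by apply: ler_pM => //; [exact: H|rewrite lerDl].
Qed.

Section deterministic_paths.
Context {R : realType} {X : normedModType R} {dJ : measure_display} {J : measurableType dJ}
  (nu : {sigma_finite_measure set J -> \bar R})
  (M : {measure set (measurableTypeR R * J) -> \bar R}).
Variables (t : nat -> R) (L m : nat) (C : 'I_m -> set J).
Hypotheses (t0 : t 0%N = 0) (t_lt : forall i, (i < L)%N -> t i < t i.+1)
  (mC : forall j, measurable (C j)) (nuC : forall j, (nu (C j) < +oo)%E)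
  (MC : forall j, (M (slab 0 (t L) (C j)) < +oo)%E).

Let mu : {measure set (measurableTypeR R * J) -> \bar R} := (lebesgue_measure \x nu)%E.

Definition centered (A : set (measurableTypeR R * J)) : R := fine (M A - mu A)%E.
Definition cumul (j : 'I_m) (u : R) : R := centered (slab 0 u (C j)).

Lemma time_mono i k : (i <= k)%N -> (k <= L)%N -> t i <= t k.
Proof.
move=> /subnKC <-; elim: (k - i)%N => [|n IH] H; first by rewrite addn0.
rewrite addnS in H *; apply: (le_trans (IH (ltnW H))); exact/ltW/t_lt.
Qed.

Lemma time_ge0 i : (i <= L)%N -> 0 <= t i.
Proof. by move=> iL; rewrite -t0; exact: time_mono. Qed.

Lemma slab_fin a b j : 0 <= a -> b <= t L ->
  M (slab a b (C j)) \is a fin_num /\ mu (slab a b (C j)) \is a fin_num.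
Proof.
move=> a0 bt; have sub : slab a b (C j) `<=` slab 0 (t L) (C j) by apply: slab_mono.
have h (K : {measure set (measurableTypeR R * J) -> \bar R}) :
    (K (slab 0 (t L) (C j)) < +oo)%E -> K (slab a b (C j)) \is a fin_num.
  move=> fin; rewrite ge0_fin_numE//; apply: le_lt_trans fin.
  by apply: le_measure; rewrite ?inE; [exact: measurable_slab..|].
split; apply: h; first exact: MC.
rewrite /mu mu_slab// ?time_ge0// lte_mul_pinfty ?lee_fin ?subr_ge0 ?time_ge0//.
Qed.

Lemma centered_slab a b j : 0 <= a -> a <= b -> b <= t L ->
  centered (slab a b (C j)) = cumul j b - cumul j a.
Proof.
move=> a0 ab bt; have at_ := le_trans ab bt.
have [M1 m1] := slab_fin j a0 bt; have [M2 m2] := slab_fin j (lexx 0) at_.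
have hU (K : {measure set (measurableTypeR R * J) -> \bar R}) :
    K (slab 0 b (C j)) = (K (slab 0 a (C j)) + K (slab a b (C j)))%E.
  rewrite (slab_split (C j) a0 ab); apply: measureU; last exact: slab_disj.
  - exact: measurable_slab.
  - exact: measurable_slab.
rewrite /cumul /centered (hU M) (hU mu) -/mu.
move: M1 M2 m1 m2; case: (M (slab a b _)) => [x1||]//; case: (M _) => [x2||]//.
case: (mu (slab a b _)) => [x3||]//; case: (mu _) => [x4||]// _ _ _ _ /=.
by ring.
Qed.

Lemma centered_bound a b j : 0 <= a -> b <= t L ->
  `|centered (slab a b (C j))| <= fine (M (slab a b (C j))) + fine (mu (slab a b (C j))).
Proof.
move=> a0 bt; have [M1 m1] := slab_fin j a0 bt.
rewrite /centered fineB// (le_trans (ler_normB _ _))//.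
by rewrite !ger0_norm ?fine_ge0.
Qed.

Lemma cumul_right_cont j (a u : R) : 0 <= a -> a <= t L -> 0 <= u ->
  right_cont ((fun v => cumul j (Num.min a v)) : R -> R^o) u.
Proof.
move=> a0 at_ u0 e e0; have e20 : 0 < e / 2 by rewrite divr_gt0.
have b0 : 0 <= Num.min a u by rewrite le_min a0.
have bt : Num.min a u <= t L by rewrite ge_min at_.
have mufin : (mu (slab 0 (t L) (C j)) < +oo)%E.
  by have [_] := slab_fin j (lexx 0) (lexx (t L)); rewrite ge0_fin_numE.
have [d1 d10 H1] := slab_vanish (mC j) (MC j) b0 bt e20.
have [d2 d20 H2] := slab_vanish (mC j) mufin b0 bt e20.
exists (Num.min d1 d2) => [|v uv vd]; first by rewrite lt_min d10.
have bv : Num.min a u <= Num.min a v by rewrite le_min !ge_min lexx uv orbT.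
have vt : Num.min a v <= t L by rewrite ge_min at_.
have dd : Num.min a v <= Num.min a u + Num.min d1 d2.
  have d0 : 0 <= Num.min d1 d2 by rewrite le_min !ltW.
  have [au|ua] := leP a u; first by rewrite ge_min lerDl d0.
  by rewrite ge_min vd orbT.
rewrite -(centered_slab _ b0 bv vt) (le_trans (centered_bound _ b0 vt))//.
have [M1 m1] := slab_fin j b0 vt; rewrite [leRHS]splitr; apply: lerD.
  rewrite -lee_fin fineK//; apply/ltW/H1 => //; apply: (le_trans dd).
  by rewrite lerD2l ge_min lexx.
rewrite -lee_fin fineK//; apply/ltW/H2 => //; apply: (le_trans dd).
by rewrite lerD2l ge_min lexx orbT.
Qed.

Variable f : 'I_L -> 'I_m -> X.

(** The integral written with the distribution function [cumul] in time, so that right continuity in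
    [u] reduces to that of [cumul]. *)
Definition path (u : R) : X := \sum_(i < L) \sum_(j < m)
  (cumul j (Num.min (t i.+1) u) - cumul j (Num.min (t i) u)) *: f i j.

Lemma path0 : path 0 = 0.
Proof.
rewrite /path big1// => i _; rewrite big1// => j _.
by rewrite !min_r ?subrr ?scale0r//; apply: time_ge0 => //; exact: ltnW.
Qed.

Lemma path_beyond u : t L <= u -> path u = path (t L).
Proof.
move=> tu; apply: eq_bigr => i _; apply: eq_bigr => j _.
have h k : (k <= L)%N -> Num.min (t k) u = Num.min (t k) (t L).
  by move=> kL; rewrite !min_l// ?(le_trans _ tu)//; exact: time_mono.
by rewrite !h// ltnW.
Qed.

(** Within one interval of constancy only the terms of index [i0] move: earlier ones are complete
    and later ones have not begun. *)
Lemma path_step (i0 : 'I_L) (r r' : R) : r <= r' -> t i0 <= r -> r' <= t i0.+1 ->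
  path r' = path r + \sum_(j < m) centered (slab r r' (C j)) *: f i0 j.
Proof.
move=> rr tr rt; have r0 : 0 <= r by apply: le_trans tr; apply: time_ge0; exact: ltnW.
have rL : r' <= t L by apply: (le_trans rt); exact: time_mono.
rewrite /path [in LHS](bigD1 i0)//= [in RHS](bigD1 i0)//= addrAC; congr (_ + _); last first.
  apply: eq_bigr => i ii0; apply: eq_bigr => j _.
  have [lt|gt] : (i < i0)%N \/ (i0 < i)%N.
    by move: ii0; rewrite -val_eqE/= neq_ltn => /orP[]; [left|right].
    have ti1 : t i.+1 <= r by apply: (le_trans _ tr); apply: time_mono => //; exact: ltnW.
    have ti : t i <= r by apply: le_trans ti1; exact/ltW/t_lt.
    by rewrite !min_l// ?(le_trans _ rr).
  have ti : r' <= t i by apply: (le_trans rt); apply: time_mono => //; exact: ltnW.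
  have ti1 : r' <= t i.+1 by apply: (le_trans ti); exact/ltW/t_lt.
  by rewrite !min_r ?subrr ?scale0r// ?(le_trans rr).
rewrite -big_split/=; apply: eq_bigr => j _.
rewrite -scalerDl (centered_slab _ r0 rr rL) (min_l (le_trans tr rr)) (min_l tr).
rewrite (min_r rt) (min_r (le_trans rr rt)); congr (_ *: _).
by rewrite addrAC addrCA subrr addr0.
Qed.

Lemma path_right_cont u : 0 <= u -> right_cont path u.
Proof.
move=> u0; apply: right_cont_sum => i; apply: right_cont_sum => j; apply: right_contZ.
have h k : (k <= L)%N -> right_cont ((fun v => cumul j (Num.min (t k) v)) : R -> R^o) u.
  by move=> kL; apply: cumul_right_cont => //; [exact: time_ge0|exact: time_mono].
apply: right_contD; first exact: h.
move=> e e0; have [d d0 H] := h i (ltnW (ltn_ord i)) e e0; exists d => // v uv vd.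
by rewrite -opprD normrN -[X in _ - X]opprK opprK; exact: H.
Qed.

End deterministic_paths.

(** * Discretization *)

Section grid.
Context {R : realType} (t : nat -> R) (L K : nat).
Hypotheses (t0 : t 0%N = 0) (t_lt : forall i, (i < L)%N -> t i < t i.+1) (K0 : (0 < K)%N).

(* The interval [t i, t i.+1] is cut into [K] equal parts, starting at index [i * K]. *)
Definition grid (q : nat) : R :=
  t (q %/ K) + (q %% K)%:R / K%:R * (t (q %/ K).+1 - t (q %/ K)).

Lemma gridS q : grid q.+1 - grid q = (t (q %/ K).+1 - t (q %/ K)) / K%:R.
Proof.
have Kn0 : K%:R != 0 :> R by rewrite pnatr_eq0 -lt0n.
have qE := divn_eq q K; have mK := ltn_pmod q K0.
rewrite /grid; set i := (q %/ K)%N in qE *; set k := (q %% K)%N in qE mK *.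
have [kK|kK] := ltnP k.+1 K.
  have -> : (q.+1 %/ K)%N = i by rewrite qE -addnS divnMDl// divn_small// addn0.
  have -> : (q.+1 %% K)%N = k.+1 by rewrite qE -addnS modnMDl modn_small.
  by rewrite -natr1; field.
have kE : k.+1 = K by apply/eqP; rewrite eqn_leq mK.
have -> : (q.+1 %/ K)%N = i.+1 by rewrite qE -addnS kE divnMDl// divnn K0 addn1.
have -> : (q.+1 %% K)%N = 0%N by rewrite qE -addnS kE modnMDl modnn.
have -> : k%:R = K%:R - 1 :> R by rewrite -kE -natr1 addrK.
by rewrite !mul0r addr0; field.
Qed.

Lemma grid_div q : (q < L * K)%N -> (q %/ K < L)%N.
Proof. by move=> qQ; rewrite ltn_divLR. Qed.

Lemma grid_bounds q : (q < L * K)%N ->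
  [/\ t (q %/ K) <= grid q, grid q < grid q.+1 & grid q.+1 <= t (q %/ K).+1].
Proof.
move=> qQ; have lt := t_lt (grid_div qQ).
have Kp : 0 < K%:R :> R by rewrite ltr0n.
have d0 : 0 < t (q %/ K).+1 - t (q %/ K) by rewrite subr_gt0.
split.
- by rewrite /grid lerDl mulr_ge0 ?divr_ge0 ?(ltW d0)// ltW.
- by rewrite -subr_gt0 gridS divr_gt0.
- have := gridS q; move/eqP; rewrite subr_eq => /eqP ->; rewrite /grid.
  rewrite addrCA -lerBrDl; set x := _ - _ in d0 *.
  have -> : x / K%:R + (q %% K)%:R / K%:R * x = ((q %% K).+1%:R / K%:R) * x.
    by rewrite -natr1; field; rewrite gt_eqF.
  by rewrite ler_piMl ?(ltW d0)// ler_pdivrMr// mul1r ler_nat ltn_pmod.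
Qed.

Lemma grid0 : grid 0 = 0.
Proof. by rewrite /grid div0n mod0n !mul0r addr0 t0. Qed.

Lemma grid_last : grid (L * K) = t L.
Proof. by rewrite /grid mulnK// modnMl !mul0r addr0. Qed.

Lemma grid_mono q q' : (q <= q')%N -> (q' <= L * K)%N -> grid q <= grid q'.
Proof.
move=> /subnKC <-; elim: (q' - q)%N => [|n IH] H; first by rewrite addn0.
rewrite addnS in H *; apply: (le_trans (IH (ltnW H))).
by have [_ /ltW] := grid_bounds H.
Qed.

Lemma grid_ge0 q : (q <= L * K)%N -> 0 <= grid q.
Proof. by move=> qQ; rewrite -grid0; exact: grid_mono. Qed.

Lemma grid_locate x n : grid 0 < x -> x <= grid n ->
  exists2 q, (q < n)%N & grid q < x /\ x <= grid q.+1.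
Proof.
move=> x0; elim: n => [|n IH] xn; first by move: (lt_le_trans x0 xn); rewrite ltxx.
have [/IH[q qn Hq]|nx] := leP x (grid n); first by exists q => //; exact: leqW.
by exists n.
Qed.

End grid.

Section grid_process.
Context {R : realType} {X : normedModType R} {dJ : measure_display} {J : measurableType dJ}
  (nu : {sigma_finite_measure set J -> \bar R})
  {d : measure_display} {T : measurableType d}
  (N : T -> {measure set (measurableTypeR R * J) -> \bar R}).
Variables (t : nat -> R) (L m K : nat) (A : 'I_m -> set J) (B : set J).
Hypotheses (t0 : t 0%N = 0) (t_lt : forall i, (i < L)%N -> t i < t i.+1)
  (mA : forall j, measurable (A j)) (mB : measurable B)
  (tA : trivIset setT A)
  (nuA : forall j, (nu (A j) < +oo)%E) (K0 : (0 < K)%N)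
  (KC : forall i j, (i < L)%N -> ((t i.+1 - t i)%:E * nu (A j `&` B) <= K%:R%:E)%E).

Let mu : {measure set (measurableTypeR R * J) -> \bar R} := (lebesgue_measure \x nu)%E.
Let C j := A j `&` B.
Let r := grid t K.
Let Q := (L * K)%N.

(* The cell of time step [q] and set [C j] has number [q * m + j]. *)
Definition cellC (j : nat) : set J := if insub j is Some o then C o else set0.
Definition cell (M : nat) : set (measurableTypeR R * J) :=
  if (M < Q * m)%N then slab (r (M %/ m)) (r (M %/ m).+1) (cellC (M %% m)) else set0.

Lemma cellC_ord (j : 'I_m) : cellC j = C j.
Proof. by rewrite /cellC valK. Qed.

Lemma cellP M : (M < Q * m)%N -> exists (q : nat) (j : 'I_m),
  [/\ (q < Q)%N, M = (q * m + j)%N & cell M = slab (r q) (r q.+1) (C j)].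
Proof.
move=> MQ; have m0 : (0 < m)%N by case: (m) MQ => //; rewrite muln0.
have qQ : (M %/ m < Q)%N by rewrite ltn_divLR.
exists (M %/ m)%N, (Ordinal (ltn_pmod M m0)); split=> //; first exact: divn_eq.
by rewrite /cell MQ -cellC_ord.
Qed.

Lemma cellE (q : nat) (j : 'I_m) : (q < Q)%N ->
  cell (q * m + j) = slab (r q) (r q.+1) (C j).
Proof.
move=> qQ; have m0 : (0 < m)%N by apply: leq_ltn_trans (ltn_ord j).
rewrite /cell divnMDl// modnMDl (divn_small (ltn_ord j)) (modn_small (ltn_ord j)) addn0 cellC_ord ifT//.
apply: (@leq_trans (q.+1 * m)); first by rewrite mulSn addnC ltn_add2r.
by rewrite leq_mul2r qQ orbT.
Qed.

Lemma measurable_C j : measurable (C j). Proof. exact: measurableI. Qed.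

Lemma restricted_set_finite j : (nu (C j) < +oo)%E.
Proof.
apply: le_lt_trans (nuA j); apply: le_measure; rewrite ?inE//.
- exact: measurable_C.
- by move=> x [].
Qed.

Lemma measurable_cell M : measurable (cell M).
Proof.
case: (ltnP M (Q * m)) => [/cellP[q [j [_ _ ->]]]|H]; last first.
  by rewrite /cell ltnNge H; exact: measurable0.
apply: measurable_slab; exact: measurable_C.
Qed.

Lemma cell_half_line M : cell M `<=` half_line_times.
Proof.
case: (ltnP M (Q * m)) => [/cellP[q [j [qQ _ ->]]]|H]; last first.
  by rewrite /cell ltnNge H; exact: sub0set.
by apply: slab_half_line; apply: (@grid_ge0 _ _ L) => //; exact: ltnW.
Qed.

Lemma cell_mass M : (mu (cell M) <= 1)%E.
Proof.
case: (ltnP M (Q * m)) => [/cellP[q [j [qQ _ ->]]]|H]; last by rewrite /cell ltnNge H measure0.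
have [_ lt _] := grid_bounds t_lt K0 qQ.
rewrite /mu mu_slab//; [|exact: ltW|exact: measurable_C].
rewrite gridS//; have := KC j (grid_div K0 qQ).
have Kp : 0 < K%:R :> R by rewrite ltr0n.
have : nu (C j) \is a fin_num by rewrite ge0_fin_numE ?restricted_set_finite.
rewrite -/(C j); case: (nu (C j)) => // x _.
by rewrite -!EFinM !lee_fin mulrAC ler_pdivrMr// mul1r.
Qed.

Lemma cell_trivIset : trivIset setT cell.
Proof.
move=> M M' _ _; case: (ltnP M (Q * m)) => [/cellP[q [j [qQ -> ->]]]|H]; last first.
  by rewrite /cell ltnNge H set0I => /set0P; rewrite eqxx.
case: (ltnP M' (Q * m)) => [/cellP[q' [j' [qQ' -> ->]]]|H]; last first.
  by rewrite /cell ltnNge H setI0 => /set0P; rewrite eqxx.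
move=> [[x z] [[/=]]]; rewrite in_itv/= => /andP[x1 x2] [zA _] [/=].
rewrite in_itv/= => /andP[x3 x4] [zA' _].
have jj : j = j' by apply: tA => //; exists z.
suff qq : q = q' by rewrite qq jj.
apply/eqP; rewrite eqn_leq; apply/andP; split; rewrite leqNgt; apply/negP => lt.
  have := grid_mono t_lt K0 lt (ltnW qQ); rewrite -/(r q) -/(r q'.+1) leNgt.
  by rewrite (lt_le_trans x1 x4).
have := grid_mono t_lt K0 lt (ltnW qQ'); rewrite -/(r q') -/(r q.+1) leNgt.
by rewrite (lt_le_trans x3 x2).
Qed.

Definition history_basis (u : R) : set_system T :=
  [set E | exists (a b : R) (A : set J) (Y : set (\bar R)),
    [/\ (0 <= a)%R, (a < b)%R & (b <= u)%R] /\
    [/\ measurable A, measurable Y & E = [set w | Y (N w (`]a, b] `*` A))]]].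

Variable f : 'I_L -> 'I_m -> T -> X.

Definition cellf (M : nat) (w : T) : X :=
  if (insub (M %/ m %/ K)%N, insub (M %% m)%N) is (Some i, Some j) then f i j w else 0.

Lemma cellfE (q : nat) (j : 'I_m) (qQ : (q < Q)%N) w :
  cellf (q * m + j) w = f (Ordinal (grid_div K0 qQ)) j w.
Proof.
have m0 : (0 < m)%N by apply: leq_ltn_trans (ltn_ord j).
rewrite /cellf divnMDl// modnMDl (divn_small (ltn_ord j)) (modn_small (ltn_ord j)) addn0 valK.
by rewrite (insubT (fun k => k < L)%N (grid_div K0 qQ)).
Qed.

(** Transform and path agree at multiples of [m], when all the sets of a time step have been added.
    The intermediate indices can only enlarge the maximal function. *)
Lemma transform_path w q : (q <= Q)%N ->
  (forall j, (N w (slab 0 (t L) (C j)) < +oo)%E) ->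
  transform mu N cell cellf (q * m) w =
  path nu (N w) t C (fun i j => f i j w) (r q).
Proof.
move=> qQ NC; elim: q qQ => [|q IH] qQ.
  by rewrite mul0n transform0 /r (grid0 _ t0) (path0 nu _ C t0 t_lt).
have [b1 b2 b3] := grid_bounds t_lt K0 qQ.
rewrite mulSn addnC /transform big_split_ord/= -/(transform _ _ _ _ _ _) (IH (ltnW qQ)).
rewrite (path_step t0 t_lt measurable_C restricted_set_finite NC _ (i0 := Ordinal (grid_div K0 qQ)) (ltW b2) b1 b3).
congr (_ + _); apply: eq_bigr => j _.
by rewrite cellfE /incr /compensated cellE.
Qed.

Lemma path_le_maximal w q : (q <= Q)%N ->
  (forall j, (N w (slab 0 (t L) (C j)) < +oo)%E) ->
  `|path nu (N w) t C (fun i j => f i j w) (r q)| <= maximal mu N cell cellf (Q * m) w.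
Proof.
move=> qQ NC; rewrite -transform_path//; apply: maximal_ge.
by rewrite leq_mul2r qQ orbT.
Qed.

(** Cells are numbered by time first, so all nonempty cells from [M] on start no earlier than [t i],
    whereas the history at [t i] is generated by slabs that end by then. *)
Lemma cellf_adapted :
  (forall i j, exists n (F : 'I_n -> T -> R) (x : 'I_n -> X),
     f i j = (fun w => \sum_k F k w *: x k) /\
     forall k, bounded_sigma_measurable (history_basis (t i)) (F k)) ->
  adapted half_line_times N cell (@bounded_sigma_measurable _ _ _) cellf.
Proof.
move=> Hf M; case: (ltnP M (Q * m)) => [MQ|H]; last first.
  rewrite (_ : cellf M = fun=> 0); first exact: fspan0.
  apply/funext => w; rewrite /cellf; case: (posnP m) => [m0|m0].
    by case: insubP => // o _ _; case: insubP => // o' _ _; move: (ltn_ord o'); rewrite {2}m0.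
  case: insubP => // o; rewrite ltn_divLR// ltn_divLR// => H'.
  by move: H; rewrite leqNgt H'.
have [q [j [qQ ME _]]] := cellP MQ.
rewrite (_ : cellf M = f (Ordinal (grid_div K0 qQ)) j); last first.
  by apply/funext => w; rewrite ME cellfE.
have [n [F [x [-> HF]]]] := Hf (Ordinal (grid_div K0 qQ)) j.
apply: fspan_sum => k; have [mF bF] := HF k; split=> //.
move=> _ Y mY; have := mF measurableT Y mY.
apply: smallest_sub; first exact: smallest_sigma_algebra.
move=> _ [a [b [A' [Y' [[a0 ab bt] [mA' mY' ->]]]]]]; apply: sub_sigma_algebra.
apply: cylinder1 => //.
- by apply: measurableX.
- exact: slab_half_line.
rewrite -subset0 => -[y z] [[/=]]; rewrite in_itv/= => /andP[_ yb] _ [M' /= MM'].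
case: (ltnP M' (Q * m)) => [/cellP[q' [j' [qQ' M'E ->]]]|H]; last by rewrite /cell ltnNge H.
move=> [/=]; rewrite in_itv/= => /andP[yr _] _.
have qq : (q <= q')%N.
  have m0 : (0 < m)%N by apply: leq_ltn_trans (ltn_ord j).
  rewrite leqNgt; apply/negP => q'q; move: MM'; rewrite ME M'E leqNgt => /negP; apply.
  apply: (@leq_trans (q'.+1 * m)); first by rewrite mulSn addnC ltn_add2r.
  by apply: (@leq_trans (q * m)); rewrite ?leq_addr// leq_mul2r q'q orbT.
have [b1 _ _] := grid_bounds t_lt K0 qQ.
have := le_trans bt (le_trans b1 (grid_mono t_lt K0 qq (ltnW qQ'))).
by rewrite leNgt (lt_le_trans yr yb).
Qed.

Definition restricted (w : T) (z : measurableTypeR R * J) : X :=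
  (\1_B z.2 : R) *: \sum_(i < L) \sum_(j < m)
    (\1_(`]t i, t i.+1]%classic) z.1 * \1_(A j) z.2 : R) *: f i j w.

Lemma restricted_cell M w z : cell M z -> restricted w z = cellf M w.
Proof.
case: (ltnP M (Q * m)) => [/cellP[q [j [qQ -> ->]]]|H]; last by rewrite /cell ltnNge H.
move=> [/=]; rewrite in_itv/= => /andP[zl zr] [zA zB].
have [b1 b2 b3] := grid_bounds t_lt K0 qQ.
rewrite cellfE /restricted indicE mem_set// scale1r.
rewrite (bigD1 (Ordinal (grid_div K0 qQ)))//= (bigD1 j)//= !indicE !mem_set//; last first.
  by rewrite /= in_itv/= (le_lt_trans b1 zl) (le_trans zr b3).
rewrite mulr1 scale1r [X in _ + X + _]big1 ?addr0; last first.
  move=> j' /negP jj'; rewrite [X in _ * X]indicE memNset ?mulr0 ?scale0r// => zA'.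
  by apply: jj'; apply/eqP/tA => //; exists z.2.
rewrite big1 ?addr0// => i ii; rewrite big1// => j' _.
rewrite indicE memNset ?mul0r ?scale0r//= in_itv/= => /andP[zi zi'].
have [lt|gt] : (i < q %/ K)%N \/ (q %/ K < i)%N.
  by move: ii; rewrite -val_eqE/= neq_ltn => /orP[]; [left|right].
  have := time_mono t_lt lt (ltnW (grid_div K0 qQ)).
  by rewrite leNgt (le_lt_trans b1 (lt_le_trans zl zi')).
have := time_mono t_lt gt (ltnW (ltn_ord i)).
by rewrite leNgt (lt_le_trans zi (le_trans zr b3)).
Qed.

Lemma restricted_off w z : (forall M, (M < Q * m)%N -> ~ cell M z) -> restricted w z = 0.
Proof.
move=> H; rewrite /restricted; have [zB|zB] := pselect (B z.2); last first.
  by rewrite indicE memNset// scale0r.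
rewrite big1 ?scaler0// => i _; rewrite big1// => j _.
have [zA|zA] := pselect (A j z.2); last by rewrite [X in _ * X]indicE memNset// mulr0 scale0r.
rewrite [X in X * _]indicE; have [zt|zt] := pselect (`]t i, t i.+1]%classic z.1); last first.
  by rewrite memNset// mul0r scale0r.
exfalso; move: zt; rewrite /= in_itv/= => /andP[zi zi'].
have z0 : grid t K 0 < z.1.
  by rewrite grid0//; apply: le_lt_trans zi; apply: (time_ge0 t0 t_lt); exact: ltnW.
have zL : z.1 <= grid t K Q.
  by rewrite grid_last//; apply: (le_trans zi'); exact: (time_mono t_lt).
have [q qQ [q1 q2]] := grid_locate z0 zL.
apply: (H (q * m + j)%N).
  apply: (@leq_trans (q.+1 * m)); first by rewrite mulSn addnC ltn_add2r.
  by rewrite leq_mul2r qQ orbT.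
by rewrite cellE//; split => //=; rewrite in_itv/= q1.
Qed.

Lemma measurable_half_line : measurable (half_line_times : set (measurableTypeR R * J)).
Proof.
rewrite (_ : half_line_times = `[0%R, +oo[%classic `*` setT).
  by apply: measurableX => //; exact: measurable_itv.
by apply/seteqP; split => z /=; rewrite /half_line_times/= in_itv/= andbT => //; case.
Qed.

(** Points outside all cells contribute nothing because [h 0 = 0]. The left side does not involve
    the mesh, so refining the grid leaves the energy unchanged. *)
Lemma integral_restricted (h : R -> R) w : h 0 = 0 -> (forall x, 0 <= x -> 0 <= h x) ->
  (\int[mu]_(z in half_line_times) (h `|restricted w z|)%:E =
   (energy mu cell h cellf (Q * m) w)%:E)%E.
Proof.
move=> h0 hge0.
rewrite (eq_integral (fun z => \sum_(M < Q * m) ((h `|cellf M w|)%:E * (\1_(cell M) z)%:E)))%E; last first.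
  move=> z _; have [[M [MQ Mz]]|H] := pselect (exists M, (M < Q * m)%N /\ cell M z).
    rewrite (restricted_cell w Mz) (bigD1 (Ordinal MQ))//= indicE mem_set// mule1.
    rewrite big1 ?adde0// => M' MM'; rewrite indicE memNset ?mule0// => M'z.
    move/negP: MM'; apply; apply/eqP/val_inj; apply: cell_trivIset => //.
    by exists z.
  rewrite restricted_off ?normr0 ?h0; last by move=> M MQ Mz; apply: H; exists M.
  rewrite big1// => M _; rewrite indicE memNset ?mule0// => Mz.
  by apply: H; exists M.
rewrite ge0_integral_sum//; [|exact: measurable_half_line| |]; last 2 first.
- move=> M; apply: measurable_funeM; apply/measurable_EFinP; apply: measurable_funTS.
  by apply: measurable_indic; exact: measurable_cell.
- by move=> M z _; rewrite mule_ge0 ?lee_fin ?hge0.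
rewrite /energy -sumEFin; apply: eq_bigr => M _.
rewrite ge0_integralZl//; [|exact: measurable_half_line| |]; last 2 first.
- apply/measurable_EFinP; apply: measurable_funTS.
  by apply: measurable_indic; exact: measurable_cell.
- by rewrite lee_fin hge0.
rewrite integral_indic//; [|exact: measurable_half_line|exact: measurable_cell].
rewrite setIidl; last exact: cell_half_line.
by rewrite /mass EFinM muleC fineK// ge0_fin_numE//; apply: le_lt_trans (cell_mass M) (ltry 1).
Qed.

End grid_process.

Section ae_tools.
Context {R : realType} {d : measure_display} {T : measurableType d}.
Local Open Scope ereal_scope.

Lemma limn_einf_ge (u : nat -> \bar R) c : (\forall n \near \oo, c <= u n) ->
  c <= limn_einf u.
Proof.
move=> [n _ H]; rewrite limn_einf_lim (cvg_lim _ (@cvg_einfs_sup _ u))//.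
apply: (@le_trans _ _ (einfs u n)); last by apply: ereal_sup_ubound; exists n.
by apply: le_ereal_inf_tmp => _ [k /= nk <-]; exact: H.
Qed.

Lemma limn_einf_le (u : nat -> \bar R) b : (forall n, u n <= b) -> limn_einf u <= b.
Proof.
move=> ub; apply: (le_trans (limn_einf_sup u)); rewrite limn_esup_lim.
apply: lime_le; first exact: is_cvg_esups.
by apply: nearW => n; apply: ge_ereal_sup => _ [k _ <-].
Qed.

(** Every c below [y] is eventually a lower bound, so c^p bounds the limit inferior from below.
    Taking the inverse power lets c tend to [y]. *)
Lemma powR_limn_einf (p y : R) (x : nat -> R) : (0 < p)%R -> (0 <= y)%R ->
  (forall n, 0 <= x n)%R ->
  (forall e, (0 < e)%R -> \forall n \near \oo, (y - e <= x n)%R) ->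
  (y `^ p)%:E <= limn_einf (fun n => (x n `^ p)%:E).
Proof.
move=> p0 y0 x0 H; set l := limn_einf _.
have lge0 : 0 <= l by apply: limn_einf_ge; apply: nearW => n; rewrite lee_fin powR_ge0.
have [->|yn0] := eqVneq y 0%R; first by rewrite powR0 ?gt_eqF.
have yp : (0 < y)%R by rewrite lt_neqAle eq_sym yn0.
have cl c : (0 <= c)%R -> (c < y)%R -> (c `^ p)%:E <= l.
  move=> c0 cy; apply: limn_einf_ge.
  have := H (y - c)%R; rewrite subr_gt0 => /(_ cy); apply: filterS => n.
  by rewrite opprB addrC subrK lee_fin => cx; apply: powR_le => //; exact: ltW.
case: (l) lge0 cl => [r r0 cl|_ _|//]; last exact: leey.
rewrite lee_fin; have r00 : (0 <= r)%R by rewrite -lee_fin.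
have -> : r = ((r `^ p^-1) `^ p)%R by rewrite -powRrM mulVf ?gt_eqF// powRr1.
apply: powR_le => //; first exact: ltW.
apply/ler_addgt0Pr => e e0; rewrite -lerBlDr.
have [|ye0] := leP (y - e)%R 0%R; first by move=> /le_trans; apply; exact: powR_ge0.
have := cl (y - e)%R (ltW ye0); rewrite ltrBlDr ltrDl => /(_ e0); rewrite lee_fin => Hr.
have -> : (y - e = ((y - e) `^ p) `^ p^-1)%R.
  by rewrite -powRrM mulfV ?gt_eqF// powRr1// ltW.
by apply: powR_le => //; [rewrite ltW// invr_gt0|exact: powR_ge0].
Qed.

Lemma ess_bounded (P : probability T R) (F : T -> R) :
  'N[P]_+oo [EFin \o F] < +oo -> exists b : R, {ae P, forall w, (`|F w| <= b)%R}.
Proof.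
rewrite unlock /= probability_setT lte01; set g := (abse \o _) => fin.
have ge0 : 0 <= ess_sup P g.
  apply: ess_sup_gee; last by apply: nearW => w; exact: abse_ge0.
  exact: (eq_ind_r (fun z : \bar R => 0 < z) lte01 (@probability_setT _ _ _ P)).
exists (fine (ess_sup P g)); have := ess_sup_ge P g; apply: filterS => w.
by rewrite -lee_fin fineK ?ge0_fin_numE.
Qed.

End ae_tools.

(** * From grid points to all times *)

Section process.
Context {R : realType} {X : normedModType R} {dJ : measure_display} {J : measurableType dJ}
  (nu : {sigma_finite_measure set J -> \bar R})
  {d : measure_display} {T : measurableType d} (P : probability T R)
  (N : T -> {measure set (measurableTypeR R * J) -> \bar R}).

Let mu : {measure set (measurableTypeR R * J) -> \bar R} := (lebesgue_measure \x nu)%E.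

Hypothesis HN : poisson_random_measure P half_line_times mu N.
Variables (phi : simple_process X J T) (B : set J).
Hypotheses (Hphi : simple_adapted P nu N phi) (mB : measurable B).

Let L := sp_l phi.
Let m := sp_m phi.
Let t := sp_t phi.
Let C j := sp_A phi j `&` B.

Definition coeff (F : 'I_(sp_l phi) -> 'I_(sp_m phi) -> 'I_(sp_n phi) -> T -> R) i j (w : T) : X :=
  \sum_k F i j k w *: sp_x phi i j k.

Let mC j : measurable (C j).
Proof. by apply: measurableI => //; apply: sp_A_measurable Hphi j. Qed.

Let nuC j : (nu (C j) < +oo)%E.
Proof.
apply: le_lt_trans (sp_A_finite Hphi j); apply: le_measure; rewrite ?inE//.
- exact: sp_A_measurable Hphi j.
- by move=> x [].
Qed.

(** Finiteness of the masses is essential: [fine] of a difference is additive in time only for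
    finite values. *)
Lemma sp_integral_path w u : 0 <= u ->
  (forall j, (N w (slab 0 (t L) (C j)) < +oo)%E) ->
  sp_integral nu N phi B u w =
  path nu (N w) t C (fun i j => coeff (sp_F phi) i j w) u.
Proof.
move=> u0 NC; apply: eq_bigr => i _; apply: eq_bigr => j _.
rewrite /coeff scaler_sumr; apply: eq_bigr => k _.
have t0 := sp_t0 Hphi; have t_lt := sp_t_lt Hphi.
have iL := ltn_ord i.
have ti0 : 0 <= t i by apply: (time_ge0 t0 t_lt); exact: ltnW.
have ti : t i <= t i.+1 by apply/ltW/t_lt.
have tL : t i.+1 <= t L by apply: (time_mono t_lt).
rewrite -(centered_slab t0 t_lt mC nuC NC) ?scalerA//; first by rewrite mulrC.
- by rewrite le_min ti0.
- by rewrite le_min !ge_min lexx ti orbT.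
- by rewrite ge_min tL.
Qed.

Lemma sp_restrictE w z :
  sp_restrict phi B w z = restricted t (sp_A phi) B (coeff (sp_F phi)) w z.
Proof.
congr (_ *: _); apply: eq_bigr => i _; apply: eq_bigr => j _.
rewrite /coeff scaler_sumr; apply: eq_bigr => k _; rewrite scalerA -mulrA.
by congr (_ *: _); exact: mulrC.
Qed.

(** The coefficients are only essentially bounded, whereas the discrete part needs bounds at every
    point. Replacing values above the essential bound by 0 is a function of the coefficient alone,
    so measurability with respect to the history survives. *)
Lemma bounded_coefficients : exists F : 'I_(sp_l phi) -> 'I_(sp_m phi) -> 'I_(sp_n phi) -> T -> R,
  (forall (i : 'I_L) j k, bounded_sigma_measurable (history_basis N (t i)) (F i j k)) /\
  {ae P, forall w, forall i j k, F i j k w = sp_F phi i j k w}.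
Proof.
have /choice[b Hb] (q : 'I_(sp_l phi) * 'I_(sp_m phi) * 'I_(sp_n phi)) :
    exists b : R, {ae P, forall w, `|sp_F phi q.1.1 q.1.2 q.2 w| <= b}.
  exact: ess_bounded (sp_F_bounded Hphi _ _ _).
pose clip (c x : R) := (`|x| <= c)%R%:R * x.
exists (fun i j k w => clip (b (i, j, k)) (sp_F phi i j k w)); split.
  move=> i j k; set c := b _; split; last first.
    exists (Num.max c 0) => w; rewrite /clip; have [xc|cx] := leP `|_| c.
      by rewrite mul1r le_max xc.
    by rewrite mul0r normr0 le_max lexx orbT.
  have mF : sigma_measurable_fun (history_basis N (t i)) (sp_F phi i j k).
    move=> _ Y mY; rewrite setTI; apply: (sp_F_adapted Hphi (i := i) (j := j) (k := k)).
    by exists Y => //; rewrite setTI.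
  have mclip : measurable_fun setT (clip c).
    apply: measurable_funM => //.
    apply: (measurableT_comp (f := fun b : bool => b%:R : R)) => //.
    by apply: measurable_fun_ler => //; exact: measurableT_comp.
  exact: (measurableT_comp mclip mF).
have : {ae P, forall w, forall q, `|sp_F phi q.1.1 q.1.2 q.2 w| <= b q}.
  exact: filter_forall.
apply: filterS => w H i j k; have := H (i, j, k) => /= Hw.
by rewrite /clip Hw mul1r.
Qed.

Lemma ae_finite_mass : {ae P, forall w, forall j, (N w (slab 0 (t L) (C j)) < +oo)%E}.
Proof.
apply: filter_forall => j; have t0 := sp_t0 Hphi; have t_lt := sp_t_lt Hphi.
have tL0 : 0 <= t L by exact: (time_ge0 t0 t_lt).
have mS : measurable (slab 0 (t L) (C j)) by exact: measurable_slab.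
have sS : slab 0 (t L) (C j) `<=` half_line_times by exact: slab_half_line.
have muS : (mu (slab 0 (t L) (C j)) < +oo)%E.
  by rewrite /mu mu_slab// lte_mul_pinfty ?lee_fin ?subr0.
have mN := prm_measurable HN mS sS.
exists (~` [set w | exists k : nat, N w (slab 0 (t L) (C j)) = k%:R%:E]); split.
- apply: measurableC; rewrite (_ : [set _ | _] = \bigcup_k
    ((fun w => N w (slab 0 (t L) (C j))) @^-1` [set k%:R%:E])).
    apply: bigcupT_measurable => k; rewrite -[X in measurable X]setTI; exact: mN.
  by apply/seteqP; split => w [k]; [exists k|move=> _ ?; exists k].
- by apply: (poisson_ae_nat mN) (prm_poisson HN mS sS muS); exact: fine_ge0.
- move=> w H [k Hk]; apply: H; rewrite /= Hk; exact: ltry.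
Qed.

End process.

Lemma moment_const_gt0 {R : realType} (s K p : R) : 0 < K -> 0 < p -> 0 < moment_const s K p.
Proof.
move=> K0 p0; have two (a : R) : 0 < 2 `^ a by rewrite powR_gt0.
have del0 : 0 < good_lambda_del s K p by exact: good_lambda_del_gt0.
rewrite /moment_const mulr_gt0 ?addr_gt0 ?poisson_const_gt0//.
by rewrite mulr_gt0// mulr_gt0// mulr_gt0// mulr_gt0 ?geo_gt0// powR_gt0// invr_gt0.
Qed.

Section sampling.
Context {R : realType} {X : normedModType R} {dJ : measure_display} {J : measurableType dJ}
  (nu : {sigma_finite_measure set J -> \bar R})
  {d : measure_display} {T : measurableType d} (P : probability T R)
  (N : T -> {measure set (measurableTypeR R * J) -> \bar R}).

Let mu : {measure set (measurableTypeR R * J) -> \bar R} := (lebesgue_measure \x nu)%E.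

Hypothesis HN : poisson_random_measure P half_line_times mu N.
Variables (phi : simple_process X J T) (B : set J).
Hypotheses (Hphi : simple_adapted P nu N phi) (mB : measurable B).

Let L := sp_l phi.
Let m := sp_m phi.
Let t := sp_t phi.
Let A : 'I_m -> set J := sp_A phi.
Let C j := A j `&` B.

Variable F : 'I_L -> 'I_m -> 'I_(sp_n phi) -> T -> R.
Hypotheses (HF : forall (i : 'I_L) j k, bounded_sigma_measurable (history_basis N (t i)) (F i j k))
  (FE : {ae P, forall w, forall i j k, F i j k w = sp_F phi i j k w}).

Let t0 : t 0%N = 0 := sp_t0 Hphi.
Let t_lt i : (i < L)%N -> t i < t i.+1 := @sp_t_lt _ _ _ _ _ _ _ _ _ _ Hphi i.
Let mA j : measurable (A j) := sp_A_measurable Hphi j.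
Let tA : trivIset setT A := sp_A_disjoint Hphi.
Let nuA j : (nu (A j) < +oo)%E := sp_A_finite Hphi j.
Let tL0 : 0 <= t L. Proof. exact: (time_ge0 t0 t_lt). Qed.

Let nuC_lt j : (nu (C j) < +oo)%E. Proof. exact: (restricted_set_finite mA mB nuA). Qed.

Let nuC_fin j : nu (C j) \is a fin_num. Proof. by rewrite ge0_fin_numE. Qed.

(* Large enough for all cells to have intensity at most 1. *)
Definition mesh (n : nat) : nat :=
  ((Num.trunc (sp_t phi (sp_l phi) * \sum_j fine (nu (sp_A phi j `&` B)))).+1 + n)%N.

Let K0 n : (0 < mesh n)%N. Proof. by rewrite /mesh addSn. Qed.

Let KC n (i : nat) (j : 'I_m) : (i < L)%N ->
  ((t i.+1 - t i)%:E * nu (A j `&` B) <= (mesh n)%:R%:E)%E.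
Proof.
move=> iL; rewrite -/(C j) -(fineK (nuC_fin j)) -EFinM lee_fin.
apply: (@le_trans _ _ (t L * \sum_j fine (nu (C j)))).
  apply: ler_pM; [by rewrite subr_ge0; exact/ltW/t_lt|exact: fine_ge0| |].
    rewrite lerBlDr (le_trans (time_mono t_lt iL (leqnn L)))// lerDl.
    by apply: (time_ge0 t0 t_lt); exact: ltnW.
  rewrite (bigD1 j)//= lerDl sumr_ge0// => k _; exact: fine_ge0.
rewrite /mesh natrD -/t -/L; apply: (le_trans (ltW (truncnS_gt _))).
by rewrite lerDl.
Qed.

Let D n := cell t L (mesh n) A B.
Let f n := cellf (mesh n) (coeff F).
Let M n := (L * mesh n * m)%N.

Definition sampled_max (n : nat) (w : T) : R :=
  maximal mu N (cell (sp_t phi) (sp_l phi) (mesh n) (sp_A phi) B) (cellf (mesh n) (coeff F))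
    (sp_l phi * mesh n * sp_m phi) w.

Let adapted_f n : adapted half_line_times N (D n) (@bounded_sigma_measurable _ _ _) (f n).
Proof.
by apply: cellf_adapted => // i j; exists (sp_n phi), (F i j), (sp_x phi i j); split.
Qed.

(** The first grid point at or after [u] lies within [t L / mesh n] of it, and right continuity
    compares the two values. From [t L] on the path is constant and the last grid point gives its
    value. *)
Lemma sampled_max_lim w (u : R) : (forall j, (N w (slab 0 (t L) (C j)) < +oo)%E) ->
  (forall i j k, F i j k w = sp_F phi i j k w) -> 0 < u ->
  forall e, 0 < e -> \forall n \near \oo,
    `|sp_integral nu N phi B u w| - e <= sampled_max n w.
Proof.
move=> NC Fw u0 e e0; rewrite (sp_integral_path Hphi mB (ltW u0) NC).
have -> : (fun i j => coeff (sp_F phi) i j w) = (fun i j => coeff F i j w).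
  apply/funext => i; apply/funext => j; rewrite /coeff; apply: eq_bigr => k _.
  by rewrite Fw.
set pa := path nu (N w) t C _.
have le n q : (q <= L * mesh n)%N -> `|pa (grid t (mesh n) q)| <= sampled_max n w.
  move=> qQ; exact: (path_le_maximal t0 t_lt mA mB nuA (K0 n) (coeff F) qQ NC).
have [tu|ut] := leP (t L) u.
  apply: nearW => n; rewrite /pa (path_beyond _ _ _ t_lt _ tu) -/pa.
  rewrite -(grid_last t L (K0 n)); apply: (le_trans _ (le n _ (leqnn _))).
  by rewrite lerBlDr lerDl ltW.
have [del del0 Hdel] := path_right_cont t0 t_lt (fun j => measurableI _ _ (mA j) mB)
  nuC_lt NC (fun i j => coeff F i j w) (ltW u0) e0.
near=> n.
have gK : t L / (mesh n)%:R <= del.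
  rewrite ler_pdivrMr ?ltr0n// -ler_pdivrMl//.
  apply: (@le_trans _ _ n%:R); last by rewrite ler_nat /mesh leq_addl.
  near: n; exists (Num.trunc (del^-1 * t L)).+1 => // n /= Hn.
  by apply: (le_trans (ltW (truncnS_gt _))); rewrite ler_nat.
have [||q qQ [q1 q2]] := @grid_locate _ t (mesh n) u (L * mesh n).
- by rewrite grid0.
- by rewrite grid_last// ltW.
apply: (@le_trans _ _ `|pa (grid t (mesh n) q.+1)|); last exact: le.
rewrite lerBlDr.
have := Hdel _ q2; rewrite -/pa distrC => H.
rewrite -lerBlDl; apply: (le_trans (lerB_dist _ _)); apply: H.
rewrite addrC -lerBlDr; apply: (@le_trans _ _ (grid t (mesh n) q.+1 - grid t (mesh n) q)).
  by rewrite lerB// ltW.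
rewrite gridS//; apply: le_trans gK; rewrite ler_pM2r ?invr_gt0 ?ltr0n//.
have qL := grid_div (K0 n) qQ.
rewrite lerBlDr (le_trans (time_mono t_lt qL (leqnn L)))// lerDl.
by apply: (time_ge0 t0 t_lt); exact: ltnW.
Unshelve. all: by end_near. Qed.

Lemma sampled_max_measurable n : measurable_fun setT (sampled_max n).
Proof.
apply: (maximal_measurable HN).
- move=> k; exact: measurable_cell.
- move=> k; exact: (cell_half_line t0 t_lt (K0 n)).
- exact: (cell_trivIset t_lt tA (K0 n)).
- exact: adapted_bounded (adapted_f n).
Qed.

(** Successive grids are not nested, so Fatou's lemma takes the place of monotone convergence. The
    limit inferior is a measurable function above the supremum over times. *)
Lemma sup_sp_integral_le (p : R) (b : \bar R) : 0 < p ->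
  (forall n, \int[P]_w (sampled_max n w `^ p)%:E <= b)%E ->
  (\int[P]_w ereal_sup [set ((`|sp_integral nu N phi B u w| `^ p)%R)%:E
                         | u in [set u | (0 < u)%R]] <= b)%E.
Proof.
move=> p0 Hb.
have mS n : measurable_fun setT (fun w => (sampled_max n w `^ p)%:E).
  by apply/measurable_EFinP; apply: (measurableT_comp (measurable_powR p)); exact: sampled_max_measurable.
apply: (@le_trans _ _ (\int[P]_w limn_einf (fun n => (sampled_max n w `^ p)%:E))%E); last first.
  apply: (le_trans (fatou P _ _ _)) => //.
  - by move=> n w _; rewrite lee_fin powR_ge0.
  - exact: limn_einf_le.
apply: le_integral_ae.
- rewrite /limn_einf; apply: measurableT_comp => //.
  apply: measurable_fun_limn_esup => n.
  by apply: measurableT_comp => //; exact: mS.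
- move=> w; apply: (@le_trans _ _ ((`|sp_integral nu N phi B 1 w| `^ p)%:E)%E).
    by rewrite lee_fin powR_ge0.
  by apply: ereal_sup_ubound; exists 1 => //=.
- by move=> w; apply: limn_einf_ge; apply: nearW => n; rewrite lee_fin powR_ge0.
(* The exceptional null set does not depend on the time [u], so the whole supremum is controlled at
   once. *)
have := ae_finite_mass HN Hphi mB; apply: filterS2 FE => w Fw NC.
apply: ge_ereal_sup => _ [u /= u0 <-].
apply: powR_limn_einf => //.
- by move=> n; exact: maximal_ge0.
- exact: sampled_max_lim.
Qed.

Lemma sampled_energy n (h : R -> R) w : h 0 = 0 -> (forall x, 0 <= x -> 0 <= h x) ->
  (forall i j k, F i j k w = sp_F phi i j k w) ->
  ((energy mu (D n) h (f n) (M n) w)%:E =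
   \int[mu]_(z in half_line_times) (h `|sp_restrict phi B w z|)%:E)%E.
Proof.
move=> h0 hge0 Fw.
rewrite -(integral_restricted t0 t_lt mA mB tA nuA (K0 n) (@KC n) (coeff F) w h0 hge0).
apply: eq_integral => z _; rewrite sp_restrictE; congr (h `|_|)%:E.
congr (_ *: _); apply: eq_bigr => i _; apply: eq_bigr => j _; congr (_ *: _).
by apply: eq_bigr => k _; rewrite Fw.
Qed.

(** [g'] is the version of [g] on extended reals. Measurability is supplied by the discrete energy
    on the left. *)
Let energy_le (h : R -> R) n (g : R -> R) (g' : \bar R -> \bar R) : measurable_fun setT h ->
  measurable_fun setT g -> h 0 = 0 -> (forall x, 0 <= x -> 0 <= h x) ->
  (forall x, 0 <= x -> 0 <= g x) -> (forall x, (0 <= x -> 0 <= g' x)%E) -> (forall x, (g x)%:E = g' x%:E) ->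
  (\int[P]_w (g (energy mu (D n) h (f n) (M n) w))%:E <=
   \int[P]_w g' (\int[mu]_(z in half_line_times) (h `|sp_restrict phi B w z|)%:E))%E.
Proof.
move=> mh mg h0 hge0 gge0 g'ge0 gE; apply: le_ae_integral => //.
- apply/measurable_EFinP; apply: (measurableT_comp mg).
  apply: (energy_measurable HN) => //.
  exact: (adapted_bounded (adapted_f n)).
- by move=> w; rewrite lee_fin gge0// energy_ge0.
- move=> w; apply: g'ge0; apply: integral_ge0 => z _; rewrite lee_fin; exact: hge0.
- by apply: filterS FE => w Fw; rewrite -(sampled_energy n h0 hge0 Fw) gE.
Qed.

Variables (s K : R).
Hypotheses (s1 : 1 <= s) (K_gt0 : 0 < K) (mart : @martingale_bound R X s K).

Lemma sup_moment_large (p : R) : s <= p ->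
  (\int[P]_w ereal_sup [set ((`|sp_integral nu N phi B u w| `^ p)%R)%:E
                         | u in [set u | (0 < u)%R]] <=
   (moment_const s K p)%:E *
   (\int[P]_w (\int[mu]_(z in half_line_times) ((`|sp_restrict phi B w z| `^ s)%R)%:E) `^ (p / s)
    + \int[P]_w \int[mu]_(z in half_line_times) ((`|sp_restrict phi B w z| `^ p)%R)%:E))%E.
Proof.
move=> sp; have s0 : 0 < s by apply: lt_le_trans s1.
have p0 : 0 < p by apply: lt_le_trans sp.
apply: sup_sp_integral_le => // n.
apply: (le_trans (discrete_moment_large HN _ _ _ _ s1 K_gt0 mart _ (adapted_f n) sp)).
- move=> k; exact: measurable_cell.
- move=> k; exact: (cell_half_line t0 t_lt (K0 n)).
- exact: (cell_trivIset t_lt tA (K0 n)).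
- move=> k; apply: cell_mass => //; exact: KC.
apply: lee_wpmul2l; first by rewrite lee_fin ltW// moment_const_gt0.
apply: leeD.
  apply: (energy_le (h := @powR R ^~ s) n (g := @powR R ^~ (p / s)) (g' := fun x => (x `^ (p / s))%E)) => //.
  - by rewrite powR0// gt_eqF.
  - by move=> x _; exact: powR_ge0.
  - by move=> x _; exact: powR_ge0.
  - by move=> x _; exact: poweR_ge0.
apply: (energy_le (h := @powR R ^~ p) n (g := fun x => x) (g' := fun x => x)) => //.
- by rewrite powR0// gt_eqF.
- by move=> x _; exact: powR_ge0.
Qed.

Hypothesis s2 : s <= 2.

Definition small_const (p : R) : R := 4 `^ p * (1 + K * poisson_const s + poisson_const 1).

Lemma sup_moment_small (p eps : R) : 0 < p -> 0 < eps ->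
  (\int[P]_w ereal_sup [set ((`|sp_integral nu N phi B u w| `^ p)%R)%:E
                         | u in [set u | (0 < u)%R]] <=
   ((2 * eps) `^ p)%:E + (small_const p)%:E *
   \sum_(k <oo) (dyad eps k `^ p)%:E * \int[P]_w mine 1
     (\int[mu]_(z in half_line_times) (psi s (`|sp_restrict phi B w z| / dyad eps k))%:E))%E.
Proof.
move=> p0 e0; have s0 : 0 < s by apply: lt_le_trans s1.
apply: sup_sp_integral_le => // n.
apply: (le_trans (discrete_moment_small HN _ _ _ _ s1 K_gt0 mart _ (adapted_f n) p0 e0)).
- move=> k; exact: measurable_cell.
- move=> k; exact: (cell_half_line t0 t_lt (K0 n)).
- exact: (cell_trivIset t_lt tA (K0 n)).
- move=> k; apply: cell_mass => //; exact: KC.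
apply: leeD => //; apply: lee_wpmul2l.
  by rewrite lee_fin mulr_ge0 ?powR_ge0// !addr_ge0 ?mulr_ge0 ?(ltW (poisson_const_gt0 _))// ltW.
have psi0 k x : 0 <= x -> 0 <= psi s (x / dyad eps k).
  by move=> x0; apply: psi_ge0; rewrite divr_ge0// ltW// dyad_gt0.
apply: lee_nneseries.
  move=> k _; rewrite mule_ge0 ?lee_fin ?powR_ge0//; apply: integral_ge0 => w _.
  by rewrite lee_fin le_min ler01 energy_ge0//; exact: psi0.
move=> k _; apply: lee_wpmul2l; first by rewrite lee_fin powR_ge0.
apply: (energy_le (h := fun x : R => psi s (x / dyad eps k)) n
  (g := fun x => Num.min 1 x) (g' := fun x => mine 1%E x)) => //.
- exact: measurable_psi.
- exact: measurable_minr.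
- by rewrite mul0r /psi powR0 ?gt_eqF// minxx.
- exact: psi0.
- by move=> x x0; rewrite le_min ler01.
- by move=> x x0; rewrite le_min lee01.
- by move=> x; rewrite EFin_min.
Qed.

End sampling.

(** * The sum norm *)

Section dyadic_bounds.
Context {R : realType} (s p : R) (p0 : 0 < p) (ps : p < s).

(** A level d above [b] contributes b^s d^(-(s - p)), which decays geometrically because [p < s]. *)
Lemma dyadic_tail (eps b : R) (L : nat) : 0 < eps -> 0 <= b ->
  \sum_(k < L) (b < dyad eps k)%R%:R * (dyad eps k `^ p * (b / dyad eps k) `^ s)
    <= geo (s - p) * b `^ p.
Proof.
move=> e0 b0; have s0 : 0 < s by apply: lt_trans ps.
have [->|bn0] := eqVneq b 0.
  rewrite powR0 ?gt_eqF// mulr0 big1// => k _.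
  by rewrite mul0r powR0 ?gt_eqF// !mulr0.
have bp : 0 < b by rewrite lt_neqAle eq_sym bn0.
rewrite (eq_bigr (fun k : 'I_L => b `^ s * ((b < dyad eps k)%R%:R * dyad eps k `^ (- (s - p))))); last first.
  move=> k _; have d0 := dyad_gt0 k e0.
  rewrite powRM ?invr_ge0 ?(ltW d0)// -powR_inv1 ?(ltW d0)// -powRrM mulN1r opprB.
  rewrite (_ : dyad eps k `^ (p - s) = dyad eps k `^ p * dyad eps k `^ (- s)); first by ring.
  by rewrite powRD// (gt_eqF d0) implybT.
rewrite -mulr_sumr; apply: (@le_trans _ _ (b `^ s * (geo (s - p) * b `^ (- (s - p))))).
  by rewrite ler_wpM2l ?powR_ge0// dyadic_sum_gt// subr_gt0.
rewrite mulrCA ler_wpM2l ?(ltW (geo_gt0 _)) ?subr_gt0//.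
by rewrite -powRD ?bn0 ?implybT// opprB addrC subrK.
Qed.

Lemma dyadic_min_sum (eps b : R) (L : nat) : 0 < eps -> 0 <= b ->
  \sum_(k < L) dyad eps k `^ p * Num.min 1 ((b / dyad eps k) `^ s)
    <= (geo p + geo (s - p)) * b `^ p.
Proof.
move=> e0 b0; rewrite mulrDl.
apply: le_trans (lerD (dyadic_sum_le L p0 e0 b0) (dyadic_tail L e0 b0)).
rewrite -big_split/=; apply: ler_sum => k _.
have [db|bd] := leP (dyad eps k) b.
  by rewrite mul1r mul0r addr0 ler_piMr ?powR_ge0// ge_min lexx.
by rewrite mul0r mul1r add0r ler_wpM2l ?powR_ge0// ge_min lexx orbT.
Qed.

(** Levels d up to [b] use psi(u) <= u and contribute at most b d^(p - 1), a geometric growth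
    because [1 < p]. Higher levels use psi(u) <= u^s and fall under [dyadic_tail]. *)
Lemma dyadic_psi_sum (eps b : R) (L : nat) : 1 < p -> 0 < eps -> 0 <= b ->
  \sum_(k < L) dyad eps k `^ p * psi s (b / dyad eps k)
    <= (geo (p - 1) + geo (s - p)) * b `^ p.
Proof.
move=> p1 e0 b0; rewrite mulrDl.
have -> : geo (p - 1) * b `^ p = b * (geo (p - 1) * b `^ (p - 1)).
  have [->|bn0] := eqVneq b 0; first by rewrite powR0 ?gt_eqF// mul0r mulr0.
  rewrite mulrCA; congr (_ * _); rewrite -[X in X * _]powRr1// -powRD ?bn0 ?implybT//.
  by rewrite addrC subrK.
have p10 : 0 < p - 1 by rewrite subr_gt0.
apply: le_trans (lerD (ler_wpM2l b0 (dyadic_sum_le L p10 e0 b0)) (dyadic_tail L e0 b0)).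
rewrite mulr_sumr -big_split/=; apply: ler_sum => k _; have d0 := dyad_gt0 k e0.
have [db|bd] := leP (dyad eps k) b.
  rewrite mul1r mul0r addr0; apply: (@le_trans _ _ (dyad eps k `^ p * (b / dyad eps k))).
    by rewrite ler_wpM2l ?powR_ge0// ge_min lexx.
  by rewrite powRB ?(gt_eqF d0) ?implybT// powRr1 ?(ltW d0)//; rewrite mulrCA.
by rewrite mul0r mulr0 mul1r add0r ler_wpM2l ?powR_ge0// ge_min lexx orbT.
Qed.

Local Open Scope ereal_scope.

Lemma dyadic_mine_sum (eps : R) (a : \bar R) (L : nat) : (0 < eps)%R -> 0 <= a ->
  \sum_(k < L) (dyad eps k `^ p)%:E * mine 1 (a * (dyad eps k `^ (- s))%:E)
    <= (geo p + geo (s - p))%:E * a `^ (p / s).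
Proof.
move=> e0; have s0 : (0 < s)%R by apply: lt_trans ps.
have c0 : (0 < geo p + geo (s - p))%R by rewrite addr_gt0 ?geo_gt0// subr_gt0.
case: a => [a a0||//]; last first.
  by move=> _; rewrite poweRyr ?gt_eqF ?divr_gt0// gt0_muley ?leey// lte_fin.
rewrite lee_fin in a0; rewrite poweR_EFin -EFinM.
(* The scalar sum is used with the L^s norm a^(1/s) in the role of [b]. *)
rewrite (eq_bigr (fun k : 'I_L => (dyad eps k `^ p * Num.min 1 ((a `^ s^-1 / dyad eps k) `^ s))%:E)); last first.
  move=> k _; have d0 := dyad_gt0 k e0.
  rewrite -EFinM -EFin_min -EFinM; congr (_ * Num.min _ _)%:E.
  rewrite powRM ?powR_ge0 ?invr_ge0 ?(ltW d0)// -powRrM mulVf ?gt_eqF// powRr1//.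
  by rewrite -powR_inv1 ?(ltW d0)// -powRrM mulN1r.
rewrite sumEFin lee_fin; apply: (le_trans (dyadic_min_sum _ e0 (powR_ge0 _ _))).
by rewrite -powRrM mulrC [(s^-1 * p)%R]mulrC mulrC.
Qed.

End dyadic_bounds.

Section roots.
Context {R : realType}.
Local Open Scope ereal_scope.

Lemma root_le_max (S A B : \bar R) (c p : R) : (0 < p)%R -> (0 <= c)%R -> 0 <= S ->
  0 <= A -> 0 <= B -> S <= c%:E * (A + B) ->
  S `^ p^-1 <= ((2 * c) `^ p^-1)%:E * maxe (A `^ p^-1) (B `^ p^-1).
Proof.
move=> p0 c0 S0 A0 B0 H.
have ip : (0 <= p^-1)%R by rewrite invr_ge0 ltW.
have mono (x y : \bar R) : 0 <= x -> x <= y -> x `^ p^-1 <= y `^ p^-1.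
  by move=> x0 xy; apply: gt0_ler_poweR; rewrite // ?in_itv/= leey ?x0 ?(le_trans x0 xy).
wlog AB : A B A0 B0 H / A <= B.
  move=> W; have [|BA] := leP A B; first exact: W.
  by rewrite maxC; apply: W => //; [rewrite addeC|exact: ltW].
rewrite max_r; last exact: mono.
rewrite -poweR_EFin -poweRM ?lee_fin ?mulr_ge0//.
apply: mono => //; apply: (le_trans H).
rewrite EFinM [2%:E * _]muleC -muleA; apply: lee_wpmul2l; first by rewrite lee_fin.
by rewrite mule_natl mule2n leeD2r.
Qed.

End roots.

(** Only the first part stays truncated. Its sum over levels would otherwise degenerate as eps tends
    to 0, while the second part is already tamed by [psi]. *)
Lemma mine1D {R : realType} (x y : \bar R) : (0 <= x -> 0 <= y ->
  mine 1 (4%:E * (x + y)) <= 4%:E * (mine 1 x + y))%E.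
Proof.
move=> x0 y0; have [x1|x1] := leP x 1%E; first by rewrite ge_min lexx orbT.
rewrite ge_min; apply/orP; left; apply: (@le_trans _ _ (4%:E * 1)%E).
  by rewrite mule1 lee_fin ler1n.
by apply: lee_wpmul2l; rewrite ?lee_fin// leeDl.
Qed.

Lemma le_ae_integral_in {R : realType} {d} {Z : measurableType d} (mu : {measure set Z -> \bar R})
    (H : set Z) (f g : Z -> \bar R) : measurable H -> measurable_fun H g ->
  (forall z, 0 <= f z)%E -> (forall z, 0 <= g z)%E ->
  {ae mu, forall z, H z -> (f z <= g z)%E} ->
  (\int[mu]_(z in H) f z <= \int[mu]_(z in H) g z)%E.
Proof.
move=> mH mg f0 g0 fg; rewrite integral_mkcond [leRHS]integral_mkcond.
have r0 (u : Z -> \bar R) : (forall z, 0 <= u z)%E -> forall z, (0 <= (u \_ H) z)%E.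
  by move=> u0 z; rewrite patchE; case: ifP.
apply: le_integral_ae; [exact: (iffLR (measurable_restrictT _ mH))|exact: r0|exact: r0|].
apply: filterS fg => z; rewrite !patchE; case: ifPn => // /set_mem Hz; exact.
Qed.

Section decomposition.
Context {R : realType} {d : measure_display} {T : measurableType d} (P : probability T R)
  {dZ : measure_display} {Z : measurableType dZ}
  (mu : {sigma_finite_measure set Z -> \bar R}) (H : set Z) (mH : measurable H).
Local Open Scope ereal_scope.

Lemma measurable_section_integral (g : T * Z -> R) : measurable_fun setT g ->
  (forall q, 0 <= g q)%R -> measurable_fun setT (fun w => \int[mu]_(z in H) (g (w, z))%:E).
Proof.
move=> mg g0.
rewrite (_ : (fun w => _) = fun w => \int[mu]_z ((fun q => if q.2 \in H then (g q)%:E else 0) (w, z))).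
  apply: (@measurable_fun_fubini_tonelli_F _ _ _ _ _ mu (fun q : T * Z => if q.2 \in H then (g q)%:E else 0)).
    apply: measurable_fun_ifT => //; last exact/measurable_EFinP.
    apply: (measurable_fun_bool true); rewrite setTI (_ : _ @^-1` _ = setT `*` H).
      exact: measurableX.
    by apply/seteqP; split => q /=; [move=> /set_mem|move=> [_] /mem_set].
  by move=> q; case: ifP => // _; rewrite lee_fin.
by apply/funext => w; rewrite integral_mkcond; apply: eq_integral => z _; rewrite patchE.
Qed.

Lemma measurable_section (g : T * Z -> R) w : measurable_fun setT g ->
  measurable_fun H (fun z => (g (w, z))%:E).
Proof.
move=> mg; apply: measurable_funTS; apply/measurable_EFinP.
exact: (measurableT_comp mg (pair1_measurable w)).
Qed.

Context {X : normedModType R} (s : R) (s1 : (1 <= s)%R) (s2 : (s <= 2)%R).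
Variables (phi f0 f1 : T -> Z -> X).
Hypotheses (mf0 : measurable_fun setT (fun q : T * Z => `|f0 q.1 q.2|%R))
  (mf1 : measurable_fun setT (fun q : T * Z => `|f1 q.1 q.2|%R))
  (dec : {ae P, forall w, {ae mu, forall z, H z -> phi w z = (f0 w z + f1 w z)%R}}).

Let mpow (f : T -> Z -> X) (a : R) : measurable_fun setT (fun q : T * Z => `|f q.1 q.2|%R) ->
  measurable_fun setT (fun q : T * Z => (`|f q.1 q.2| `^ a)%R).
Proof. by move=> mf; exact: (measurableT_comp (measurable_powR a) mf). Qed.

Let alpha w := \int[mu]_(z in H) ((`|f0 w z| `^ s)%R)%:E.
Let G (l : R) w := \int[mu]_(z in H) (psi s (`|f1 w z| / l))%:E.

Let mG l : (0 < l)%R -> measurable_fun setT (fun q : T * Z => psi s (`|f1 q.1 q.2| / l)).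
Proof. by move=> l0; exact: (measurableT_comp (measurable_psi _ _) mf1). Qed.

Let psi0 l (x : X) : (0 < l)%R -> (0 <= psi s (`|x| / l))%R.
Proof. by move=> l0; apply: psi_ge0; rewrite divr_ge0// ltW. Qed.

Let alpha_ge0 w : 0 <= alpha w.
Proof. by apply: integral_ge0 => z _; rewrite lee_fin powR_ge0. Qed.

Let G_ge0 l w : (0 < l)%R -> 0 <= G l w.
Proof. by move=> l0; apply: integral_ge0 => z _; rewrite lee_fin psi0. Qed.

(** The parts are treated differently: for [f0], psi(u) <= u^s makes the level factor out, while
    [f1] keeps [psi] so that levels can be summed at each point. *)
Lemma integral_psi_split (l : R) : (0 < l)%R -> {ae P, forall w,
  \int[mu]_(z in H) (psi s (`|phi w z| / l))%:E
   <= 4%:E * (alpha w * (l `^ (- s))%:E + G l w)}.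
Proof.
move=> l0; apply: filterS dec => w decw.
have ls0 : 0 <= (l `^ (- s))%:E by rewrite lee_fin powR_ge0.
have mal : measurable_fun H (fun z => ((`|f0 w z| `^ s)%R)%:E).
  exact: (measurable_section w (mpow s mf0)).
have mGl : measurable_fun H (fun z => (psi s (`|f1 w z| / l))%:E).
  exact: (measurable_section w (mG l0)).
rewrite [alpha w * _]muleC /alpha /G -ge0_integralZl//.
rewrite -ge0_integralD//; last 3 first.
- by move=> z _; rewrite mule_ge0// lee_fin powR_ge0.
- exact: measurable_funeM.
- by move=> z _; rewrite lee_fin psi0.
rewrite -ge0_integralZl//; last 2 first.
- by apply: emeasurable_funD => //; exact: measurable_funeM.
- by move=> z _; rewrite adde_ge0 ?mule_ge0 ?lee_fin ?powR_ge0 ?psi0.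
apply: le_ae_integral_in => //.
- by apply: measurable_funeM; apply: emeasurable_funD => //; exact: measurable_funeM.
- by move=> z; rewrite lee_fin psi0.
- by move=> z; rewrite mule_ge0// adde_ge0 ?mule_ge0 ?lee_fin ?powR_ge0 ?psi0.
apply: filterS decw => z /[apply] ->; rewrite -!EFinM lee_fin.
have s0 : (0 <= s)%R by apply: le_trans s1.
have il0 : (0 <= l^-1)%R by rewrite invr_ge0 ltW.
apply: (@le_trans _ _ (psi s (`|f0 w z| / l + `|f1 w z| / l))).
  apply: psi_le => //; first by rewrite mulr_ge0.
  by rewrite -mulrDl ler_wpM2r// ler_normD.
apply: (le_trans (psiD s1 s2 _ _)); rewrite ?mulr_ge0//.
rewrite ler_wpM2l// lerD2r; apply: (@le_trans _ _ ((`|f0 w z| / l) `^ s)%R).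
  by rewrite /psi ge_min lexx orbT.
by rewrite powRM// -powR_inv1 ?(ltW l0)// -powRrM mulN1r mulrC.
Qed.

(** Serves the endpoint [p = s], where the sums over levels give no bound and both spaces of the sum
    norm coincide. *)
Lemma integral_pow_split :
  \int[P]_w \int[mu]_(z in H) ((`|phi w z| `^ s)%R)%:E
  <= (2 `^ s)%:E * (\int[P]_w \int[mu]_(z in H) ((`|f0 w z| `^ s)%R)%:E
                    + \int[P]_w \int[mu]_(z in H) ((`|f1 w z| `^ s)%R)%:E).
Proof.
have s0 : (0 <= s)%R by apply: le_trans s1.
pose alpha1 w := \int[mu]_(z in H) ((`|f1 w z| `^ s)%R)%:E.
have alpha1_ge0 w : 0 <= alpha1 w by apply: integral_ge0 => z _; rewrite lee_fin powR_ge0.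
have malpha : measurable_fun setT alpha.
  by apply: (measurable_section_integral (mpow s mf0)) => q; exact: powR_ge0.
have malpha1 : measurable_fun setT alpha1.
  by apply: (measurable_section_integral (mpow s mf1)) => q; exact: powR_ge0.
have sum0 w : 0 <= alpha w + alpha1 w := adde_ge0 (alpha_ge0 w) (alpha1_ge0 w).
pose alphap w := \int[mu]_(z in H) ((`|phi w z| `^ s)%R)%:E.
suff : \int[P]_w alphap w <= (2 `^ s)%:E * (\int[P]_w alpha w + \int[P]_w alpha1 w) by [].
rewrite -(ge0_integralD P measurableT (fun w _ => alpha_ge0 w) malpha (fun w _ => alpha1_ge0 w) malpha1).
rewrite -(ge0_integralZl P measurableT (emeasurable_funD malpha malpha1) (fun w _ => sum0 w)); last first.
  by rewrite lee_fin powR_ge0.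
apply: le_integral_ae.
- by apply: measurable_funeM; exact: emeasurable_funD.
- by move=> w; apply: integral_ge0 => z _; rewrite lee_fin powR_ge0.
- by move=> w; apply: mule_ge0 (sum0 w); rewrite lee_fin powR_ge0.
apply: filterS dec => w decw.
have m0 : measurable_fun H (fun z => ((`|f0 w z| `^ s)%R)%:E).
  exact: (measurable_section w (mpow s mf0)).
have m1 : measurable_fun H (fun z => ((`|f1 w z| `^ s)%R)%:E).
  exact: (measurable_section w (mpow s mf1)).
have z0 (f : T -> Z -> X) z : 0 <= ((`|f w z| `^ s)%R)%:E by rewrite lee_fin powR_ge0.
rewrite /alphap /alpha /alpha1 -ge0_integralD// -ge0_integralZl//; last 2 first.
- exact: emeasurable_funD.
- by move=> z _; exact: adde_ge0 (z0 f0 z) (z0 f1 z).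
apply: le_ae_integral_in => //.
- by apply: measurable_funeM; exact: emeasurable_funD.
- by move=> z; rewrite mule_ge0 ?lee_fin ?powR_ge0//; exact: adde_ge0.
apply: filterS decw => z /[apply] ->; rewrite -EFinD -EFinM lee_fin.
apply: (@le_trans _ _ ((2 * Num.max `|f0 w z| `|f1 w z|) `^ s)%R).
  apply: powR_le => //; apply: (le_trans (ler_normD _ _)).
  by rewrite mulr_natl mulr2n lerD// le_max lexx ?orbT.
rewrite powRM ?le_max ?normr_ge0// ler_wpM2l ?powR_ge0//.
by have [_|_] := leP `|f0 w z|%R; rewrite ?lerDl ?lerDr powR_ge0.
Qed.

Variable p : R.
Hypotheses (p1 : (1 < p)%R) (ps : (p < s)%R).

Let p0 : (0 < p)%R. Proof. exact: lt_trans p1. Qed.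
Let s0 : (0 < s)%R. Proof. exact: lt_trans ps. Qed.
Let c1 : R := (geo p + geo (s - p))%R.
Let c2 : R := (geo (p - 1) + geo (s - p))%R.
Let beta w := \int[mu]_(z in H) ((`|f1 w z| `^ p)%R)%:E.

Let c1_gt0 : (0 < c1)%R. Proof. by rewrite addr_gt0 ?geo_gt0 ?subr_gt0. Qed.
Let c2_gt0 : (0 < c2)%R. Proof. by rewrite addr_gt0 ?geo_gt0 ?subr_gt0. Qed.

Let beta_ge0 w : 0 <= beta w.
Proof. by apply: integral_ge0 => z _; rewrite lee_fin powR_ge0. Qed.

Let sum_G (eps : R) L w : (0 < eps)%R ->
  \sum_(k < L) (dyad eps k `^ p)%:E * G (dyad eps k) w <= c2%:E * beta w.
Proof.
move=> e0; have d0 k : (0 < dyad eps k)%R by exact: dyad_gt0.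
have mGl k : measurable_fun H (fun z => (psi s (`|f1 w z| / dyad eps k))%:E).
  exact: (measurable_section w (mG (d0 k))).
have mb : measurable_fun H (fun z => ((`|f1 w z| `^ p)%R)%:E).
  exact: (measurable_section w (mpow p mf1)).
rewrite (eq_bigr (fun k : 'I_L => \int[mu]_(z in H)
    ((dyad eps k `^ p)%:E * (psi s (`|f1 w z| / dyad eps k))%:E))); last first.
  by move=> k _; rewrite ge0_integralZl ?lee_fin ?powR_ge0// => z _; rewrite lee_fin psi0.
rewrite -ge0_integral_sum//; last 2 first.
- by move=> k; exact: measurable_funeM.
- by move=> k z _; rewrite mule_ge0// lee_fin ?powR_ge0 ?psi0.
rewrite /beta -ge0_integralZl//; last by rewrite lee_fin ltW.
apply: le_ae_integral_in => //.
- exact: measurable_funeM.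
- by move=> z; apply: sume_ge0 => k _; rewrite mule_ge0// lee_fin ?powR_ge0 ?psi0.
- by move=> z; rewrite mule_ge0// lee_fin ?powR_ge0// ltW.
apply: nearW => z _; under eq_bigr do rewrite -EFinM.
by rewrite sumEFin -EFinM lee_fin; exact: dyadic_psi_sum.
Qed.

(** The constant is free of [eps], so [eps] can be sent to 0 afterwards. Levels are summed inside
    both integrals: [dyadic_mine_sum] handles [f0] for each [w], and [dyadic_psi_sum] handles [f1]
    at each point. *)
Lemma sum_integral_psi_le (eps : R) : (0 < eps)%R ->
  \sum_(k <oo) (dyad eps k `^ p)%:E * \int[P]_w mine 1
     (\int[mu]_(z in H) (psi s (`|phi w z| / dyad eps k))%:E)
  <= (4 * (geo p + geo (s - p) + (geo (p - 1) + geo (s - p))))%:E *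
     (\int[P]_w (\int[mu]_(z in H) ((`|f0 w z| `^ s)%R)%:E) `^ (p / s)
      + \int[P]_w \int[mu]_(z in H) ((`|f1 w z| `^ p)%R)%:E).
Proof.
move=> e0; have d0 k : (0 < dyad eps k)%R by exact: dyad_gt0.
pose A k w := mine 1 (alpha w * (dyad eps k `^ (- s))%:E).
pose U k w := 4%:E * (A k w + G (dyad eps k) w).
have malpha : measurable_fun setT alpha.
  by apply: (measurable_section_integral (mpow s mf0)) => q; exact: powR_ge0.
have mbeta : measurable_fun setT beta.
  by apply: (measurable_section_integral (mpow p mf1)) => q; exact: powR_ge0.
have mGk k : measurable_fun setT (G (dyad eps k)).
  by apply: (measurable_section_integral (mG (d0 k))) => q; exact: psi0.
have A0 k w : 0 <= A k w.
  by rewrite le_min lee01 mule_ge0 ?alpha_ge0// lee_fin powR_ge0.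
have mA k : measurable_fun setT (A k).
  by apply: measurable_mine => //; exact: emeasurable_funM.
have U0 k w : 0 <= U k w by rewrite mule_ge0// adde_ge0 ?G_ge0.
have mU k : measurable_fun setT (U k).
  by apply: measurable_funeM; exact: emeasurable_funD.
apply: nneseries_le => [k|L].
  rewrite mule_ge0 ?lee_fin ?powR_ge0//; apply: integral_ge0 => w _.
  rewrite le_min lee01/=; apply: integral_ge0 => z _; rewrite lee_fin; exact: psi0.
apply: (@le_trans _ _ (\sum_(k < L) (dyad eps k `^ p)%:E * \int[P]_w U k w)).
  apply: lee_sum => k _; apply: lee_wpmul2l; first by rewrite lee_fin powR_ge0.
  apply: le_integral_ae => //.
    move=> w; rewrite le_min lee01/=; apply: integral_ge0 => z _; rewrite lee_fin; exact: psi0.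
  apply: filterS (integral_psi_split (d0 k)) => w Hw.
  apply: (le_trans _ (mine1D _ _)); last 2 first.
  - by rewrite mule_ge0 ?lee_fin ?powR_ge0.
  - exact: G_ge0.
  by rewrite le_min !ge_min lexx Hw orbT.
rewrite (eq_bigr (fun k : 'I_L => \int[P]_w ((dyad eps k `^ p)%:E * U k w))); last first.
  move=> k _; apply/esym/ge0_integralZl => //.
  by rewrite lee_fin powR_ge0.
rewrite -ge0_integral_sum//; last 2 first.
- by move=> k; exact: measurable_funeM.
- by move=> k w _; rewrite mule_ge0// lee_fin powR_ge0.
have mas : measurable_fun setT (fun w => alpha w `^ (p / s)).
  exact: (measurableT_comp (measurable_poweR _)).
rewrite -ge0_integralD//; last 2 first.
- by move=> w _; exact: poweR_ge0.
- by move=> w _; exact: beta_ge0.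
rewrite -ge0_integralZl//; last 3 first.
- exact: emeasurable_funD.
- by move=> w _; exact: adde_ge0 (poweR_ge0 _ _) (beta_ge0 w).
- by rewrite lee_fin mulr_ge0// ltW// addr_gt0.
apply: le_integral_nonmeasurable => w.
  by apply: sume_ge0 => k _; rewrite mule_ge0// lee_fin powR_ge0.
rewrite (eq_bigr (fun k : 'I_L => 4%:E * ((dyad eps k `^ p)%:E * A k w +
    (dyad eps k `^ p)%:E * G (dyad eps k) w))); last first.
  by move=> k _; rewrite /U muleCA ge0_muleDr ?G_ge0.
rewrite -ge0_sume_distrr; last first.
  by move=> k _; rewrite adde_ge0// mule_ge0 ?G_ge0// lee_fin powR_ge0.
rewrite EFinM -muleA; apply: lee_wpmul2l; first by rewrite lee_fin.
rewrite big_split/= [leRHS](ge0_muleDr _ (poweR_ge0 _ _) (beta_ge0 w)); apply: leeD.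
  apply: (le_trans (dyadic_mine_sum p0 ps L e0 (alpha_ge0 w))).
  by apply: lee_wpmul2r; [exact: poweR_ge0|rewrite lee_fin lerDl ltW].
apply: (le_trans (sum_G L w e0)).
by apply: lee_wpmul2r; [exact: beta_ge0|rewrite lee_fin lerDr ltW].
Qed.

End decomposition.

(** * The two inequalities *)

Lemma double_bound {R : realType} (m c : R) (S A B : \bar R) : 0 <= m -> (
   S <= m%:E * (A + A) -> A <= c%:E * B -> S <= (2 * m * c)%:E * B)%E.
Proof.
move=> m0 HS HA; apply: (le_trans HS).
apply: (@le_trans _ _ (m%:E * (c%:E * B + c%:E * B))%E).
  by rewrite lee_wpmul2l ?lee_fin// leeD.
by rewrite -mule2n -mule_natl !muleA -!EFinM [(m * 2)%R]mulrC.
Qed.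

Section intensity.
Context {R : realType} {dJ : measure_display} {J : measurableType dJ}
  (nu : {sigma_finite_measure set J -> \bar R}).

(* The canonical sigma-finite structure of [\x] is only inferred for
   probability measures, hence this alias. *)
Definition intensity : set (measurableTypeR R * J) -> \bar R := (lebesgue_measure \x nu)%E.

HB.instance Definition _ := Measure.on intensity.

Let intensity_sigma_finite : sigma_finite setT intensity.
Proof.
have [F FT mF] : sigma_finite setT (@lebesgue_measure R) by exact: sigma_finiteT.
have [G GT mG] := sigma_finiteT nu.
exists (fun n => if @unpickle (nat * nat)%type n is Some k then F k.1 `*` G k.2 else set0).
  apply/esym; rewrite -subTset => -[x y] _.
  have [i _ Fx] : (\bigcup_n F n) x by rewrite -FT.
  have [j _ Gy] : (\bigcup_n G n) y by rewrite -GT.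
  by exists (pickle (i, j)) => //; rewrite pickleK.
move=> n; case: unpickle => [k|]; last by split; [exact: measurable0|rewrite measure0].
have [mFk Fk] := mF k.1; have [mGk Gk] := mG k.2; split; first exact: measurableX.
rewrite /intensity; have -> : (lebesgue_measure \x nu)%E (F k.1 `*` G k.2) =
    (lebesgue_measure (F k.1) * nu (G k.2))%E by exact: product_measure1E.
by rewrite lte_mul_pinfty// ge0_fin_numE.
Qed.

HB.instance Definition _ := Measure_isSigmaFinite.Build _ _ _ intensity intensity_sigma_finite.

End intensity.

Section main.
Context {R : realType} {X : normedModType R} (s K : R).
Hypotheses (s1 : 1 < s) (s2 : s <= 2) (K0 : 0 < K) (mart : @martingale_bound R X s K).
Context {dJ : measure_display} {J : measurableType dJ}
  (nu : {sigma_finite_measure set J -> \bar R})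
  {d : measure_display} {T : measurableType d} (P : probability T R)
  (N : T -> {measure set (measurableTypeR R * J) -> \bar R}).
Hypothesis HN : poisson_random_measure P half_line_times (lebesgue_measure \x nu)%E N.
Variables (phi : simple_process X J T) (B : set J).
Hypotheses (Hphi : simple_adapted P nu N phi) (mB : measurable B).
Local Open Scope ereal_scope.

Let mu : {sigma_finite_measure set (measurableTypeR R * J)%type -> \bar R} :=
  intensity nu.
Let sup_moment (p : R) : \bar R :=
  \int[P]_w ereal_sup [set ((`|sp_integral nu N phi B u w| `^ p)%R)%:E | u in [set u | (0 < u)%R]].
Let lower (f : T -> measurableTypeR R * J -> X) (p q : R) : \bar R :=
  \int[P]_w (\int[mu]_(z in half_line_times) ((`|f w z| `^ q)%R)%:E) `^ (p / q).
Let diag (f : T -> measurableTypeR R * J -> X) (p : R) : \bar R :=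
  \int[P]_w \int[mu]_(z in half_line_times) ((`|f w z| `^ p)%R)%:E.

Let lower_diag f p : p != 0%R -> lower f p p = diag f p.
Proof.
move=> p0; apply: eq_integral => w _; rewrite divff// poweRe1//.
by apply: integral_ge0 => z _; rewrite lee_fin powR_ge0.
Qed.

Let lower_ge0 f p q : 0 <= lower f p q.
Proof. by apply: integral_ge0 => w _; exact: poweR_ge0. Qed.

Let sup_moment_ge0 p : 0 <= sup_moment p.
Proof.
apply: integral_ge0 => w _.
apply: (@le_trans _ _ ((`|sp_integral nu N phi B 1 w| `^ p)%R)%:E).
  by rewrite lee_fin powR_ge0.
by apply: ereal_sup_ubound; exists 1%R => //=.
Qed.

Let s1' : (1 <= s)%R := ltW s1.

Let phiB := sp_restrict phi B.

Let large (p : R) : (s <= p)%R ->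
  sup_moment p <= (moment_const s K p)%:E * (lower phiB p s + diag phiB p).
Proof.
move=> sp; have [F [HF FE]] := bounded_coefficients Hphi.
exact: (sup_moment_large HN Hphi mB HF FE s1' K0 mart sp).
Qed.

Let small (p eps : R) : (0 < p)%R -> (0 < eps)%R ->
  sup_moment p <= ((2 * eps) `^ p)%:E + (small_const s K p)%:E *
   \sum_(k <oo) (dyad eps k `^ p)%:E * \int[P]_w mine 1
     (\int[mu]_(z in half_line_times) (psi s (`|phiB w z| / dyad eps k))%:E).
Proof.
move=> p0 e0; have [F [HF FE]] := bounded_coefficients Hphi.
exact: (sup_moment_small HN Hphi mB HF FE s1' K0 mart p0 e0).
Qed.

Lemma maximal_norm_le_cap (p : R) : (s <= p)%R ->
  maximal_norm nu P N p phi B <=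
  ((2 * moment_const s K p) `^ p^-1)%:E * Dcap_norm nu P p s p (sp_restrict phi B).
Proof.
move=> sp; have p0 : (0 < p)%R by apply: lt_le_trans sp; exact: lt_trans s1.
have := large sp; rewrite -[diag _ p]lower_diag ?gt_eqF// => H.
exact: (root_le_max p0 (ltW (moment_const_gt0 s K0 p0)) (sup_moment_ge0 p)
  (lower_ge0 _ _ _) (lower_ge0 _ _ _) H).
Qed.

(** At [p = s] the quantity [geo (s - p)] would divide by zero; there the constant comes from
    [large] followed by [integral_pow_split]. *)
Definition sum_const (p : R) : R :=
  (if p == s then 2 * moment_const s K s * 2 `^ s
   else small_const s K p * (4 * (geo p + geo (s - p) + (geo (p - 1) + geo (s - p)))))%R.

Let small_const_gt0 (p : R) : (0 < small_const s K p)%R.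
Proof.
rewrite /small_const mulr_gt0 ?powR_gt0// addr_gt0 ?poisson_const_gt0//.
by rewrite addr_gt0// mulr_gt0 ?poisson_const_gt0.
Qed.

Lemma sum_const_gt0 (p : R) : (1 < p)%R -> (p <= s)%R -> (0 < sum_const p)%R.
Proof.
move=> p1 ps; rewrite /sum_const; have [_|psn] := eqVneq p s.
  by rewrite mulr_gt0 ?powR_gt0// mulr_gt0// moment_const_gt0// (lt_trans _ s1).
have psl : (p < s)%R by rewrite lt_neqAle psn.
rewrite mulr_gt0// mulr_gt0// !addr_gt0 ?geo_gt0 ?subr_gt0//; exact: lt_trans p1.
Qed.

Let sup_moment_decomposition (p : R) f0 f1 : (1 < p)%R -> (p <= s)%R ->
  Dspace nu P p s f0 -> Dspace nu P p p f1 ->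
  {ae P, forall w, {ae lebesgue_measure \x nu, forall z,
     half_line_times z -> sp_restrict phi B w z = (f0 w z + f1 w z)%R}} ->
  sup_moment p <= (sum_const p)%:E * (lower f0 p s + lower f1 p p).
Proof.
move=> p1 ps [/norm_strongly_measurableT mf0 _] [/norm_strongly_measurableT mf1 _] dec.
have p0 : (0 < p)%R by apply: lt_trans p1.
have mH : measurable (half_line_times : set (measurableTypeR R * J)%type) := measurable_half_line.
have sn0 : (s != 0)%R by rewrite gt_eqF// (lt_trans _ s1).
rewrite [lower f1 p p]lower_diag ?gt_eqF// /sum_const.
have [psE|psn] := eqVneq p s.
  (* At the endpoint both terms of [large] are the same diagonal integral, which explains the factor
     2. *)
  rewrite psE (lower_diag f0 sn0).
  have Hs : sup_moment s <= (moment_const s K s)%:E * (diag phiB s + diag phiB s).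
    by rewrite -[X in _ * (X + _)](lower_diag phiB sn0); exact: large.
  apply: (double_bound _ Hs); first by rewrite ltW// moment_const_gt0// (lt_trans _ s1).
  exact: (integral_pow_split (P := P) (mu := mu) mH s1' mf0 mf1 dec).
have psl : (p < s)%R by rewrite lt_neqAle psn.
apply/lee_addgt0Pr => e e0.
(* Chosen so that the error term of [small], the p-th power of [2 * eps], equals [e]. *)
pose eps : R := (e `^ p^-1 / 2)%R.
have eps0 : (0 < eps)%R by rewrite divr_gt0// powR_gt0.
apply: (le_trans (small p0 eps0)).
rewrite addeC (EFinM (small_const s K p)) -muleA; apply: leeD.
  apply: lee_wpmul2l; first by rewrite lee_fin ltW.
  exact: (sum_integral_psi_le (P := P) (mu := mu) mH s1' s2 mf0 mf1 dec p1 psl eps0).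
by rewrite lee_fin /eps mulrCA divff// mulr1 -powRrM mulVf ?gt_eqF// powRr1// ltW.
Qed.

Lemma maximal_norm_le_sum (p : R) : (1 < p)%R -> (p <= s)%R ->
  maximal_norm nu P N p phi B <=
  ((2 * sum_const p) `^ p^-1)%:E * Dsum_norm nu P p s p (sp_restrict phi B).
Proof.
move=> p1 ps; have p0 : (0 < p)%R by apply: lt_trans p1.
have c0 : (0 < (2 * sum_const p) `^ p^-1)%R by rewrite powR_gt0// mulr_gt0// sum_const_gt0.
rewrite -lee_pdivrMl//; apply: le_ereal_inf_tmp => _ [f0 [f1 [D0 D1 dec ->]]].
rewrite lee_pdivrMl//.
have H := sup_moment_decomposition p1 ps D0 D1 dec.
apply: (le_trans (root_le_max p0 (ltW (sum_const_gt0 p1 ps)) (sup_moment_ge0 _) (lower_ge0 _ _ _)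
  (lower_ge0 _ _ _) H)).
apply: lee_wpmul2l; first by rewrite lee_fin ltW.
by rewrite ge_max leeDl ?leeDr ?poweR_ge0.
Qed.

End main.

Theorem theorem2p11 (R : realType) (X : completeNormedModType R) (s : R)
    (s_gt1 : 1 < s) (s_le2 : s <= 2) (X_type : martingale_type X s) :
  (forall p : R, s <= p ->
     exists C : R,
     forall (dJ : measure_display) (J : measurableType dJ)
       (nu : {sigma_finite_measure set J -> \bar R})
       (d : measure_display) (T : measurableType d) (P : probability T R)
       (N : T -> {measure set (measurableTypeR R * J) -> \bar R}),
     poisson_random_measure P half_line_times (lebesgue_measure \x nu)%E N ->
     forall (phi : simple_process X J T), simple_adapted P nu N phi ->
     forall B : set J, measurable B ->
     (maximal_norm nu P N p phi B
       <= C%:E * Dcap_norm nu P p s p (sp_restrict phi B))%E) /\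
  (forall p : R, 1 < p -> p <= s ->
     exists C : R,
     forall (dJ : measure_display) (J : measurableType dJ)
       (nu : {sigma_finite_measure set J -> \bar R})
       (d : measure_display) (T : measurableType d) (P : probability T R)
       (N : T -> {measure set (measurableTypeR R * J) -> \bar R}),
     poisson_random_measure P half_line_times (lebesgue_measure \x nu)%E N ->
     forall (phi : simple_process X J T), simple_adapted P nu N phi ->
     forall B : set J, measurable B ->
     (maximal_norm nu P N p phi B
       <= C%:E * Dsum_norm nu P p s p (sp_restrict phi B))%E).
Proof.
have s1' : 1 <= s by exact: ltW.
have [K K0 mart] := martingale_type_bound (lt_trans ltr01 s_gt1) X_type.
split=> p.
  move=> sp; exists ((2 * moment_const s K p) `^ p^-1) => dJ J nu d T P N HN phi Hphi B mB.
  exact: (maximal_norm_le_cap s_gt1 K0 mart HN Hphi mB sp).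
move=> p1 ps; exists ((2 * sum_const s K p) `^ p^-1) => dJ J nu d T P N HN phi Hphi B mB.
exact: (maximal_norm_le_sum s_gt1 s_le2 K0 mart HN Hphi mB p1 ps).
Qed.
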